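(* Suppose that $\Delta_n\to\Delta\in[0,1]$, $\lambda_n\to\lambda\in[0,1]$ and $\kappa_n\to\kappa\in[0,\infty]$. Let $\beta>0$ be a constant and set $\beta_c=1-\Delta-\kappa^{-1}\in[-\infty,1]$ (with $1/0=\infty$, $1/\infty=0$). (Low temperature) If $\beta>\beta_c$, then $\frac1n W_1(\mu_{G_n,\infty},\mu_{G_n,\beta})\to0$ in probability. (High temperature) If $\beta<\beta_c$, then there is a constant $C_\delta>0$ depending only on $\delta=\beta_c-\beta$ such that $\frac1nW_1(\mu_{G_n,\infty},\mu_{G_n,\beta})>C_\delta$ with probability at least $1-o(1)$.
   Context: Let $(\alpha_n)$ be a sequence in $(0,\infty)$ with $0<\liminf\alpha_n\le\limsup\alpha_n<\infty$, $q_n=\alpha_n\log n/n$, $G_n\sim\mathcal G(n,q_n)$ on $\{1,\dots,n\}$. Let $\ell_n^*=\log n/\log(nq_n)$, $d_n^*=\min\{d\in\mathbb Z:(nq_n)^d\ge n/(\log\log n)^2\}$, $\Delta_n=d_n^*-\ell_n^*$, $\lambda_n\in(0,1)$ with $\log(1/\lambda_n)=(nq_n)^{d_n^*}/n$, and $\kappa_n=(1-\lambda_n)\log\log n$. Let $\overline G_n$ be the component of $G_n$ containing $1$, vertex set $\overline V_n$. The Gibbs measure on spanning trees $T$ of $\overline G_n$ is $\mu_{G_n,\beta}(T)\propto\exp\big(-\beta\log\log(n)\sum_{v\in\overline V_n}\mathsf d_T(1,v)\big)$, and $\mu_{G_n,\infty}$ is the uniform measure on shortest path trees of $\overline G_n$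 (spanning trees with $\mathsf d_T(1,v)=\mathsf d_{G_n}(1,v)$ for all $v$). Trees are rooted at $1$; $W_1$ is the $1$-Wasserstein distance for the Hamming metric $d(T,T')=\#\{v\ne1:\text{the parent of }v\text{ in }T\text{ differs from that in }T'\}$. *)

(* Defs.v *)
From HB Require Import structures.
From mathcomp Require Export all_boot all_order all_algebra.
From mathcomp Require Export all_classical all_reals all_analysis.
Export Order.TTheory GRing.Theory Num.Theory.
Export numFieldNormedType.Exports.

Set Implicit Arguments.
Unset Strict Implicit.
Unset Printing Implicit Defensive.

Local Open Scope ring_scope.

(** * Finite graphs, given by their edge sets *)

Section Graphs.
Variable V : finType.
Implicit Types E T : {set {set V}}.

Definition vertex_pairs : {set {set V}} := [set e : {set V} | #|e| == 2%N]%SET.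

Definition adj E : rel V := fun x y => (x != y) && ([set x; y]%SET \in E).

Definition component E (r : V) : {set V} := [set v | connect (adj E) r v]%SET.

(* Graph distance: the least number of edges of a walk from [x] to [y]; the
   value is the junk [#|V|] when [x] and [y] are not connected. *)
Definition gdist E (x y : V) : nat :=
  find (fun k => [exists p : k.-tuple V, path (adj E) x p && (last x p == y)])
       (iota 0 #|V|).

Definition acyclic E : bool :=
  `[< forall c : seq V, (2 < size c)%N -> ~ ucycle (adj E) c >].

Definition is_tree (W : {set V}) T : bool :=
  [&& [forall e in T, e \subset W],
      [forall u in W, forall v in W, connect (adj T) u v] & acyclic T].

Definition spanning_trees E (r : V) : {set {set {set V}}} :=
  [set T : {set {set V}} | (T \subset E) && is_tree (component E r) T]%SET.

Definition shortest_path_trees E (r : V) : {set {set {set V}}} :=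
  [set T in spanning_trees E r
    | [forall v in component E r, gdist T r v == gdist E r v]]%SET.

Definition parent T (r v : V) : option V :=
  [pick u | adj T u v && (gdist T r v == (gdist T r u).+1)].

Definition hamming E (r : V) T T' : nat :=
  #|[set v in component E r | (v != r) && (parent T r v != parent T' r v)]%SET|.

End Graphs.

(** * Wasserstein distance between mass functions on a finite type *)

Section Wasserstein.
Variables (R : realType) (S : finType).

Definition coupling (mu nu : S -> R) (pi : S * S -> R) : Prop :=
  [/\ forall p, 0 <= pi p,
      forall x, \sum_y pi (x, y) = mu x &
      forall y, \sum_x pi (x, y) = nu y].

Definition W1 (d : S -> S -> nat) (mu nu : S -> R) : R :=
  inf [set \sum_p pi p * (d p.1 p.2)%:R | pi in coupling mu nu]%classic.

End Wasserstein.

(** * Gibbs measures on spanning trees of the component of the root *)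

Section Gibbs.
Variables (R : realType) (V : finType).
Implicit Types E T : {set {set V}}.

Definition gibbs_weight (b : R) E (r : V) T : R :=
  expR (- (b * \sum_(v in component E r) (gdist T r v)%:R)).

Definition gibbs (b : R) E (r : V) T : R :=
  if T \in spanning_trees E r then
    gibbs_weight b E r T / \sum_(T' in spanning_trees E r) gibbs_weight b E r T'
  else 0.

Definition gibbs_inf E (r : V) T : R :=
  if T \in shortest_path_trees E r then #|shortest_path_trees E r|%:R^-1 else 0.

End Gibbs.

(** * The Erdos-Renyi graph *)

(* The vertex set {1,...,n} is encoded as {0,...,n-1}, so that the vertex 1 is
   [ord0]; the shape [n.-1.+1] only matters at [n = 0], where it is junk. *)
Definition vertex (n : nat) : finType := 'I_n.-1.+1.
Definition vertex1 (n : nat) : vertex n := ord0.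
Definition graph (n : nat) : finType := {set {set vertex n}}.

(* Probability that G(n,q) satisfies [A].  For q outside [0,1] this is junk;
   along the sequences considered here, q_n tends to 0. *)
Definition er_prob (R : realType) (n : nat) (q : R) (A : pred (graph n)) : R :=
  \sum_(E in powerset (vertex_pairs (vertex n)) | A E)
    \prod_(e in vertex_pairs (vertex n)) (if e \in E then q else 1 - q).

Section Scales.
Variables (R : realType) (alpha : nat -> R).

Definition loglog (n : nat) : R := ln (ln n%:R).

Definition q_ (n : nat) : R := alpha n * ln n%:R / n%:R.

Definition ell_star (n : nat) : R := ln n%:R / ln (n%:R * q_ n).

Definition d_star (n : nat) : int :=
  let D := [set d : int | n%:R / loglog n ^+ 2 <= (n%:R * q_ n) ^ d]%classic in
  xget 0 [set d | D d /\ forall d', D d' -> d <= d']%classic.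

Definition Delta_ (n : nat) : R := (d_star n)%:~R - ell_star n.

Definition lambda_ (n : nat) : R :=
  expR (- ((n%:R * q_ n) ^ d_star n / n%:R)).

Lemma lambda_P (n : nat) : (0 < n)%N -> 0 < n%:R * q_ n ->
  0 < lambda_ n < 1 /\ ln (1 / lambda_ n) = (n%:R * q_ n) ^ d_star n / n%:R.
Proof.
move=> n0 nq0; split; last by rewrite /lambda_ div1r expRN invrK expRK.
rewrite expR_gt0 /= -expR0 ltr_expR oppr_lt0.
by rewrite divr_gt0 ?exprz_gt0 ?ltr0n.
Qed.

Definition kappa_ (n : nat) : R := (1 - lambda_ n) * loglog n.

End Scales.

(* The inverse of extended reals satisfies 0^-1 = +oo and +oo^-1 = 0. *)
Definition beta_c (R : realType) (Delta : R) (kappa : \bar R) : \bar R :=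
  (1 - Delta%:E - kappa^-1)%E.

(* (1/n) W_1(mu_{G,oo}, mu_{G,beta}) as a function of the graph [E]. *)
Definition scaled_W1 (R : realType) (beta : R) (n : nat) (E : graph n) : R :=
  W1 (hamming E (vertex1 n))
     (gibbs_inf R E (vertex1 n))
     (gibbs (beta * loglog R n) E (vertex1 n)) / n%:R.

(* Main.v *)
(** A spanning tree of the component of the root [r] is a parent function, and
given the depths the parents are independent and uniform.  Write [n] for the
number of vertices, [a = n q], [l = log log n], [b = beta l], [D = d_star], [d]
for the distance to [r], and let the level [k] consist of the vertices with
[d = k].  With high probability the graph is pseudo-random, the levels below
[D] are negligible, the level [D] has about [(1 - lambda) n] vertices and the
level [D + 1] almost all the others.

Low temperature.  Call a vertex bad if its depth exceeds its distance.
Rerouting parents couples the two measures at a cost governed by the bad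
vertices, and the probability that a given set is bad is at most the product
over its vertices [v] of [exp (1 - b) deg v / #|choices v| * exp (- wt v)],
where [wt v] is the expected number of children of [v] in a uniform shortest
path tree.  The sum of these factors is [o(n)] when [beta > beta_c]: summing
[1 / #|choices v|] gives the threshold [1 - Delta], and if [kappa] is finite,
then [wt] is about [1 / (1 - lambda) = l / kappa] on the level [D], which
accounts for the remaining term [1 / kappa].

High temperature.  Let [top] be the set of vertices of the level [D] whose
depth is [D].  If [top] has more than [K = c n / l] elements, many of them are
leaves that can be reattached below other elements of [top] at the price of
one factor [exp (- b)], which gives more configurations than there can be as
soon as [c > 1 / (1 - beta - Delta)].  Resampling arguments show that few
vertices have a parent of wrong depth below the level [D] and that few vertices
of the level [D + 1] have depth more than [D + 1].  Hence almost all vertices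
of the level [D] change parent, and so do those vertices of the level [D + 1]
whose shortest path parent is not in [top], which leaves out a proportion
[1 / ((1 - beta - Delta) kappa)] at most. *)

Require Import Defs.
From mathcomp Require Import ring lra zify.

Set Implicit Arguments.
Unset Strict Implicit.
Unset Printing Implicit Defensive.

Local Open Scope ring_scope.

(** * Finite product measures *)

(** Everything is measured in powers of [exp l]: [a] is [exp l] up to constants and [y = a ^ D / n]
    is about [exp (Delta l)], so [beta], [Delta] and [1 / kappa] compete as exponents. Low
    temperature: ordinary vertices from the level [D] on have at least about [y] shortest path
    parents, so their factor is at most about [exp ((1 - beta - Delta) l)]. Badness of different
    vertices is not independent, but the product bound, summed over all sets, is a product of terms
    [1 + factor], which controls an exponential moment of the cost. High temperature: resampling a
    parent among all neighbours costs [ln deg], about [l], which is as much as the price [b] of one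
    level. So only [O(n / l)] vertices may be resampled at full cost; the others must get new
    parents from a fraction [1 / l ^ 2] of their neighbours, at cost [O(ln l)]. For [top], leaf
    moves compare [n a exp (- l / c)] with [n exp ((beta + Delta) l)], whence the condition on [c].
    Finally the coupling in the lower bound is arbitrary, so [top] may depend on the shortest path
    tree: its number of children is bounded uniformly over sets through a variance. *)

Section ProductMeasure.
Variables (R : realType) (I X : finType) (w : I -> X -> R).
Hypothesis w_ge0 : forall i x, 0 <= w i x.
Hypothesis w_sum1 : forall i, \sum_x w i x = 1.

Definition pweight (f : {ffun I -> X}) : R := \prod_i w i (f i).

Definition pE (F : {ffun I -> X} -> R) : R := \sum_f pweight f * F f.

Definition depends_on (P : pred I) (Y : Type) (F : {ffun I -> X} -> Y) :=
  forall f g : {ffun I -> X}, {in P, f =1 g} -> F f = F g.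

Lemma pweight_ge0 f : 0 <= pweight f.
Proof. exact: prodr_ge0. Qed.

Lemma pE_prod (phi : I -> X -> R) :
  pE (fun f => \prod_i phi i (f i)) = \prod_i \sum_x w i x * phi i x.
Proof.
rewrite bigA_distr_bigA /=; apply: eq_bigr => f _.
by rewrite big_split.
Qed.

Lemma pE_cst c : pE (fun=> c) = c.
Proof.
rewrite /pE -mulr_suml; have -> : \sum_f pweight f = 1; last by rewrite mul1r.
by rewrite -bigA_distr_bigA big1.
Qed.

Lemma eq_pE F G : F =1 G -> pE F = pE G.
Proof. by move=> FG; apply: eq_bigr => f _; rewrite FG. Qed.

Lemma pE_le F G : (forall f, F f <= G f) -> pE F <= pE G.
Proof. by move=> FG; apply: ler_sum => f _; rewrite ler_wpM2l ?pweight_ge0. Qed.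

Lemma pE_ge0 F : (forall f, 0 <= F f) -> 0 <= pE F.
Proof. by move=> F0; apply: sumr_ge0 => f _; rewrite mulr_ge0 ?pweight_ge0. Qed.

Lemma pED F G : pE (fun f => F f + G f) = pE F + pE G.
Proof. by rewrite /pE -big_split; apply: eq_bigr => f _; rewrite mulrDr. Qed.

Lemma pEZ c F : pE (fun f => c * F f) = c * pE F.
Proof. by rewrite /pE mulr_sumr; apply: eq_bigr => f _; rewrite mulrCA. Qed.

Lemma pE_sum (J : finType) (P : pred J) (F : J -> {ffun I -> X} -> R) :
  pE (fun f => \sum_(j | P j) F j f) = \sum_(j | P j) pE (F j).
Proof. by rewrite /pE exchange_big /=; apply: eq_bigr => f _; rewrite mulr_sumr. Qed.

Lemma pE_coord i (phi : X -> R) : pE (fun f => phi (f i)) = \sum_x w i x * phi x.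
Proof.
pose ph j x := if j == i then phi x else 1.
transitivity (pE (fun f => \prod_j ph j (f j))).
  apply: eq_pE => f; rewrite (bigD1 i) //= /ph eqxx big1 ?mulr1 // => j /negbTE ->.
  by [].
rewrite pE_prod (bigD1 i) //= /ph eqxx [X in _ * X]big1 ?mulr1 //.
by move=> j /negbTE ->; under eq_bigr do rewrite mulr1.
Qed.

(* Exchanging the coordinates in [P] between two independent copies preserves
   the product weight. *)
Lemma pE_indep (P : pred I) F G :
  depends_on P F -> depends_on (predC P) G ->
  pE (fun f => F f * G f) = pE F * pE G.
Proof.
move=> dF dG.
pose sw (fg : {ffun I -> X} * {ffun I -> X}) :=
  ([ffun i => if P i then fg.1 i else fg.2 i],
   [ffun i => if P i then fg.2 i else fg.1 i]).
have swK : involutive sw.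
  by move=> [f g]; rewrite /sw /=; congr pair; apply/ffunP => i; rewrite !ffunE; case: (P i); rewrite ?ffunE.
have wsw fg : pweight (sw fg).1 * pweight (sw fg).2 = pweight fg.1 * pweight fg.2.
  rewrite /pweight -!big_split /=; apply: eq_bigr => i _; rewrite !ffunE.
  by case: ifP => // _; rewrite mulrC.
rewrite {2 3}/pE big_distrlr /= pair_big /=.
transitivity (\sum_fg pweight fg.1 * pweight fg.2 * (F fg.1 * G fg.1)).
  rewrite -[LHS]mulr1 -(pE_cst 1) {1 2}/pE big_distrlr /= pair_big /=.
  by apply: eq_bigr => fg _; rewrite mulr1 mulrAC.
rewrite (reindex_inj (inv_inj swK)) /=; apply: eq_bigr => -[f g] _.
have -> : F (sw (f, g)).1 = F f by apply: dF => i Pi; rewrite ffunE [P i]Pi.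
have -> : G (sw (f, g)).1 = G g.
  by apply: dG => i; rewrite inE /= => /negbTE Pi; rewrite ffunE Pi.
by rewrite wsw /= mulrACA.
Qed.

(** For indicators uncorrelated in pairs the off-diagonal covariances vanish and each diagonal term
    is [m - m ^ 2]. Serves the degrees, the numbers of children and the exploration. *)
Lemma pE_variance (J : finType) (P : pred J) (Z : J -> {ffun I -> X} -> R)
    (m : J -> R) :
  (forall j f, P j -> Z j f ^+ 2 = Z j f) ->
  (forall j, P j -> pE (Z j) = m j) ->
  (forall i j, P i -> P j -> i != j -> pE (fun f => Z i f * Z j f) = m i * m j) ->
  pE (fun f => (\sum_(j | P j) Z j f - \sum_(j | P j) m j) ^+ 2)
    <= \sum_(j | P j) m j.
Proof.
move=> Z2 Zm Zij.
have -> : pE (fun f => (\sum_(j | P j) Z j f - \sum_(j | P j) m j) ^+ 2) =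
  \sum_(i | P i) \sum_(j | P j) pE (fun f => (Z i f - m i) * (Z j f - m j)).
  under [RHS]eq_bigr do rewrite -pE_sum.
  rewrite -pE_sum; apply: eq_pE => f.
  by rewrite -sumrB expr2 big_distrlr.
apply: ler_sum => i Pi; rewrite (bigD1 i) //= [X in _ + X]big1.
  rewrite addr0.
  have -> : pE (fun f => (Z i f - m i) * (Z i f - m i)) = m i - m i ^+ 2.
    rewrite (@eq_pE _ (fun f => Z i f + ((- (2 * m i)) * Z i f + m i ^+ 2))).
      by rewrite !pED pEZ pE_cst !Zm //; ring.
    by move=> f; rewrite -expr2 sqrrB Z2 //; ring.
  by rewrite lerBlDr lerDl sqr_ge0.
move=> j /andP[Pj ij].
rewrite (@eq_pE _ (fun f => Z i f * Z j f +
   ((- m j) * Z i f + ((- m i) * Z j f + m i * m j)))).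
  by rewrite !pED !pEZ pE_cst !Zm // Zij // 1?eq_sym //; ring.
by move=> f; ring.
Qed.

End ProductMeasure.

(** * Graph distance *)

Section Distance.
Variables (V : finType) (E : {set {set V}}).

Lemma adj_sym x y : adj E x y = adj E y x.
Proof. by rewrite /adj eq_sym finset.setUC. Qed.

Lemma adj_irr x : adj E x x = false.
Proof. by rewrite /adj eqxx. Qed.

Lemma gdist_le x p : path (adj E) x p -> (size p < #|V|)%N ->
  (gdist E x (last x p) <= size p)%N.
Proof.
move=> xp sp; rewrite leqNgt; apply/negP => /(before_find 0%N).
rewrite nth_iota // add0n /= => /negbT/negP; apply; apply/fintype.existsP.
by exists (in_tuple p); rewrite xp eqxx.
Qed.

Lemma gdist_path x y : connect (adj E) x y ->
  (gdist E x y < #|V|)%N /\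
  exists p, [/\ path (adj E) x p, last x p = y & size p = gdist E x y].
Proof.
move=> /connectP[p0 /shortenP[p xp up _] ->{p0}].
have sp : (size p < #|V|)%N by have := card_uniqP up; rewrite /= => <-; apply: max_card.
set y' := last x p.
have Hl := leq_ltn_trans (gdist_le xp sp) sp.
split => //.
have : has (fun k => [exists p : k.-tuple V, path (adj E) x p && (last x p == y')])
    (iota 0 #|V|) by rewrite has_find size_iota.
move/(nth_find 0%N); rewrite nth_iota // add0n => /fintype.existsP[q /andP[xq /eqP lq]].
by exists q; split => //; rewrite size_tuple.
Qed.

Variable r : V.

Lemma component_root : r \in component E r.
Proof. by rewrite inE connect0. Qed.

Lemma component_adj u v : u \in component E r -> adj E u v -> v \in component E r.
Proof. by rewrite !inE => ru uv; apply: (connect_trans ru); apply: connect1. Qed.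

Lemma gdist_root : gdist E r r = 0%N.
Proof.
apply/eqP; rewrite -leqn0; apply: (@gdist_le r [::]) => //=.
by apply/card_gt0P; exists r.
Qed.

Lemma gdist_adj u v : u \in component E r -> adj E u v ->
  (gdist E r v <= (gdist E r u).+1)%N.
Proof.
move=> Cu uv; have := component_adj Cu uv; rewrite inE => /gdist_path[dv _].
move: Cu; rewrite inE => /gdist_path[du [p [rp lp <-]]].
(* If the path to [u] already has [#|V| - 1] edges, the extended path is too long for the range
   searched by [gdist]; then the general bound on [gdist E r v] is enough. *)
have [sp|le] := ltnP (size p).+1 #|V|; last exact: leq_trans (ltnW dv) le.
have := @gdist_le r (rcons p v); rewrite rcons_path last_rcons size_rcons rp lp uv.
exact.
Qed.

Lemma gdist_pred v : v \in component E r -> v != r ->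
  exists u, [/\ u \in component E r, adj E u v & gdist E r v = (gdist E r u).+1].
Proof.
move=> Cv vr; move: (Cv); rewrite inE => /gdist_path[dv [p [rp lp sp]]].
case/lastP: p rp lp sp => [|p y] rp lp sp; first by rewrite -lp eqxx in vr.
move: rp lp sp; rewrite rcons_path last_rcons size_rcons => /andP[rp ly] yv sp.
rewrite {}yv in ly *; exists (last r p).
have Cu : last r p \in component E r by rewrite inE; apply/connectP; exists p.
split => //; apply/eqP; rewrite eqn_leq gdist_adj // -sp ltnS gdist_le //.
by apply: leq_trans dv; rewrite -sp ltnW.
Qed.

(** Descend along the predecessors for [h2]: each step lowers [h2] by exactly one and [h1] by at
    most one. Used in both directions, this characterises the distance as the only function with
    both properties. *)
Lemma lipschitz_le_pred (h1 h2 : V -> nat) :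
  h1 r = 0%N ->
  (forall u v, u \in component E r -> adj E u v -> (h1 v <= (h1 u).+1)%N) ->
  (forall v, v \in component E r -> v != r ->
    exists u, [/\ u \in component E r, adj E u v & h2 v = (h2 u).+1]) ->
  forall v, v \in component E r -> (h1 v <= h2 v)%N.
Proof.
move=> h1r h1L h2P v; move: {2}(h2 v) (erefl (h2 v)) => k.
elim: k v => [|k IH] v hv Cv; have [->|vr] := eqVneq v r; rewrite ?h1r //;
  have [u [Cu uv hu]] := h2P _ Cv vr; first by rewrite hu in hv.
rewrite hu; apply: leq_trans (h1L _ _ Cu uv) _; rewrite ltnS; apply: IH => //.
by move: hu; rewrite hv => -[].
Qed.

Lemma gdist_unique (h : V -> nat) :
  h r = 0%N ->
  (forall u v, u \in component E r -> adj E u v -> (h v <= (h u).+1)%N) ->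
  (forall v, v \in component E r -> v != r ->
    exists u, [/\ u \in component E r, adj E u v & h v = (h u).+1]) ->
  forall v, v \in component E r -> gdist E r v = h v.
Proof.
move=> hr hL hP v Cv; apply/eqP; rewrite eqn_leq; apply/andP; split.
  exact: lipschitz_le_pred gdist_root gdist_adj hP _ Cv.
exact: lipschitz_le_pred hr hL gdist_pred _ Cv.
Qed.

End Distance.

Lemma eq_set2 (V : finType) (x y u v : V) : x != y ->
  [set x; y]%SET = [set u; v]%SET -> (x = u /\ y = v) \/ (x = v /\ y = u).
Proof.
move=> xy e; have := finset.set22 x y; have := finset.set21 x y; rewrite e !in_set2.
by case/orP=> /eqP xE; case/orP=> /eqP yE; [|left|right|];
  rewrite ?xE ?yE ?eqxx // in xy *.
Qed.

(** * Product sets of functions and sums over them *)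

Section Box.
Variables (I X : finType).
Implicit Types F : I -> {set X}.

Definition box F : {set {ffun I -> X}} :=
  [set f : {ffun I -> X} | [forall i, f i \in F i]]%SET.

Lemma boxP F (f : {ffun I -> X}) : reflect (forall i, f i \in F i) (f \in box F).
Proof. by rewrite inE; apply: forallP. Qed.

Lemma mem_box_family F : box F =i family F.
Proof. by move=> f; apply/boxP/familyP. Qed.

Lemma card_box F : #|box F| = (\prod_i #|F i|)%N.
Proof.
rewrite -sum1_card (eq_bigl _ _ (mem_box_family F)).
under [RHS]eq_bigr do rewrite -sum1_card.
by rewrite bigA_distr_big_dep; apply: eq_bigr => f _; rewrite big1.
Qed.

Lemma sum_box (R : realType) F (phi : I -> X -> R) :
  \sum_(f in box F) \prod_i phi i (f i) = \prod_i \sum_(x in F i) phi i x.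
Proof.
by rewrite (eq_bigl _ _ (mem_box_family F)) bigA_distr_big_dep.
Qed.

End Box.

(** * Spanning trees as parent functions *)

Section ParentFunctions.
Variables (V : finType) (E : {set {set V}}) (r : V).
Implicit Types (p : {ffun V -> V}) (T : {set {set V}}).
Local Notation C := (component E r).

Definition nonroot v := (v \in C) && (v != r).

(** Such a function is frozen to the identity at the root and outside the component, so that it is
    determined by its tree and counting functions is counting trees. *)
Definition pfun : {set {ffun V -> V}} :=
  [set p : {ffun V -> V} |
    [forall v, if nonroot v then adj E (p v) v else p v == v] &&
    [forall v in C, has (fun k => iter k p v == r) (iota 0 #|V|)]]%SET.

Definition depth p v := find (fun k => iter k p v == r) (iota 0 #|V|).

Definition tree_of p : {set {set V}} := [set [set v; p v]%SET | v in nonroot]%SET.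

Lemma nonrootC v : nonroot v -> v \in C. Proof. by case/andP. Qed.

Lemma root_or_nonroot v : v \in C -> v = r \/ nonroot v.
Proof. by rewrite /nonroot => ->; have [->|] := eqVneq v r; [left|right]. Qed.

Lemma nonroot_root : nonroot r = false.
Proof. by rewrite /nonroot eqxx andbF. Qed.

Lemma pfun_adj p v : p \in pfun -> nonroot v -> adj E (p v) v.
Proof. by rewrite inE => /andP[/forallP/(_ v)]; case: ifP. Qed.

Lemma pfun_fix p v : p \in pfun -> ~~ nonroot v -> p v = v.
Proof. by rewrite inE => /andP[/forallP/(_ v)]; case: ifP => // _ /eqP. Qed.

Lemma pfun_comp p v : p \in pfun -> v \in C -> p v \in C.
Proof.
move=> pp Cv; have [nv|nv] := boolP (nonroot v); last by rewrite pfun_fix.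
by apply: (component_adj Cv); rewrite adj_sym pfun_adj.
Qed.

Lemma depth_root p : depth p r = 0%N.
Proof.
rewrite /depth; have : (0 < #|V|)%N by apply/card_gt0P; exists r.
by case: #|V| => // n _ /=; rewrite eqxx.
Qed.

Lemma iter_depth p v : p \in pfun -> v \in C ->
  (depth p v < #|V|)%N /\ iter (depth p v) p v = r.
Proof.
rewrite inE => /andP[_ /forall_inP H] Cv; have h := H _ Cv.
have lt : (depth p v < #|V|)%N by move: h; rewrite has_find size_iota.
by split => //; apply/eqP; have := nth_find 0%N h; rewrite nth_iota.
Qed.

Lemma depth_le p v k : (k < #|V|)%N -> iter k p v = r -> (depth p v <= k)%N.
Proof.
move=> kV kr; rewrite leqNgt; apply/negP => /(before_find 0%N).
by rewrite nth_iota // add0n kr eqxx.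
Qed.

Lemma depth_step p v : p \in pfun -> nonroot v -> depth p v = (depth p (p v)).+1.
Proof.
move=> pp nv; have [lv iv] := iter_depth pp (nonrootC nv).
have [lp ip] := iter_depth pp (pfun_comp pp (nonrootC nv)).
apply/eqP; rewrite eqn_leq; apply/andP; split.
  have [lt|le] := ltnP (depth p (p v)).+1 #|V|; last exact: leq_trans (ltnW lv) le.
  by apply: depth_le; rewrite // iterSr.
case dE : (depth p v) => [|k].
  by move: iv; rewrite dE /= => vr; rewrite vr nonroot_root in nv.
by rewrite ltnS; apply: depth_le; [rewrite -ltnS -dE ltnW | rewrite -iterSr -dE].
Qed.

Lemma depth_lt p v : p \in pfun -> v \in C -> (depth p v < #|V|)%N.
Proof. by move=> pp /(iter_depth pp)[]. Qed.

(** A height that drops by one along [p] is a certificate: it forces every orbit to reach the root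
    and it is then the depth. *)
Lemma pfunI p (h : V -> nat) :
  (forall v, nonroot v -> adj E (p v) v /\ h v = (h (p v)).+1) ->
  (forall v, ~~ nonroot v -> p v = v) -> h r = 0%N ->
  p \in pfun /\ {in C, forall v, depth p v = h v}.
Proof.
move=> ph pf hr.
have pC v : v \in C -> p v \in C.
  move=> Cv; have [nv|nv] := boolP (nonroot v); last by rewrite pf.
  by apply: (component_adj Cv); rewrite adj_sym; case: (ph _ nv).
have iC k v : v \in C -> iter k p v \in C by move=> Cv; elim: k => //= k; apply: pC.
have hi k v : v \in C -> (k <= h v)%N -> h (iter k p v) = (h v - k)%N.
  move=> Cv; elim: k => [|k IH] kh; first by rewrite subn0.
  rewrite iterS; have ih := IH (ltnW kh).
  have [er|nr] := root_or_nonroot (iC k v Cv).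
    by move: ih; rewrite er hr => /esym/eqP; rewrite subn_eq0 leqNgt kh.
  by have [_] := ph _ nr; rewrite ih subnS => ->.
have h0 v : v \in C -> h v = 0%N -> v = r.
  by move=> Cv hv; have [//|/ph[_]] := root_or_nonroot Cv; rewrite hv.
have ir v : v \in C -> iter (h v) p v = r.
  by move=> Cv; apply: h0; [apply: iC | rewrite hi // subnn].
have hV v : v \in C -> (h v < #|V|)%N.
  (* The iterates of [v] have distinct heights, so they are distinct vertices; hence [h v] lies in
     the range searched by [depth]. *)
  move=> Cv; pose f (i : 'I_(h v).+1) := iter i p v.
  have fi : injective f.
    move=> i j fij; have := congr1 h fij; rewrite /f !hi ?leq_ord // => /eqP.
    by rewrite eqn_sub2lE ?leq_ord // => /eqP/val_inj.
  by have := leq_card f fi; rewrite card_ord.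
split.
  rewrite inE; apply/andP; split.
    apply/forallP => v; case: ifP => [/ph[]//|/negbT/pf ->] //.
  apply/forall_inP => v Cv; apply/hasP; exists (h v); last by rewrite ir.
  by rewrite mem_iota add0n hV.
move=> v Cv; apply/eqP; rewrite eqn_leq depth_le ?hV ?ir //=.
rewrite leqNgt; apply/negP => lt.
have hh : has (fun k => iter k p v == r) (iota 0 #|V|).
  by apply/hasP; exists (h v); rewrite ?mem_iota ?add0n ?hV ?ir.
have := nth_find 0%N hh; rewrite nth_iota ?add0n => [|]; last first.
  by rewrite -[X in (_ < X)%N](size_iota 0) -has_find.
move=> /eqP e; have := hi _ _ Cv (ltnW lt); rewrite e hr => /esym/eqP.
by rewrite subn_eq0 leqNgt lt.
Qed.

Lemma gdist_le_depth p v : p \in pfun -> v \in C -> (gdist E r v <= depth p v)%N.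
Proof.
move=> pp Cv; apply: (lipschitz_le_pred (gdist_root E r) _ _ Cv).
  exact: gdist_adj.
move=> u Cu ur; have nu : nonroot u by apply/andP.
by exists (p u); rewrite pfun_comp // pfun_adj // depth_step.
Qed.

Section TreeOf.
Variable p : {ffun V -> V}.
Hypothesis pp : p \in pfun.

Lemma pfun_neq v : nonroot v -> v != p v.
Proof. by move/(pfun_adj pp); rewrite /adj eq_sym => /andP[]. Qed.

Lemma adj_tree x y : adj (tree_of p) x y ->
  (nonroot x /\ p x = y) \/ (nonroot y /\ p y = x).
Proof.
case/andP=> xy /imsetP[v nv /(eq_set2 xy)[[-> ->]|[-> ->]]]; first by left.
by right.
Qed.

Lemma adj_tree_parent v : nonroot v -> adj (tree_of p) (p v) v.
Proof.
by move=> nv; rewrite adj_sym /adj pfun_neq //; apply/imsetP; exists v.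
Qed.

Lemma tree_sub : tree_of p \subset E.
Proof.
apply/fintype.subsetP => _ /imsetP[v nv ->].
by have := pfun_adj pp nv; rewrite adj_sym => /andP[].
Qed.

Lemma connect_tree v : v \in C -> connect (adj (tree_of p)) r v.
Proof.
move: {2}(depth p v) (erefl (depth p v)) => k; elim: k v => [|k IH] v dv Cv;
  have [->|nv] := root_or_nonroot Cv; rewrite ?connect0 //.
  by rewrite depth_step in dv.
apply: connect_trans (IH (p v) _ _) (connect1 (adj_tree_parent nv)).
  by move: dv; rewrite depth_step // => -[].
by rewrite pfun_comp.
Qed.

Lemma component_tree : component (tree_of p) r = C.
Proof.
apply/setP => v; apply/idP/idP => [|/connect_tree]; last by rewrite inE.
rewrite !inE; apply: connect_sub => x y; move/andP=> [xy Txy].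
by apply: connect1; rewrite /adj xy (fintype.subsetP tree_sub).
Qed.

Lemma gdist_tree v : v \in C -> gdist (tree_of p) r v = depth p v.
Proof.
rewrite -component_tree; apply: gdist_unique; rewrite ?depth_root // component_tree.
  move=> x y Cx /adj_tree[[nx <-]|[ny <-]]; last by rewrite depth_step.
  by rewrite (depth_step pp nx) leqW // leqW.
move=> y Cy yr; have ny : nonroot y by apply/andP.
by exists (p y); rewrite pfun_comp // adj_tree_parent // depth_step.
Qed.

Lemma parent_tree v : nonroot v -> parent (tree_of p) r v = Some (p v).
Proof.
move=> nv; rewrite /parent; case: pickP => [u /andP[uv /eqP]|/(_ (p v))].
  have Cv := nonrootC nv; case: (adj_tree uv) => [[nu pu]|[_ ->//]].
  rewrite !gdist_tree // ?(nonrootC nu) // (depth_step pp nu) pu => h.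
  by have := ltnn (depth p v); rewrite {2}h ltnS ltnW.
rewrite adj_tree_parent // !gdist_tree ?pfun_comp ?(nonrootC nv) //.
by rewrite -depth_step // eqxx.
Qed.

(** A deepest vertex of a cycle can only be joined to its parent, so its two neighbours on the cycle
    would coincide. *)
Lemma acyclic_tree : acyclic (tree_of p).
Proof.
apply/asboolP => c sc /andP[cc uc].
have [x0 x0c] : exists x, x \in c by case: c sc {cc uc} => // x c; exists x; rewrite mem_head.
have [v vc vmax] : exists2 v, v \in c & forall u, u \in c -> (depth p u <= depth p v)%N.
  by case: (@arg_maxnP _ x0 (mem c) (depth p) x0c) => v vc vm; exists v.
have nbr u : u \in c -> adj (tree_of p) u v -> nonroot v /\ p v = u.
  move=> uc' /adj_tree[[nu pu]|//]; have := vmax _ uc'.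
  by rewrite (depth_step pp nu) pu ltnn.
have [i c' ci] := rot_to vc.
have mc u : (u \in v :: c') = (u \in c) by rewrite -ci mem_rot.
move: cc uc sc; rewrite -(rot_cycle i) -(rot_uniq i) -(size_rot i) ci {ci}.
case: c' mc => [//|x [//|y s]] mc /= /and3P[vx xy ys] /andP[_ /andP[xys _]] _.
rewrite rcons_path in ys; case/andP: ys => _ lv.
have [_ e1] : nonroot v /\ p v = x.
  by apply: nbr; rewrite -?mc ?inE ?eqxx ?orbT // adj_sym.
have ly : last y s \in y :: s by exact: mem_last.
have [_ e2] : nonroot v /\ p v = last y s.
  by apply: nbr => //; rewrite -mc 2!inE ly !orbT.
by rewrite -e1 e2 ly in xys.
Qed.

Lemma tree_spanning : tree_of p \in spanning_trees E r.
Proof.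
rewrite inE tree_sub /=; apply/and3P; split; last exact: acyclic_tree.
  apply/forall_inP => _ /imsetP[v nv ->]; apply/fintype.subsetP => x; rewrite inE.
  case/orP; rewrite inE => /eqP ->; first exact: nonrootC.
  by rewrite pfun_comp ?nonrootC.
apply/forall_inP => u Cu; apply/forall_inP => v Cv.
apply: connect_trans (connect_tree Cv).
by rewrite (sym_connect_sym (@adj_sym _ _)) connect_tree.
Qed.

End TreeOf.

Hypothesis E_pairs : E \subset vertex_pairs V.

(** The parents are read off from the distances in [T], which gives a subtree of [T] on the whole
    component; acyclicity leaves no room for further edges. *)
Lemma spanning_treeP T : T \in spanning_trees E r ->
  exists2 p, p \in pfun & T = tree_of p.
Proof.
rewrite inE => /andP[TE /and3P[/forall_inP TC /forall_inP Tcon /asboolP Tac]].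
have CT : component T r = C.
  apply/setP => v; apply/idP/idP => [|Cv]; last first.
    by rewrite inE; apply: (forall_inP (Tcon _ (component_root E r))).
  rewrite !inE; apply: connect_sub => x y /andP[xy Txy]; apply: connect1.
  by rewrite /adj xy (fintype.subsetP TE).
pose p := [ffun v => if nonroot v then odflt v (parent T r v) else v].
have pP v : nonroot v -> adj T (p v) v /\ gdist T r v = (gdist T r (p v)).+1.
  move=> nv; rewrite ffunE nv /parent; case: pickP => [u /andP[uv /eqP]//|no].
  have [u [_ uv du]] : exists u, [/\ u \in component T r, adj T u v &
      gdist T r v = (gdist T r u).+1].
    by apply: gdist_pred; [rewrite CT nonrootC | case/andP: nv].
  by have := no u; rewrite uv du eqxx.
have [pp _] : p \in pfun /\ {in C, forall v, depth p v = gdist T r v}.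
  apply: pfunI; last exact: gdist_root.
    move=> v nv; have [a ->] := pP _ nv; split => //; case/andP: a => a1 a2.
    by rewrite /adj a1 (fintype.subsetP TE).
  by move=> v /negbTE nv; rewrite ffunE nv.
exists p => //; apply/eqP; rewrite finset.eqEsubset; apply/andP; split; last first.
  apply/fintype.subsetP => _ /imsetP[v nv ->]; have [] := pP _ nv.
  by rewrite adj_sym => /andP[].
apply/fintype.subsetP => e eT; apply/negPn/negP => eN.
(* An edge of T outside the breadth-first tree closes a cycle. *)
have := fintype.subsetP E_pairs _ (fintype.subsetP TE _ eT).
rewrite inE => /cards2P[x [y [xy ee]]].
have Cx : x \in C by apply: (fintype.subsetP (TC _ eT)); rewrite ee in_set2 eqxx.
have Cy : y \in C by apply: (fintype.subsetP (TC _ eT)); rewrite ee in_set2 eqxx orbT.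
have : connect (adj (tree_of p)) x y.
  apply: connect_trans (connect_tree pp Cy).
  by rewrite (sym_connect_sym (@adj_sym _ _)) connect_tree.
move=> /connectP[q0 /shortenP[q xq uq _] ly] {q0}.
have q2 : (1 < size q)%N.
  case: q xq uq ly => [|z [|? ?]] //=; first by move=> _ _ yx; rewrite yx eqxx in xy.
  by rewrite andbT => /andP[_ xzT] _ yz; rewrite ee yz xzT in eN.
apply: (Tac (x :: q)) => //; apply/andP; split => //.
have Tyx : adj T y x by rewrite adj_sym /adj xy -ee.
rewrite /= rcons_path -ly Tyx andbT.
apply: sub_path xq => u v /andP[uv]; rewrite /adj uv /=.
move=> /imsetP[z nz ->]; have [] := pP _ nz.
by rewrite adj_sym => /andP[].
Qed.

Lemma spanning_treesE : spanning_trees E r = (tree_of @: pfun)%SET.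
Proof.
apply/setP => T; apply/idP/imsetP => [/spanning_treeP[p pp ->]|[p pp ->]].
  by exists p.
exact: tree_spanning.
Qed.

Lemma tree_of_inj : {in pfun &, injective tree_of}.
Proof.
move=> p p' pp pp' e; apply/ffunP => v; have [nv|nv] := boolP (nonroot v).
  by have := parent_tree pp nv; rewrite e parent_tree // => -[].
by rewrite !pfun_fix.
Qed.

(** For [h] the distance these are the shortest path parents; for [h = depth p] they are the parents
    that [v] can take without changing any depth. The singleton elsewhere contributes a factor one
    to cardinals of boxes. *)
Definition choices (h : V -> nat) v : {set V} :=
  if nonroot v then [set u | adj E u v && (h v == (h u).+1)]%SET
  else [set v]%SET.

Lemma choicesP h p : h r = 0%N -> (forall v, p v \in choices h v) ->
  p \in pfun /\ {in C, forall v, depth p v = h v}.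
Proof.
move=> hr ph; apply: pfunI => // v; have := ph v; rewrite /choices.
  by move=> pv nv; move: pv; rewrite nv inE => /andP[? /eqP].
by move=> + /negbTE nv; rewrite nv inE => /eqP.
Qed.

Lemma choices_depth p v : p \in pfun -> p v \in choices (depth p) v.
Proof.
move=> pp; rewrite /choices; case: ifP => [nv|/negbT nv]; last by rewrite pfun_fix // set11.
by rewrite inE pfun_adj //= -depth_step.
Qed.

Lemma choices_ext h h' v : {in C, h =1 h'} -> choices h v = choices h' v.
Proof.
move=> hh; rewrite /choices; case: ifP => // nv; apply/setP => u; rewrite !inE.
have [uv|//] := boolP (adj E u v); rewrite !hh ?(nonrootC nv) //.
by apply: (component_adj (nonrootC nv)); rewrite adj_sym.
Qed.

Local Notation d := (gdist E r).

(** Being a box, this set carries a uniform law under which the parents are independent. *)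
Definition spt : {set {ffun V -> V}} :=
  box (choices d).

Lemma sptP p : reflect (p \in pfun /\ {in C, forall v, depth p v = d v}) (p \in spt).
Proof.
apply: (iffP idP) => [|[pp pd]].
  by move=> /boxP; apply: choicesP; rewrite gdist_root.
by apply/boxP => v; rewrite -(choices_ext v pd) choices_depth.
Qed.

Lemma choices_gdist_neq0 v : (0 < #|choices d v|)%N.
Proof.
apply/card_gt0P; rewrite /choices; case: ifP => [/andP[Cv vr]|_]; last first.
  by exists v; rewrite inE.
by have [u [_ uv du]] := gdist_pred Cv vr; exists u; rewrite inE uv du eqxx.
Qed.

Lemma card_spt : #|spt| = (\prod_v #|choices d v|)%N.
Proof. exact: card_box. Qed.

Lemma card_spt_gt0 : (0 < #|spt|)%N.
Proof. by rewrite card_spt prodn_gt0 // => v; apply: choices_gdist_neq0. Qed.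

Lemma shortest_path_treesE : shortest_path_trees E r = (tree_of @: spt)%SET.
Proof.
apply/setP => T; rewrite inE spanning_treesE; apply/idP/imsetP.
  move=> /andP[/imsetP[p pp ->] /forall_inP H]; exists p => //; apply/sptP; split => //.
  by move=> v Cv; apply/eqP; rewrite -gdist_tree // H.
move=> [p /sptP[pp pd] ->]; rewrite imset_f //=; apply/forall_inP => v Cv.
by rewrite gdist_tree // pd.
Qed.

Definition pdiff p p' := #|[set v | nonroot v && (p v != p' v)]%SET|.

Lemma hamming_tree p p' : p \in pfun -> p' \in pfun ->
  hamming E r (tree_of p) (tree_of p') = pdiff p p'.
Proof.
move=> pp pp'; apply: eq_card => v; rewrite !inE -/(connect _ _ _).
rewrite andbA -[connect _ _ _ && _]/((_ && _)) .
have -> : connect (adj E) r v && (v != r) = nonroot v by rewrite /nonroot inE.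
by have [nv|//] := boolP (nonroot v); rewrite !parent_tree.
Qed.

End ParentFunctions.

(** * Bounds on the Wasserstein distance *)

Section WassersteinBounds.
Variables (R : realType) (S : finType) (d : S -> S -> nat) (mu nu : S -> R).

Lemma W1_has_lbound :
  has_lbound [set \sum_p pi p * (d p.1 p.2)%:R | pi in coupling mu nu]%classic.
Proof.
exists 0 => _ [pi [pi0 _ _] <-]; apply: sumr_ge0 => p _.
by rewrite mulr_ge0.
Qed.

(** The coupling is the image of [rho] under the pair of maps [S1], [S2]; this avoids describing it
    on trees. *)
Lemma W1_le (I : finType) (rho : I -> R) (S1 S2 : I -> S) :
  (forall i, 0 <= rho i) ->
  (forall s, \sum_(i | S1 i == s) rho i = mu s) ->
  (forall s, \sum_(i | S2 i == s) rho i = nu s) ->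
  W1 d mu nu <= \sum_i rho i * (d (S1 i) (S2 i))%:R.
Proof.
move=> r0 r1 r2.
pose pi (p : S * S) := \sum_(i | (S1 i, S2 i) == p) rho i.
apply: (@ge_inf _ _ _); first exact: W1_has_lbound.
exists pi; first split.
    by move=> p; apply: sumr_ge0.
  move=> x; rewrite -r1 [RHS](partition_big S2 xpredT) //=.
  move=> y; rewrite -r2 [RHS](partition_big S1 xpredT) //=.
  by apply: eq_bigr => x _; apply: eq_bigl => i; rewrite xpair_eqE andbC.
rewrite [RHS](partition_big (fun i => (S1 i, S2 i)) xpredT) //=.
apply: eq_bigr => p _; rewrite /pi mulr_suml; apply: eq_bigr => i /eqP <- //.
Qed.

(** The easy half of Kantorovich duality. The constraint is needed only on pairs of positive mass,
    because a coupling charges no others. *)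
Lemma W1_ge (F G : S -> R) :
  (forall x, 0 <= mu x) -> (forall x, 0 <= nu x) ->
  \sum_x mu x = 1 -> \sum_x nu x = 1 ->
  (forall x y, 0 < mu x -> 0 < nu y -> F x + G y <= (d x y)%:R) ->
  \sum_x mu x * F x + \sum_y nu y * G y <= W1 d mu nu.
Proof.
move=> mu0 nu0 mu1 nu1 FG; apply: lb_le_inf.
  exists (\sum_p (mu p.1 * nu p.2) * (d p.1 p.2)%:R); exists (fun p => mu p.1 * nu p.2) => //.
  split => [p|x|y] /=; first by rewrite mulr_ge0.
    by rewrite -mulr_sumr nu1 mulr1.
  by rewrite -mulr_suml mu1 mul1r.
move=> _ [pi [pi0 pi1 pi2] <-].
have -> : \sum_x mu x * F x = \sum_p pi p * F p.1.
  rewrite [RHS](eq_bigr (fun p => pi (p.1, p.2) * F p.1)) => [|[]//].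
  rewrite -(pair_bigA _ (fun x y => pi (x, y) * F x)) /=.
  by apply: eq_bigr => x _; rewrite -mulr_suml pi1.
have -> : \sum_y nu y * G y = \sum_p pi p * G p.2.
  rewrite [RHS](eq_bigr (fun p => pi (p.1, p.2) * G p.2)) => [|[]//].
  rewrite -(pair_bigA _ (fun x y => pi (x, y) * G y)) /= exchange_big /=.
  by apply: eq_bigr => x _; rewrite -mulr_suml pi2.
rewrite -big_split /=; apply: ler_sum => -[x y] _ /=; rewrite -mulrDr.
have [->|pn0] := eqVneq (pi (x, y)) 0; first by rewrite !mul0r.
have pp : 0 < pi (x, y) by rewrite lt_def pn0 pi0.
rewrite ler_pM2l //; apply: FG.
  by rewrite -pi1 (bigD1 y) //= ltr_wpDr // sumr_ge0.
by rewrite -pi2 (bigD1 x) //= ltr_wpDr // sumr_ge0.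
Qed.

Lemma W1_ge0 : 0 <= W1 d mu nu.
Proof.
rewrite /W1; set A := (X in inf X).
(* The infimum of the empty set is [0] by convention. *)
have [->|/set0P Ane] := eqVneq A classical_sets.set0; first by rewrite inf0.
apply: lb_le_inf => // _ [pi [pi0 _ _] <-]; apply: sumr_ge0 => p _.
by rewrite mulr_ge0.
Qed.

End WassersteinBounds.

(** * Gibbs measures in terms of parent functions *)

Section GibbsParent.
Variables (R : realType) (V : finType) (E : {set {set V}}) (r : V) (b : R).
Hypothesis E_pairs : E \subset vertex_pairs V.
Local Notation C := (component E r).
Local Notation d := (gdist E r).
Local Notation nr := (nonroot E r).
Local Notation pfun := (pfun E r).
Local Notation spt := (spt E r).
Local Notation depth := (depth r).
Local Notation tree_of := (tree_of E r).
Local Notation choices := (choices E r).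
Implicit Types (p : {ffun V -> V}) (B : {set V}).

Definition pw p : R := expR (- (b * \sum_(v in C) (depth p v)%:R)).

Definition partition_fun : R := \sum_(p in pfun) pw p.
Local Notation Z := partition_fun.

Definition muE (F : {ffun V -> V} -> R) : R := \sum_(p in pfun) pw p / Z * F p.

Lemma pw_gt0 p : 0 < pw p. Proof. exact: expR_gt0. Qed.

Lemma spt_pfun p : p \in spt -> p \in pfun.
Proof. by case/sptP. Qed.

Lemma partition_fun_gt0 : 0 < Z.
Proof.
have [p pS] := card_gt0P (card_spt_gt0 E r).
by rewrite /Z (bigD1 p) ?spt_pfun //= ltr_wpDr ?pw_gt0 // sumr_ge0 // => q _; apply/ltW/pw_gt0.
Qed.

Lemma gibbs_weight_tree p : p \in pfun -> gibbs_weight b E r (tree_of p) = pw p.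
Proof.
move=> pp; rewrite /gibbs_weight /pw; congr (expR (- (b * _))).
by apply: eq_bigr => v Cv; rewrite gdist_tree.
Qed.

Lemma gibbs_tree p : p \in pfun -> gibbs b E r (tree_of p) = pw p / Z.
Proof.
move=> pp; rewrite /gibbs spanning_treesE // imset_f // gibbs_weight_tree //.
congr (_ / _); rewrite big_imset; last exact: tree_of_inj.
by apply: eq_bigr => q pq; rewrite gibbs_weight_tree.
Qed.

Lemma sum_gibbs F : \sum_T gibbs b E r T * F T = muE (F \o tree_of).
Proof.
transitivity (\sum_(T in spanning_trees E r) gibbs b E r T * F T).
  rewrite [RHS]big_mkcond; apply: eq_bigr => T _; rewrite /gibbs.
  by case: ifP => // _; rewrite mul0r.
rewrite spanning_treesE // big_imset; last exact: tree_of_inj.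
by apply: eq_bigr => p pp; rewrite gibbs_tree.
Qed.

Lemma gibbs_inf_tree p : p \in pfun ->
  gibbs_inf R E r (tree_of p) = (p \in spt)%:R / #|spt|%:R.
Proof.
move=> pp; rewrite /gibbs_inf shortest_path_treesE //.
rewrite card_in_imset; last first.
  by move=> p1 p2 /spt_pfun s1 /spt_pfun s2; apply: tree_of_inj.
have -> : (tree_of p \in [set tree_of x | x in spt]%SET) = (p \in spt).
  apply/imsetP/idP => [[q qs /tree_of_inj]|ps]; last by exists p.
  by move=> /(_ pp (spt_pfun qs)) ->.
by case: ifP; rewrite ?mul1r ?mul0r.
Qed.

Lemma sum_gibbs_inf F :
  \sum_T gibbs_inf R E r T * F T = \sum_(p in spt) #|spt|%:R^-1 * F (tree_of p).
Proof.
transitivity (\sum_(T in shortest_path_trees E r) gibbs_inf R E r T * F T).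
  rewrite [RHS]big_mkcond; apply: eq_bigr => T _; rewrite /gibbs_inf.
  by case: ifP => // _; rewrite mul0r.
rewrite shortest_path_treesE // big_imset; last first.
  by move=> p1 p2 /spt_pfun s1 /spt_pfun s2; apply: tree_of_inj.
by apply: eq_bigr => p ps; rewrite gibbs_inf_tree ?spt_pfun // ps mul1r.
Qed.

Lemma muE_cst c : muE (fun=> c) = c.
Proof.
by rewrite /muE -mulr_suml -mulr_suml divff ?mul1r // gt_eqF // partition_fun_gt0.
Qed.

Lemma muE_le F G : (forall p, p \in pfun -> F p <= G p) -> muE F <= muE G.
Proof.
move=> FG; apply: ler_sum => p pp; rewrite ler_wpM2l ?FG //.
by rewrite divr_ge0 // ltW ?pw_gt0 ?partition_fun_gt0.
Qed.

Lemma muED F G : muE (fun p => F p + G p) = muE F + muE G.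
Proof. by rewrite /muE -big_split; apply: eq_bigr => f _; rewrite mulrDr. Qed.

Lemma muEZ c F : muE (fun p => c * F p) = c * muE F.
Proof. by rewrite /muE mulr_sumr; apply: eq_bigr => f _; rewrite mulrCA. Qed.

Lemma gibbs_ge0 T : 0 <= gibbs b E r T.
Proof.
rewrite /gibbs; case: ifP => // _; rewrite divr_ge0 ?expR_ge0 // sumr_ge0 // => T' _.
exact: expR_ge0.
Qed.

Lemma gibbs_inf_ge0 T : 0 <= gibbs_inf R E r T.
Proof. by rewrite /gibbs_inf; case: ifP => // _; rewrite invr_ge0. Qed.

Lemma gibbs_sum1 : \sum_T gibbs b E r T = 1.
Proof. by under eq_bigr do rewrite -[gibbs _ _ _ _]mulr1; rewrite sum_gibbs muE_cst. Qed.

Lemma gibbs_inf_sum1 : \sum_T gibbs_inf R E r T = 1.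
Proof.
under eq_bigr do rewrite -[gibbs_inf _ _ _ _]mulr1; rewrite sum_gibbs_inf.
under eq_bigr do rewrite mulr1.
by rewrite sumr_const -[RHS](@mulVf _ #|spt|%:R) ?mulr_natr // pnatr_eq0 -lt0n card_spt_gt0.
Qed.

(* Depth functions, frozen to [0] outside the component. *)
Definition depth_fun (h : {ffun V -> 'I_#|V|.+1}) : bool :=
  [forall v, (~~ nr v) ==> (h v == ord0)].

Lemma depth_fun_root h : depth_fun h -> (h r : nat) = 0%N.
Proof. by move=> /forallP/(_ r); rewrite nonroot_root => /eqP ->. Qed.

(** Parent functions split into boxes according to their depths, and the Gibbs weight is constant on
    each box: given the depths, the parents are independent and uniform. *)
Lemma sum_pfun_depth (F : {ffun V -> V} -> R) :
  \sum_(p in pfun) F p =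
  \sum_(h | depth_fun h) \sum_(p in box (choices (fun v => h v : nat))) F p.
Proof.
pose dh p : {ffun V -> 'I_#|V|.+1} :=
  [ffun v => if nr v then inord (depth p v) else ord0].
have dhE p : p \in pfun -> {in C, forall v, (dh p v : nat) = depth p v}.
  move=> pp v Cv; rewrite ffunE; have [->|nv] := root_or_nonroot Cv.
    by rewrite nonroot_root depth_root.
  by rewrite nv inordK // ltnS ltnW // (@depth_lt _ E).
rewrite (partition_big dh depth_fun) /=; last first.
  by move=> p pp; apply/forallP => v; apply/implyP => /negbTE nv; rewrite ffunE nv.
apply: eq_bigr => h dfh; apply: eq_bigl => p; apply/andP/boxP.
  move=> [pp /eqP <-] v; rewrite (@choices_ext _ _ _ _ (depth p)) ?choices_depth //.
  exact: dhE.
move=> pb; have [pp pd] := @choicesP V E r (fun v => h v) p (depth_fun_root dfh) pb; split => //.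
apply/eqP/ffunP => v; have [nv|nv] := boolP (nr v).
  by apply: val_inj; rewrite /= dhE ?(nonrootC nv) // pd // (nonrootC nv).
rewrite ffunE (negbTE nv); apply/esym/eqP.
by move: dfh => /forallP/(_ v)/implyP; apply.
Qed.

Lemma card_box_depth h p : depth_fun h -> p \in box (choices (fun v => h v : nat)) ->
  pw p = expR (- (b * \sum_(v in C) (h v)%:R)).
Proof.
move=> dfh /boxP /(@choicesP V E r (fun v => h v) p (depth_fun_root dfh))[_ pd].
by rewrite /pw; congr (expR (- (b * _))); apply: eq_bigr => v Cv; rewrite pd.
Qed.

Definition deg v := #|[set u | adj E u v]%SET|.

(** * Low temperature *)

Definition bad p : {set V} := [set v | nr v && (d v < depth p v)%N]%SET.

(* Expected number of children of [u] in a uniform shortest path tree. *)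
Definition wt u : R := \sum_(v | nr v && (u \in choices d v)) #|choices d v|%:R^-1.

Lemma wt_ge0 u : 0 <= wt u.
Proof. by apply: sumr_ge0 => v _; rewrite invr_ge0. Qed.

(** Double counting: both sides are the expected number of vertices whose parent in a uniform
    shortest path tree lies in [B]. *)
Lemma sum_wt (B : {set V}) :
  \sum_(u in B) wt u = \sum_(v | nr v) #|choices d v :&: B|%:R / #|choices d v|%:R.
Proof.
rewrite /wt (exchange_big_dep nr) => [|u v _ /andP[]//] /=.
apply: eq_bigr => v nv; rewrite (eq_bigl (mem (choices d v :&: B)%SET)) => [|u].
  by rewrite sumr_const mulr_natl.
by rewrite !inE nv /= andbC.
Qed.

Lemma depth_good p v : p \in pfun -> v \in C -> v \notin bad p -> depth p v = d v.
Proof.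
move=> pp Cv; rewrite inE negb_and -leqNgt; have [->|nv] := root_or_nonroot Cv.
  by rewrite depth_root gdist_root.
by rewrite nv /= => le; apply/eqP; rewrite eqn_leq le gdist_le_depth.
Qed.

(** A parent [u] of a good [v] has depth [d v - 1]. Its depth is at least [d u], and [d u] is at
    least [d v - 1] along the edge, so [u] is good and a shortest path parent. *)
Lemma choices_good p v : p \in pfun -> nr v -> v \notin bad p ->
  choices (depth p) v = choices d v :\: bad p.
Proof.
move=> pp nv gv; apply/setP => u; rewrite /choices nv !inE (depth_good pp (nonrootC nv) gv).
have [uv|] := boolP (adj E u v); last by rewrite andbF.
have Cu : u \in C by apply: (component_adj (nonrootC nv)); rewrite adj_sym.
have [->|nu] := root_or_nonroot Cu; first by rewrite nonroot_root depth_root gdist_root.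
rewrite nu /= -leqNgt; have := gdist_le_depth pp Cu.
by case: (ltngtP (depth p u) (d u)) => //= [lt|->//] _; apply/eqP => e;
  have := gdist_adj Cu uv; rewrite e; lia.
Qed.

(* Law of the new parent of [v] given its parent [y] in the tree [p]: the
   maximal coupling of the uniform laws on [choices (depth p) v] and
   [choices d v] when the former is contained in the latter. *)
Definition kap p v (x y : V) : R :=
  if x \in choices d v then
    if (v \notin bad p) && (x \in choices (depth p) v) then
      (x == y)%:R * #|choices (depth p) v|%:R / #|choices d v|%:R
    else #|choices d v|%:R^-1
  else 0.

Lemma card_choices_gt0 v : 0 < #|choices d v|%:R :> R.
Proof. by rewrite ltr0n choices_gdist_neq0. Qed.

Lemma kap_ge0 p v x y : 0 <= kap p v x y.
Proof.
rewrite /kap; case: ifP => // _; case: ifP => _; last by rewrite invr_ge0.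
by rewrite !mulr_ge0 // invr_ge0.
Qed.

Lemma bad_nonroot p v : v \in bad p -> nr v.
Proof. by rewrite inE => /andP[]. Qed.

Lemma choices_good_sub p v : p \in pfun -> v \notin bad p ->
  choices (depth p) v \subset choices d v.
Proof.
move=> pp gv; have [nv|nv] := boolP (nr v).
  by rewrite choices_good // finset.subsetDl.
by rewrite /choices (negbTE nv).
Qed.

Lemma sum_kap_l p v y : p \in pfun -> y \in choices (depth p) v ->
  \sum_x kap p v x y = 1.
Proof.
move=> pp yP; rewrite /kap -big_mkcond /=; have c0 := card_choices_gt0 v.
have [bv|gv] := boolP (v \in bad p); rewrite /=.
  by rewrite sumr_const -[_ *+ _]mulr_natl divff // gt_eqF.
have sub := choices_good_sub pp gv.
rewrite (bigID (mem (choices (depth p) v))) /=.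
rewrite (bigD1 y) /=; last by rewrite yP (fintype.subsetP sub).
rewrite yP eqxx mul1r big1 ?addr0; last first.
  by move=> x /andP[/andP[_ ->] /negbTE ->]; rewrite !mul0r.
rewrite (eq_bigr (fun=> #|choices d v|%:R^-1)); last by move=> x /andP[_ /negbTE ->].
rewrite (eq_bigl (mem (choices d v :\: choices (depth p) v)%SET)); last first.
  by move=> x; rewrite !inE andbC.
rewrite sumr_const -[X in _ + X]mulr_natl -mulrDl -natrD.
by rewrite cardsD (finset.setIidPr sub) subnKC ?subset_leq_card // divff // gt_eqF.
Qed.

(** After division by the number of possible [y], this says that a uniform old parent yields a new
    parent uniform on [choices d v], which gives the coupling its first marginal. *)
Lemma sum_kap_r p v x : p \in pfun ->
  \sum_(y in choices (depth p) v) kap p v x y =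
  (x \in choices d v)%:R * #|choices (depth p) v|%:R / #|choices d v|%:R.
Proof.
move=> pp; rewrite /kap; have [xd|xd] := boolP (x \in choices d v); last first.
  by rewrite big1 // !mul0r.
rewrite mul1r; have [/andP[gv xP]|_] := boolP ((v \notin bad p) && (x \in choices (depth p) v)).
  rewrite (bigD1 x) //= eqxx mul1r big1 ?addr0 // => y /andP[_ /negbTE].
  by rewrite eq_sym => ->; rewrite !mul0r.
by rewrite sumr_const mulr_natl.
Qed.

Lemma kap_ext p p' v x y : p \in pfun -> p' \in pfun -> {in C, depth p =1 depth p'} ->
  kap p v x y = kap p' v x y.
Proof.
move=> pp pp' e; rewrite /kap (choices_ext v e).
have -> : bad p = bad p'; last by [].
apply/setP => u; rewrite !inE; have [nu|//] := boolP (nr u).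
by rewrite e // nonrootC.
Qed.

(** The coupling: the second tree has the Gibbs law and, given it, the parents are rerouted
    independently by [kap]. *)
Definition rho (pq : {ffun V -> V} * {ffun V -> V}) : R :=
  (pq.2 \in pfun)%:R * (pw pq.2 / Z) * \prod_v kap pq.2 v (pq.1 v) (pq.2 v).

Lemma sum_prod_kap p : p \in pfun ->
  \sum_(q : {ffun V -> V}) \prod_v kap p v (q v) (p v) = 1.
Proof.
move=> pp; rewrite -(bigA_distr_bigA (fun v x => kap p v x (p v))) big1 // => v _.
by rewrite sum_kap_l // choices_depth.
Qed.

Lemma sum_rho_r (p : {ffun V -> V}) :
  \sum_q rho (q, p) = (p \in pfun)%:R * (pw p / Z).
Proof.
rewrite /rho /= -mulr_sumr; have [pp|] := boolP (p \in pfun); last by rewrite !mul0r.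
by rewrite sum_prod_kap // mulr1.
Qed.

(** Since [kap] sees [p] only through the depths, the sum over one box of the depth decomposition
    factorises over the vertices. *)
Lemma sum_rho_l (q : {ffun V -> V}) : \sum_p rho (q, p) = (q \in spt)%:R / #|spt|%:R.
Proof.
rewrite /rho /=.
transitivity (\sum_(p in pfun) pw p / Z * \prod_v kap p v (q v) (p v)).
  rewrite [RHS]big_mkcond; apply: eq_bigr => p _.
  by case: ifP; rewrite ?mul1r ?mul0r.
rewrite sum_pfun_depth.
transitivity (\sum_(h | depth_fun h) expR (- (b * \sum_(v in C) (h v)%:R)) / Z *
   ((q \in spt)%:R / #|spt|%:R * #|box (choices (fun v => h v : nat))|%:R)); last first.
  have ZE : Z = \sum_(h | depth_fun h) expR (- (b * \sum_(v in C) (h v)%:R)) *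
      #|box (choices (fun v => h v : nat))|%:R.
    rewrite {1}/partition_fun sum_pfun_depth; apply: eq_bigr => h dfh.
    rewrite (eq_bigr (fun=> expR (- (b * \sum_(v in C) (h v)%:R)))).
      by rewrite sumr_const mulr_natr.
    by move=> p pb; rewrite (card_box_depth dfh pb).
  transitivity (\sum_(h | depth_fun h) ((q \in spt)%:R / #|spt|%:R / Z) *
     (expR (- (b * \sum_(v in C) (h v)%:R)) * #|box (choices (fun v => h v : nat))|%:R)).
    by apply: eq_bigr => h _; ring.
  by rewrite -mulr_sumr -ZE mulfVK // gt_eqF // partition_fun_gt0.
apply: eq_bigr => h dfh.
(* An empty box contributes nothing to either side; otherwise any member [p0] represents the common
   value of [kap] on the box. *)
have [->|[p0 p0b]] := set_0Vmem (box (choices (fun v => h v : nat))).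
  by rewrite big_set0 cards0 !mulr0.
have H p : p \in box (choices (fun v => h v : nat)) ->
    p \in pfun /\ {in C, forall v, depth p v = h v}.
  by move=> /boxP; apply: (@choicesP V E r (fun v => h v) p (depth_fun_root dfh)).
have [pp0 pd0] := H _ p0b.
rewrite (eq_bigr (fun p => expR (- (b * \sum_(v in C) (h v)%:R)) / Z *
   \prod_v kap p0 v (q v) (p v))); last first.
  move=> p pb; have [pp pd] := H _ pb; rewrite (card_box_depth dfh pb).
  congr (_ * _); apply: eq_bigr => v _; apply: kap_ext => // u Cu.
  by rewrite pd // pd0.
rewrite -mulr_sumr; congr (_ * _); rewrite (sum_box _ (fun v y => kap p0 v (q v) y)).
transitivity (\prod_v ((q v \in choices d v)%:R / #|choices d v|%:R *
    #|choices (fun v => h v : nat) v|%:R : R)).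
  apply: eq_bigr => v _; rewrite -(choices_ext v (pd0 : {in C, depth p0 =1 _})).
  by rewrite sum_kap_r // mulrAC.
rewrite big_split /= card_spt card_box !natr_prod; congr (_ * _).
rewrite big_split /= prodfV; congr (_ * _).
have [/boxP qs|] := boolP (q \in spt); first by rewrite big1 // => v _; rewrite qs.
rewrite inE negb_forall => /existsP[v /negbTE qv].
by rewrite (bigD1 v) //= qv mul0r.
Qed.

Lemma natr_pdiff p q :
  (pdiff E r p q)%:R = \sum_(v | nr v) (p v != q v)%:R :> R.
Proof.
rewrite /pdiff -sum1_card natr_sum big_mkcond [RHS]big_mkcond /=.
by apply: eq_bigr => v _; rewrite inE; case: (nr v) => //=; case: (p v != q v).
Qed.

(** A bad vertex changes parent with probability at most one, a good one with probability the
    proportion of bad vertices among its choices. By [sum_wt] these proportions add up to the weight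
    of the bad set. *)
Lemma W1_le_bad :
  W1 (hamming E r) (gibbs_inf R E r) (gibbs b E r)
    <= muE (fun p => \sum_(u in bad p) (1 + wt u)).
Proof.
have spanP T : T \notin [set tree_of p | p in pfun]%SET -> forall p, p \in pfun -> tree_of p != T.
  by move=> H p pp; apply: contraNneq H => <-; rewrite imset_f.
have rho_ge0 pq : 0 <= rho pq.
  apply: mulr_ge0; last by apply: prodr_ge0 => v _; apply: kap_ge0.
  by rewrite mulr_ge0 // divr_ge0 // ltW ?pw_gt0 ?partition_fun_gt0.
have rho_supp pq : rho pq != 0 -> pq.1 \in spt /\ pq.2 \in pfun.
  move=> nz; split.
    apply/negPn/negP => ns; move: nz; apply/negP/negPn/eqP.
    have := sum_rho_l pq.1; rewrite (negbTE ns) mul0r (bigD1 pq.2) //= -surjective_pairing.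
    move/eqP; rewrite paddr_eq0 ?sumr_ge0 //; first by case/andP => /eqP.
  by apply/negPn/negP => /negbTE np; move: nz; rewrite /rho np !mul0r eqxx.
apply: (@le_trans _ _ (\sum_pq rho pq * (hamming E r (tree_of pq.1) (tree_of pq.2))%:R)).
  apply: W1_le => // T.
    have [/imsetP[p pp ->]|nT] := boolP (T \in [set tree_of p | p in pfun]%SET).
      rewrite gibbs_inf_tree // -sum_rho_l.
      rewrite (bigID (fun pq => pq.1 == p)) /= [X in _ + X]big1 ?addr0.
        rewrite (eq_bigl (fun pq : _ * _ => (pq.1 == p) && true)) => [|pq].
          by rewrite -(pair_big (pred1 p) xpredT (fun q p => rho (q, p))) big_pred1_eq.
        by rewrite andbT; case: (pq.1 =P p) => [->|_]; rewrite ?eqxx ?andbF.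
      move=> pq /andP[/eqP e /eqP ne]; apply/eqP/negPn/negP => /rho_supp[s1 _].
      by apply: ne; apply: (tree_of_inj (spt_pfun s1) pp e).
    rewrite big1 => [|pq /eqP e].
      rewrite /gibbs_inf shortest_path_treesE //; case: ifP => // /imsetP[p ps e].
      by have := spanP _ nT _ (spt_pfun ps); rewrite e eqxx.
    apply/eqP/negPn/negP => /rho_supp[s1 _].
    by have := spanP _ nT _ (spt_pfun s1); rewrite e eqxx.
  have [/imsetP[p pp ->]|nT] := boolP (T \in [set tree_of p | p in pfun]%SET).
    rewrite gibbs_tree // -[RHS]mul1r -[X in X * _]/((true)%:R) -pp -sum_rho_r.
    rewrite (bigID (fun pq => pq.2 == p)) /= [X in _ + X]big1 ?addr0.
      rewrite (eq_bigl (fun pq : _ * _ => true && (pq.2 == p))) => [|pq].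
        rewrite -(pair_big xpredT (pred1 p) (fun q p => rho (q, p))) /=.
        by apply: eq_bigr => q _; rewrite big_pred1_eq.
      by case: (pq.2 =P p) => [->|_]; rewrite ?eqxx ?andbF.
    move=> pq /andP[/eqP e /eqP ne]; apply/eqP/negPn/negP => /rho_supp[_ s1].
    by apply: ne; apply: (tree_of_inj s1 pp e).
  rewrite big1 => [|pq /eqP e].
    by rewrite /gibbs spanning_treesE // (negbTE nT).
  apply/eqP/negPn/negP => /rho_supp[_ s1].
  by have := spanP _ nT _ s1; rewrite e eqxx.
rewrite (eq_bigr (fun pq => rho pq * (pdiff E r pq.1 pq.2)%:R)); last first.
  move=> pq _; have [->|/rho_supp[s1 s2]] := eqVneq (rho pq) 0; first by rewrite !mul0r.
  by rewrite (hamming_tree (spt_pfun s1) s2).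
rewrite (eq_bigr (fun pq => rho (pq.1, pq.2) * (pdiff E r pq.1 pq.2)%:R)); last by case.
rewrite -(pair_bigA _ (fun q p => rho (q, p) * (pdiff E r q p)%:R)) /= exchange_big /=.
rewrite /muE [leRHS]big_mkcond /=; apply: ler_sum => p _.
have [pp|np] := boolP (p \in pfun); last first.
  by rewrite big1 // => q _; rewrite /rho (negbTE np) !mul0r.
rewrite /rho /= pp mul1r.
rewrite (eq_bigr (fun q : {ffun V -> V} => pw p / Z * ((\prod_v kap p v (q v) (p v)) *
   (pdiff E r q p)%:R))); last by move=> q _; rewrite mulrA.
rewrite -mulr_sumr; apply: ler_wpM2l.
  by rewrite divr_ge0 // ltW ?pw_gt0 ?partition_fun_gt0.
pose ww v x := kap p v x (p v).
have ww1 v : \sum_x ww v x = 1 by apply: sum_kap_l => //; apply: choices_depth.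
have -> : \sum_(q : {ffun V -> V}) (\prod_v kap p v (q v) (p v)) * (pdiff E r q p)%:R =
  pE ww (fun q => \sum_(v | nr v) (q v != p v)%:R).
  by apply: eq_bigr => q _; rewrite natr_pdiff.
rewrite pE_sum big_split /= sum_wt.
have -> : \sum_(u in bad p) (1 : R) = \sum_(v | nr v) (v \in bad p)%:R.
  rewrite [LHS]big_mkcond [RHS]big_mkcond; apply: eq_bigr => v _ /=.
  have [vb|] := boolP (v \in bad p); last by case: ifP.
  by rewrite (bad_nonroot vb).
rewrite -big_split /=; apply: ler_sum => v nv.
rewrite (pE_coord ww1 v (fun x => (x != p v)%:R)).
have [bv|gv] := boolP (v \in bad p).
  apply: (@le_trans _ _ 1); last by rewrite lerDl divr_ge0.
  rewrite -[leRHS](ww1 v); apply: ler_sum => x _; rewrite ler_piMr ?kap_ge0 //.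
  by case: (x != p v).
rewrite add0r.
have -> : \sum_x ww v x * (x != p v)%:R = 1 - ww v (p v).
  rewrite -[X in _ = X - _](ww1 v) (bigD1 (p v)) //= [X in X - _](bigD1 (p v)) //= eqxx mulr0 add0r.
  by rewrite addrAC subrr add0r; apply: eq_bigr => x ->; rewrite mulr1.
have pc := choices_depth v pp.
have sub := choices_good_sub pp gv.
rewrite /ww /kap (fintype.subsetP sub) // gv pc eqxx mul1r /=.
have c0 := card_choices_gt0 v.
rewrite choices_good // cardsD natrB ?subset_leq_card ?finset.subsetIl //.
by rewrite mulrBl divff ?gt_eqF // opprB addrC subrK.
Qed.

Lemma sum_gdist_bad p : p \in pfun ->
  \sum_(v in C) (d v)%:R + #|bad p|%:R <= \sum_(v in C) (depth p v)%:R :> R.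
Proof.
move=> pp; have -> : #|bad p|%:R = \sum_(v in C) (v \in bad p)%:R :> R.
  rewrite -sum1_card natr_sum big_mkcond [RHS]big_mkcond /=; apply: eq_bigr => v _.
  have [vb|] := boolP (v \in bad p); last by case: ifP.
  by rewrite (nonrootC (bad_nonroot vb)).
rewrite -big_split /=; apply: ler_sum => v Cv; rewrite -natrD ler_nat.
have [|_] := boolP (v \in bad p); last by rewrite addn0 gdist_le_depth.
by rewrite inE => /andP[_]; rewrite addn1.
Qed.

(** For [s = 0] this bounds the price of making [v] bad; the summand [1] in the exponent pays for
    the children of a bad set that are bad themselves. The tilt [s] absorbs the factor
    [exp (s (1 + wt v))] of an exponential moment of the cost. *)
Definition bad_factor s v : R :=
  expR (1 + s - b) * (deg v)%:R / #|choices d v|%:R * expR (- ((1 - s) * wt v)).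

Lemma bad_factor_ge0 s v : 0 <= bad_factor s v.
Proof. by rewrite /bad_factor !mulr_ge0 ?expR_ge0. Qed.

Hypothesis b_ge0 : 0 <= b.

(* A vertex outside [B] keeps only its shortest path parents outside [B], and
   [1 - x <= exp (- x)] turns this into the factor [exp (- wt u)] for [u] in [B]. *)
Lemma muE_bad (B : {set V}) :
  muE (fun p => (bad p == B)%:R) <= \prod_(v in B) ((nr v)%:R * bad_factor 0 v).
Proof.
pose F v : {set V} := if v \in B then [set u | adj E u v]%SET
                      else (choices d v :\: B)%SET.
have [BN|nB] := boolP (B \subset [set v | nr v]%SET); last first.
  rewrite /muE big1; first by apply: prodr_ge0 => v _; rewrite mulr_ge0 ?bad_factor_ge0.
  move=> p pp; have [e|_] := eqVneq (bad p) B; last by rewrite mulr0.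
  case/negP: nB; rewrite -e; apply/fintype.subsetP => v /bad_nonroot nv; by rewrite inE.
have nB v : v \in B -> nr v by move=> /(fintype.subsetP BN); rewrite inE.
pose e0 := expR (- (b * \sum_(v in C) (d v)%:R)).
have Zge : e0 * #|spt|%:R <= Z.
  rewrite mulr_natr -sumr_const /partition_fun [leRHS](bigID (mem spt)) /=.
  rewrite -[leLHS]addr0; apply: lerD; last first.
    by apply: sumr_ge0 => p _; apply/ltW/pw_gt0.
  have -> : \sum_(p in pfun | p \in spt) pw p = \sum_(p in spt) pw p.
    by apply: eq_bigl => p; apply/andP/idP => [[]//|ps]; rewrite spt_pfun.
  apply: ler_sum => p /sptP[pp pd]; rewrite /pw le_eqVlt; apply/orP; left.
  by apply/eqP; congr (expR (- (b * _))); apply: eq_bigr => v Cv; rewrite pd.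
have Nle : muE (fun p => (bad p == B)%:R) <= e0 * expR (- (b * #|B|%:R)) / Z * #|box F|%:R.
  rewrite mulr_natr -sumr_const /muE big_mkcond [leRHS]big_mkcond /=.
  apply: ler_sum => p _.
  have rhs0 : 0 <= (if p \in box F then e0 * expR (- (b * #|B|%:R)) / Z else 0).
    case: ifP => // _; rewrite divr_ge0 ?mulr_ge0 ?expR_ge0 //.
    exact/ltW/partition_fun_gt0.
  have [pp|//] := boolP (p \in pfun); have [bB|_] := eqVneq (bad p) B; last by rewrite mulr0.
  have -> : p \in box F.
    apply/boxP => v; rewrite /F; case: ifP => [vB|/negbT vB].
      by rewrite inE (pfun_adj pp) // nB.
    have [nv|nv] := boolP (nr v); last first.
      by rewrite finset.in_setD (pfun_fix pp nv) vB /choices (negbTE nv) set11.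
    by have := choices_depth v pp; rewrite choices_good // bB.
  rewrite mulr1 ler_wpM2r ?invr_ge0 ?(ltW partition_fun_gt0) //.
  rewrite /pw /e0 -expRD ler_expR -opprD lerN2 -mulrDr ler_wpM2l //.
  by rewrite -bB sum_gdist_bad.
apply: (le_trans Nle).
have -> : \prod_(v in B) ((nr v)%:R * bad_factor 0 v) = \prod_(v in B) bad_factor 0 v.
  by apply: eq_bigr => v /nB ->; rewrite mul1r.
have c0 v := card_choices_gt0 v.
have sp0 : 0 < #|spt|%:R :> R by rewrite ltr0n card_spt_gt0.
apply: (@le_trans _ _ (expR (- (b * #|B|%:R)) * (#|box F|%:R / #|spt|%:R))).
  rewrite (_ : _ * #|box F|%:R = expR (- (b * #|B|%:R)) * #|box F|%:R * (e0 / Z)).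
    rewrite [leRHS]mulrA ler_wpM2l ?mulr_ge0 ?expR_ge0 // ler_pdivrMr ?partition_fun_gt0 //.
    by rewrite ler_pdivlMl // mulrC.
  by ring.
have -> : #|box F|%:R / #|spt|%:R = \prod_v (#|F v|%:R / #|choices d v|%:R) :> R.
  by rewrite card_box card_spt !natr_prod prodf_div.
rewrite (bigID (mem B)) /=.
have P1 : \prod_(v in B) (#|F v|%:R / #|choices d v|%:R) =
    \prod_(v in B) ((deg v)%:R / #|choices d v|%:R) :> R.
  by apply: eq_bigr => v vB; rewrite /F vB.
have P2 : \prod_(v | v \notin B) (#|F v|%:R / #|choices d v|%:R) <=
    expR (#|B|%:R - \sum_(v in B) wt v) :> R.
  rewrite sum_wt.
  apply: (@le_trans _ _ (\prod_(v | v \notin B) expR (- ((nr v)%:R *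
      (#|choices d v :&: B|%:R / #|choices d v|%:R))))).
    apply: ler_prod => v vB; rewrite divr_ge0 //= /F (negbTE vB).
    have [nv|nv] := boolP (nr v); last first.
      rewrite mul0r oppr0 expR0 ler_pdivrMr // mul1r ler_nat.
      by rewrite subset_leq_card // finset.subsetDl.
    rewrite mul1r; apply: le_trans (expR_ge1Dx _).
    rewrite cardsD natrB ?subset_leq_card ?finset.subsetIl // mulrBl divff //.
    by rewrite gt_eqF.
  rewrite -expR_sum ler_expR sumrN lerNl opprB lerBlDr.
  rewrite [leLHS]big_mkcond [X in _ <= X + _]big_mkcond /=.
  have -> : #|B|%:R = \sum_v (v \in B)%:R :> R.
    by rewrite -sum1_card natr_sum big_mkcond; apply: eq_bigr => v _; case: ifP.
  rewrite -big_split /=; apply: ler_sum => v _.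
  have [nv|_] := boolP (nr v); rewrite ?mul1r ?mul0r.
    case: (v \in B); rewrite ?addr0 //= add0r ler_pdivrMr // mul1r ler_nat.
    by rewrite subset_leq_card // finset.subsetIl.
  by case: ifP; rewrite addr_ge0.
rewrite P1 mulrA.
apply: (le_trans (ler_wpM2l _ P2)).
  by rewrite mulr_ge0 ?expR_ge0 // prodr_ge0 // => v _; rewrite divr_ge0.
rewrite le_eqVlt; apply/orP; left; apply/eqP.
rewrite /bad_factor; under [RHS]eq_bigr do rewrite -mulrA mulrC mulrA subr0 mul1r addr0.
rewrite -[#|B|%:R]mul1r [1 * _]mulr_natr -sumr_const mulr_sumr -sumrB -sumrN.
rewrite !expR_sum -!big_split /=; apply: eq_bigr => v _.
by rewrite mulr1 !expRD; ring.
Qed.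

Lemma card_nonroot_le : \sum_(v | nr v) 1 <= #|V|%:R :> R.
Proof. by rewrite sumr_const ler_nat max_card. Qed.

Lemma sum_bad_le p : \sum_(u in bad p) (1 + wt u) <= 2 * #|V|%:R.
Proof.
rewrite big_split /= sum_wt mulr_natl mulr2n; apply: lerD.
  by rewrite sumr_const ler_nat max_card.
apply: le_trans card_nonroot_le; apply: ler_sum => v nv.
by rewrite ler_pdivrMr ?card_choices_gt0 // mul1r ler_nat subset_leq_card // finset.subsetIl.
Qed.

(** Exponential Markov inequality at level [t] for the cost of the bad set, which never exceeds
    [2 #|V|]. Summed over all sets, the product bound becomes a product of [1 + z v], at most the
    exponential of the sum of the factors. *)
Lemma W1_low (s t : R) : 0 <= s -> 0 <= t ->
  W1 (hamming E r) (gibbs_inf R E r) (gibbs b E r) <=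
  t + 2 * #|V|%:R * expR (\sum_(v | nr v) bad_factor s v - s * t).
Proof.
move=> s0 t0; apply: (le_trans W1_le_bad).
pose f (B : {set V}) := \sum_(u in B) (1 + wt u).
have H p : f (bad p) <= t + 2 * #|V|%:R * expR (- (s * t)) * expR (s * f (bad p)).
  have -> : 2 * #|V|%:R * expR (- (s * t)) * expR (s * f (bad p)) =
      2 * #|V|%:R * expR (s * (f (bad p) - t)).
    by rewrite -mulrA -expRD; congr (_ * expR _); ring.
  have n0 : 0 <= 2 * #|V|%:R :> R by rewrite mulr_ge0.
  have [le|lt] := leP (f (bad p)) t.
    by apply: (le_trans le); rewrite lerDl mulr_ge0 // expR_ge0.
  apply: (@le_trans _ _ (t + 2 * #|V|%:R * 1)).
    by rewrite mulr1; apply: (le_trans (sum_bad_le p)); rewrite lerDr.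
  rewrite lerD2l ler_wpM2l // -expR0 ler_expR mulr_ge0 //.
  by rewrite subr_ge0 ltW.
apply: (le_trans (muE_le (fun p _ => H p))).
rewrite muED muE_cst muEZ lerD2l addrC expRD mulrA ler_wpM2l // ?mulr_ge0 ?expR_ge0 //.
have -> : muE (fun p => expR (s * f (bad p))) =
  \sum_B expR (s * f B) * muE (fun p => (bad p == B)%:R).
  rewrite (eq_bigr (fun B => muE (fun p => expR (s * f B) * (bad p == B)%:R))); last first.
    by move=> B _; rewrite muEZ.
  rewrite /muE exchange_big /=; apply: eq_bigr => p pp.
  rewrite -mulr_sumr; congr (_ * _); rewrite (bigD1 (bad p)) //= eqxx mulr1 big1 ?addr0 //.
  by move=> B /negbTE; rewrite eq_sym => ->; rewrite mulr0.
pose z v := (nr v)%:R * bad_factor s v.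
apply: (@le_trans _ _ (\sum_(B : {set V}) \prod_(v in B) z v)).
  apply: ler_sum => B _; apply: (le_trans (ler_wpM2l (expR_ge0 _) (muE_bad B))).
  rewrite /f mulr_sumr expR_sum -big_split /= le_eqVlt; apply/orP; left; apply/eqP.
  apply: eq_bigr => v _; rewrite /z /bad_factor mulrCA; congr (_ * _).
  have e : expR (1 + s - b) * expR (- ((1 - s) * wt v)) =
      expR (s * (1 + wt v)) * (expR (1 + 0 - b) * expR (- ((1 - 0) * wt v))).
    by rewrite -!expRD; congr expR; ring.
  transitivity (expR (1 + s - b) * expR (- ((1 - s) * wt v)) *
      ((deg v)%:R / #|choices d v|%:R)); last by ring.
  by rewrite e; ring.
have -> : \sum_(B : {set V}) \prod_(v in B) z v = \prod_v (z v + 1).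
  rewrite bigA_distr; apply: eq_big => B; first by rewrite inE.
  by rewrite big_mkcond.
apply: (@le_trans _ _ (\prod_v expR (z v))).
  apply: ler_prod => v _; rewrite addr_ge0 ?mulr_ge0 ?bad_factor_ge0 //=.
  by rewrite addrC expR_ge1Dx.
rewrite -expR_sum ler_expR [leRHS]big_mkcond; apply: ler_sum => v _.
by rewrite /z; case: (nr v); rewrite ?mul1r ?mul0r.
Qed.

End GibbsParent.

(* The notations of the next sections shadow these constants. *)
Local Notation choices_def := choices (only parsing).
Local Notation muE_def := muE (only parsing).
Local Notation pw_def := pw (only parsing).
Local Notation wt_def := wt (only parsing).

(** * Counting and convexity tools for the high temperature case *)

Lemma ler_sum_inj (R : realType) (I J : finType) (A : {pred I}) (B : {pred J})
    (f : I -> J) (F : J -> R) :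
  {in A &, injective f} -> (forall i, i \in A -> f i \in B) -> (forall j, 0 <= F j) ->
  \sum_(i in A) F (f i) <= \sum_(j in B) F j.
Proof.
move=> fi fB F0; rewrite -(big_imset F fi) /=.
rewrite [leRHS](bigID (mem [set f x | x in A]%SET)) /=.
rewrite -[leLHS]addr0; apply: lerD; last by apply: sumr_ge0.
rewrite le_eqVlt; apply/orP; left; apply/eqP; apply: eq_bigl => j.
by apply/idP/andP => [/imsetP[i Ai ->]|[]//]; rewrite fB // imset_f.
Qed.

Lemma subset_of_card (V : finType) (A : {set V}) (m : nat) : (m <= #|A|)%N ->
  exists2 B : {set V}, B \subset A & #|B| = m.
Proof.
move=> mA; exists [set z in take m (enum A)]%SET.
  by apply/fintype.subsetP => z; rewrite inE => /mem_take; rewrite mem_enum.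
rewrite cardsE; have -> : #|take m (enum A)| = size (take m (enum A)).
  by apply/card_uniqP; apply: take_uniq; apply: enum_uniq.
by rewrite size_takel // -cardE.
Qed.

Lemma half_subset (V : finType) (A : {set V}) :
  exists2 B : {set V}, B \subset A & #|B| = uphalf #|A|.
Proof. by apply: subset_of_card; rewrite leq_uphalf_double -addnn leq_addr. Qed.

(** Converse of [1 - x <= exp (- x)] for small [x]: one has [- ln (1 - x) <= x / (1 - x)], and the
    range of [x] makes [1 / (1 - x)] at most [1 + e]. *)
Lemma expR_le_1B (R : realType) (e x : R) : 0 < e -> 0 <= x -> x <= e / (1 + e) ->
  expR (- ((1 + e) * x)) <= 1 - x.
Proof.
move=> e0 x0 xe; have e1 : 0 < 1 + e by lra.
have x1 : (1 + e)^-1 <= 1 - x.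
  have -> : (1 + e)^-1 = 1 - e / (1 + e) by field; lra.
  lra.
have x1' : 0 < 1 - x by apply: lt_le_trans x1; rewrite invr_gt0.
apply: (@le_trans _ _ (expR (- (x / (1 - x))))).
  rewrite ler_expR lerN2 [leRHS]mulrC ler_wpM2l //.
  by rewrite -[leRHS]invrK lef_pV2 ?posrE ?invr_gt0.
rewrite expRN -[leRHS]invrK lef_pV2 ?posrE ?expR_gt0 ?invr_gt0 //.
have := expR_ge1Dx (x / (1 - x)); apply: le_trans.
by rewrite le_eqVlt; apply/orP; left; apply/eqP; field; lra.
Qed.

(** Jensen's inequality for [exp (- x)], through its tangent at [c]. *)
Lemma sum_expRN_ge (R : realType) (I : finType) (S : {set I}) (f : I -> R) (c : R) :
  \sum_(i in S) f i <= c * #|S|%:R ->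
  #|S|%:R * expR (- c) <= \sum_(i in S) expR (- f i).
Proof.
move=> fc; apply: (@le_trans _ _ (\sum_(i in S) expR (- c) * (1 + (c - f i)))).
  rewrite -mulr_sumr mulrC ler_wpM2l ?expR_ge0 // big_split /= sumrB !sumr_const.
  by rewrite -[c *+ _]mulr_natr lerDl subr_ge0.
apply: ler_sum => i _.
have -> : expR (- f i) = expR (- c) * expR (c - f i) by rewrite -expRD; congr expR; ring.
by rewrite ler_wpM2l ?expR_ge0 // expR_ge1Dx.
Qed.

Section AverageUnhit.
Variables (R : realType) (V : finType) (Ch : V -> {set V}) (S N0 : {set V}) (e : R).
Hypothesis e_gt0 : 0 < e.
Hypothesis Ch_big : forall v, v \in N0 -> (1 + e) / e <= #|Ch v|%:R.

Definition unhit (f : {ffun V -> V}) : {set V} :=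
  [set u in S | [forall v in N0, f v != u]]%SET.

(** Under independent uniform choices [u] is missed with probability at least [exp (- (1 + e) w u)],
    where [w u] is its expected number of hits. These expectations add up to at most [#|V|], so
    Jensen's inequality applies to their average. [Ch_big] keeps each single hit probability in the
    range of [expR_le_1B]. *)
Lemma sum_unhit (K : R) : 0 < K -> K <= #|S|%:R ->
  #|box Ch|%:R * (K * expR (- ((1 + e) * #|V|%:R / K))) <=
  \sum_(f in box Ch) #|unhit f|%:R.
Proof.
move=> K0 KS.
pose phi (u v x : V) : R := if v \in N0 then (x != u)%:R else 1.
have unhitE f : #|unhit f|%:R = \sum_(u in S) \prod_v phi u v (f v).
  rewrite -sum1_card natr_sum big_mkcond [RHS]big_mkcond /=; apply: eq_bigr => u _.
  rewrite inE; case: (u \in S) => //=; have [/forall_inP H|] := boolP [forall v in N0, f v != u].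
    by rewrite big1 // => v _; rewrite /phi; case: ifP => // /H ->.
  rewrite negb_forall => /existsP[v]; rewrite negb_imply negbK => /andP[vN /eqP <-].
  by rewrite (bigD1 v) //= /phi vN eqxx mul0r.
rewrite (eq_bigr _ (fun f _ => unhitE f)) exchange_big /=.
pose w u : R := \sum_(v in N0) (u \in Ch v)%:R / #|Ch v|%:R.
have w_ge0 u : 0 <= w u by apply: sumr_ge0 => v _; rewrite divr_ge0.
have e1 : 0 < 1 + e by move: e_gt0; lra.
have H u : #|box Ch|%:R * expR (- ((1 + e) * w u)) <=
    \sum_(f in box Ch) \prod_v phi u v (f v).
  rewrite sum_box card_box natr_prod mulr_sumr -sumrN expR_sum.
  rewrite [X in _ * X]big_mkcond -big_split /=.
  apply: ler_prod => v _; rewrite mulr_ge0 //=; last by case: ifP; rewrite ?expR_ge0.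
  rewrite /phi; case: ifP => [vN|_]; last by rewrite sumr_const mulr1.
  have c0 : 0 < #|Ch v|%:R :> R.
    by apply: lt_le_trans (Ch_big vN); rewrite divr_gt0.
  have -> : \sum_(x in Ch v) (x != u)%:R = #|Ch v|%:R - (u \in Ch v)%:R :> R.
    have [uC|uC] := boolP (u \in Ch v); last first.
      rewrite subr0 -sum1_card natr_sum; apply: eq_bigr => x xC.
      by case: eqP => // xu; rewrite -xu xC in uC.
    rewrite (bigD1 u) //= eqxx add0r (eq_bigr (fun=> 1)) => [|x /andP[_ ->]//].
    rewrite -[X in X - _](_ : \sum_(x in Ch v) 1 = _); last by rewrite sumr_const.
    by rewrite [in RHS](bigD1 u) //= addrAC subrr add0r.
  have -> : #|Ch v|%:R - (u \in Ch v)%:R = #|Ch v|%:R * (1 - (u \in Ch v)%:R / #|Ch v|%:R) :> R.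
    by field; rewrite gt_eqF.
  rewrite ler_wpM2l //; apply: expR_le_1B => //.
  apply: (@le_trans _ _ (#|Ch v|%:R^-1)).
    by case: (u \in Ch v); rewrite ?mul1r // mul0r invr_ge0 ltW.
  rewrite -[leRHS]invrK lef_pV2 ?posrE ?invr_gt0 ?divr_gt0 //.
  by rewrite invf_div Ch_big.
apply: (@le_trans _ _ (\sum_(u in S) #|box Ch|%:R * expR (- ((1 + e) * w u)))); last first.
  by apply: ler_sum.
rewrite -mulr_sumr ler_wpM2l //.
have sw : \sum_(u in S) w u <= #|V|%:R.
  rewrite exchange_big /=; apply: (@le_trans _ _ (\sum_(v in N0) 1)); last first.
    by rewrite sumr_const ler_nat max_card.
  apply: ler_sum => v vN; rewrite -mulr_suml.
  have c0 : 0 < #|Ch v|%:R :> R.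
    by apply: lt_le_trans (Ch_big vN); rewrite divr_gt0.
  rewrite ler_pdivrMr // mul1r -natr_sum ler_nat -sum1_card [leqRHS]big_mkcond [leqLHS]big_mkcond /=.
  by apply: leq_sum => u _; case: (u \in S); case: (u \in Ch v).
apply: le_trans (sum_expRN_ge (c := (1 + e) * #|V|%:R / K) _); last first.
  rewrite -mulr_sumr; apply: (@le_trans _ _ ((1 + e) * #|V|%:R)).
    by rewrite ler_wpM2l // ltW.
  rewrite -[leLHS]mulr1 -[leRHS]mulrA ler_wpM2l ?mulr_ge0 ?(ltW e1) //.
  by rewrite ler_pdivlMl // mulr1.
by rewrite ler_wpM2r ?expR_ge0.
Qed.

End AverageUnhit.

(** * High temperature: entropy against energy *)

Section HighTemperature.
Variables (R : realType) (V : finType) (E : {set {set V}}) (r : V) (b : R).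
Hypothesis E_pairs : E \subset vertex_pairs V.
Hypothesis b_ge0 : 0 <= b.
Local Notation C := (component E r).
Local Notation d := (gdist E r).
Local Notation nr := (nonroot E r).
Local Notation pfun := (pfun E r).
Local Notation spt := (spt E r).
Local Notation depth := (depth r).
Local Notation tree_of := (tree_of E r).
Local Notation choices := (choices E r).
Local Notation muE := (@muE R V E r b).
Local Notation pw := (@pw R V E r b).
Local Notation Z := (partition_fun E r b).
Local Notation deg := (deg E).
Local Notation wt := (wt R E r).
Local Notation n := (#|V|%:R : R).
Implicit Types (p q : {ffun V -> V}) (A B S : {set V}).

Definition level k : {set V} := [set v in C | d v == k]%SET.
Definition ball k : {set V} := [set v in C | (d v <= k)%N]%SET.
Definition nb S v := #|[set u in S | adj E u v]%SET|.

Lemma sum_nb A S : (\sum_(v in A) nb S v = \sum_(u in S) nb A u)%N.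
Proof.
rewrite /nb; under eq_bigr do rewrite -sum1_card.
under [RHS]eq_bigr do rewrite -sum1_card.
rewrite (exchange_big_dep (mem S)) /= => [|v u _]; last by rewrite inE => /andP[].
apply: eq_bigr => u uS; apply: eq_bigl => v; rewrite !inE uS /=.
by rewrite adj_sym.
Qed.

Lemma nb_le_deg S v : (nb S v <= deg v)%N.
Proof.
by apply: subset_leq_card; apply/fintype.subsetP => u; rewrite !inE => /andP[].
Qed.

(** ** Resampling the parents on a set *)

Section Resample.
Variables (A : {set V}) (h0 : V -> nat) (Q : V -> {set V}).
Let moved v := (v \in A) && (v != r).
Hypothesis A_comp : A \subset C.
Hypothesis A_root : r \in A.
Hypothesis h0_root : h0 r = 0%N.
Hypothesis Q_moved : forall v u, moved v -> u \in Q v ->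
  [/\ u \in A, adj E u v & h0 v = (h0 u).+1].
Hypothesis Q_fixed : forall v, ~~ moved v -> Q v = [set v]%SET.
Hypothesis Q_neq0 : forall v, (0 < #|Q v|)%N.

(** The parents inside [A] are forgotten and drawn anew so that the depths on [A] become [h0]; the
    rest of the tree keeps its parents and is carried along. *)
Definition resample p q : {ffun V -> V} := [ffun v => if moved v then q v else p v].

Lemma resampleP p q : p \in pfun -> q \in box Q ->
  [/\ resample p q \in pfun, {in A, forall v, depth (resample p q) v = h0 v} &
      forall v, v \in C -> v \notin A ->
        depth (resample p q) v = (depth (resample p q) (p v)).+1].
Proof.
move=> pp /boxP qQ.
(* The new depth is found by following [p] up to its first vertex in [A]; the old depth is enough
   fuel because the root belongs to [A]. *)
pose hf := fix hf m v := if v \in A then h0 v else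
  if m is m'.+1 then (hf m' (p v)).+1 else 0%N.
have hfA m v : v \in A -> hf m v = h0 v by case: m => [|m] /= ->.
pose h v := hf (depth p v) v.
have hA v : v \in A -> h v = h0 v by move=> vA; apply: hfA.
have nrA v : nr v -> v \notin A -> h v = (h (p v)).+1.
  by move=> nv /negbTE vA; rewrite /h (depth_step pp nv) /= vA.
have mvE v : nr v -> moved v = (v \in A) by rewrite /moved => /andP[_ ->]; rewrite andbT.
have [rp rd] : resample p q \in pfun /\ {in C, forall v, depth (resample p q) v = h v}.
  apply: pfunI => [v nv|v nv|].
    rewrite ffunE mvE //; case: ifP => [vA|/negbT vA]; last by rewrite (pfun_adj pp) // nrA.
    have mv : moved v by rewrite mvE.
    by have [uA uv hv] := Q_moved mv (qQ v); rewrite uv !hA.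
    rewrite ffunE (pfun_fix pp) //; case: ifP => // /andP[vA vr].
    by case/negP: nv; rewrite /nonroot (fintype.subsetP A_comp).
  by rewrite hA.
split => // [v vA|v Cv vA].
  by rewrite rd ?hA // (fintype.subsetP A_comp).
have nv : nr v by rewrite /nonroot Cv; apply: contraNneq vA => ->.
by rewrite !rd ?pfun_comp // nrA.
Qed.

(** Count the pairs [(p, q)]. Each [p] has [#|box Q|] images, lighter in energy by [gain]. A given
    image determines [q], and it determines [p] except for its parents on the moved vertices, for
    which there are at most the product of the degrees. *)
Lemma muE_resample (P : pred {ffun V -> V}) (gain : R) :
  (forall p q, p \in pfun -> P p -> q \in box Q ->
    \sum_(v in C) (depth (resample p q) v)%:R + gain <= \sum_(v in C) (depth p v)%:R) ->
  muE (fun p => (P p)%:R) <=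
  expR (- (b * gain)) * \prod_(v | moved v) ((deg v)%:R / #|Q v|%:R).
Proof.
move=> Pgain.
have Z0 : 0 < Z by apply: partition_fun_gt0.
have cQ0 : 0 < #|box Q|%:R :> R by rewrite card_box ltr0n prodn_gt0.
have cQE : #|box Q|%:R = \prod_(v | moved v) #|Q v|%:R :> R.
  rewrite card_box natr_prod [RHS]big_mkcond; apply: eq_bigr => v _.
  by case: ifP => // /negbT /Q_fixed ->; rewrite cards1.
have mE : muE (fun p => (P p)%:R) = (\sum_(p in pfun | P p) pw p) / Z.
  rewrite /muE_def mulr_suml [LHS]big_mkcond [RHS]big_mkcond; apply: eq_bigr => p _.
  by case: (p \in pfun) => //=; case: (P p); rewrite ?mulr1 ?mulr0.
rewrite prodf_div -cQE mE ler_pdivrMr // mulrA mulrAC ler_pdivlMr // mulr_suml.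
apply: (@le_trans _ _ (expR (- (b * gain)) *
   \sum_(p in pfun) \sum_(q in box Q) pw (resample p q))).
  rewrite mulr_sumr big_mkcondr /=; apply: ler_sum => p pp; case: ifP => [Pp|_]; last first.
    by rewrite mulr_ge0 ?expR_ge0 // sumr_ge0 // => q _; apply/ltW/pw_gt0.
  rewrite mulr_natr -sumr_const mulr_sumr; apply: ler_sum => q qQ.
  rewrite /pw_def -expRD ler_expR -opprD lerN2 -mulrDr ler_wpM2l //.
  by rewrite addrC Pgain.
rewrite -mulrA ler_wpM2l ?expR_ge0 //.
(* [N t] lists, vertex by vertex, the parents that a preimage of the image [t] can have. *)
pose N q v : {set V} := if moved v then [set u | adj E u v]%SET else [set q v]%SET.
have cN q : #|box (N q)|%:R = \prod_(v | moved v) (deg v)%:R :> R.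
  rewrite card_box natr_prod [RHS]big_mkcond; apply: eq_bigr => v _.
  by rewrite /N; case: ifP => // _; rewrite cards1.
apply: (@le_trans _ _ (\sum_(p in pfun) \sum_(q in box Q)
    \sum_(t in pfun) pw t * (resample p q == t)%:R)).
  apply: ler_sum => p pp; apply: ler_sum => q qQ.
  have [rp _ _] := resampleP pp qQ.
  rewrite (bigD1 (resample p q)) //= eqxx mulr1 lerDl sumr_ge0 // => t _.
  by rewrite mulr_ge0 // ltW // pw_gt0.
rewrite (eq_bigr (fun p => \sum_(t in pfun) \sum_(q in box Q) pw t * (resample p q == t)%:R)); last first.
  by move=> p _; rewrite exchange_big.
rewrite exchange_big /= /partition_fun mulr_sumr; apply: ler_sum => t tp.
under eq_bigr do rewrite -mulr_sumr.
rewrite -mulr_sumr mulrC ler_wpM2r //; first exact/ltW/pw_gt0.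
rewrite -(cN t) -sum1_card natr_sum big_mkcond [leRHS]big_mkcond /=.
apply: ler_sum => p _; case: ifP => [pp|_]; last by case: ifP.
have [q0 /andP[q0Q /eqP q0t]|none] :=
  pickP (fun q => (q \in box Q) && (resample p q == t)); last first.
  rewrite big1 => [|q qQ]; first by case: ifP.
  by have := none q; rewrite qQ /= => ->.
have -> : p \in box (N t).
  apply/boxP => v; rewrite /N; case mv: (moved v); last by rewrite -q0t ffunE mv set11.
  by case/andP: mv => vA vr; rewrite inE (pfun_adj pp) // /nonroot (fintype.subsetP A_comp).
rewrite (bigD1 q0) //= q0t eqxx big1 ?addr0 // => q /andP[qQ qq0].
case: eqP => // qt; case/eqP: qq0; apply/ffunP => v.
have /ffunP/(_ v) : resample p q = resample p q0 by rewrite qt.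
rewrite !ffunE; case: ifP => // /negbT mv _.
have /boxP/(_ v) := qQ; have /boxP/(_ v) := q0Q; rewrite !Q_fixed // !inE.
by move=> /eqP -> /eqP ->.
Qed.

Lemma resample_depth_le p q c : p \in pfun -> q \in box Q ->
  (forall v, v \in A -> (h0 v <= depth p v + c)%N) ->
  forall v, v \in C -> (depth (resample p q) v <= depth p v + c)%N.
Proof.
move=> pp qQ h0c v; have [rp rA rC] := resampleP pp qQ.
move: {2}(depth p v) (erefl (depth p v)) => k; elim: k v => [|k IH] v dk Cv.
  have [vr|nv] := root_or_nonroot Cv; first by rewrite rA ?vr ?h0_root.
  by rewrite (depth_step pp nv) in dk.
have [vA|vA] := boolP (v \in A); first by rewrite rA ?h0c.
have [vr|nv] := root_or_nonroot Cv; first by rewrite vr A_root in vA.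
rewrite rC // (depth_step pp nv) addSn ltnS; apply: IH; last by rewrite pfun_comp.
by move: dk; rewrite (depth_step pp nv) => -[].
Qed.

End Resample.

Definition late_children k p : {set V} :=
  [set v in C | [&& (k < d v)%N, (d (p v) <= k)%N & (d (p v) < depth p (p v))%N]]%SET.

(** Give the vertices of the ball shortest path parents: no depth increases, and a late child gains
    at least one since its parent was too deep. *)
Lemma muE_late_children k (t : R) :
  muE (fun p => (t <= #|late_children k p|%:R)%R%:R) <=
  expR (- (b * t)) * \prod_(v | (v \in ball k) && (v != r)) (deg v)%:R.
Proof.
pose Q v : {set V} := if (v \in ball k) && (v != r) then choices d v else [set v]%SET.
have bC : ball k \subset C by apply/fintype.subsetP => v; rewrite inE => /andP[].
have br : r \in ball k by rewrite inE component_root gdist_root.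
have Qm v u : (v \in ball k) && (v != r) -> u \in Q v ->
    [/\ u \in ball k, adj E u v & d v = (d u).+1].
  move=> mv; rewrite /Q mv; case/andP: mv => vb vr; have Cv := fintype.subsetP bC _ vb.
  have nv : nr v by apply/andP.
  rewrite /choices_def nv inE => /andP[uv /eqP dv]; split => //.
  rewrite inE (component_adj Cv) 1?adj_sym //=; move: vb; rewrite inE dv => /andP[_].
  exact: ltnW.
have Qf v : ~~ ((v \in ball k) && (v != r)) -> Q v = [set v]%SET.
  by move=> /negbTE mv; rewrite /Q mv.
have Q0 v : (0 < #|Q v|)%N by rewrite /Q; case: ifP; rewrite ?choices_gdist_neq0 ?cards1.
apply: (le_trans (@muE_resample (ball k) d Q bC br (gdist_root E r) Qm Qf Q0 _ t _)).
  move=> p q pp tX qQ; apply: (@le_trans _ _ (\sum_(v in C) (depth (resample (ball k) p q) v)%:R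
     + #|late_children k p|%:R)); first by rewrite lerD2l.
  have -> : #|late_children k p|%:R = \sum_(v in C) (v \in late_children k p)%:R :> R.
    rewrite -sum1_card natr_sum big_mkcond [RHS]big_mkcond /=; apply: eq_bigr => v _.
    by rewrite inE; case: (v \in C) => //=; case: ifP.
  rewrite -big_split /=; apply: ler_sum => v Cv; rewrite -natrD ler_nat.
  have [rp rA rC] := resampleP bC br (gdist_root E r) Qm pp qQ.
  have le u : u \in C -> (depth (resample (ball k) p q) u <= depth p u)%N.
    move=> Cu; rewrite -[leqRHS]addn0.
    apply: (resample_depth_le bC br (gdist_root E r) Qm pp qQ) => // w wb.
    by rewrite addn0 gdist_le_depth // (fintype.subsetP bC).
  have [|_] := boolP (v \in late_children k p); last by rewrite addn0 le.
  rewrite inE => /and4P[_ dv dpv lt].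
  have vA : v \notin ball k by rewrite inE Cv /= -ltnNge.
  have nv : nr v by rewrite /nonroot Cv; apply: contraNneq vA => ->.
  have pA : p v \in ball k by rewrite inE pfun_comp.
  by rewrite rC // rA // (depth_step pp nv) addn1.
rewrite ler_wpM2l ?expR_ge0 //; apply: ler_prod => v _.
rewrite divr_ge0 //= ler_pdivrMr ?ltr0n // ler_peMr // ler1n.
exact: Q0.
Qed.

Section LevelD.
Variable D : nat.
Hypothesis D_gt0 : (0 < D)%N.

Definition top p : {set V} := [set u in level D | depth p u == D]%SET.

Definition rich S k : {set V} :=
  [set v in C | [&& (D <= d v)%N, v \notin S & (k <= nb S v)%N]]%SET.

Definition poor S k : {set V} :=
  [set v in C | [&& (D <= d v)%N, v \notin S & (nb S v < k)%N]]%SET.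

Definition deep p : {set V} := [set v in level D.+1 | (D.+1 < depth p v)%N]%SET.

(** Straighten the ball and [S0], and hang every rich vertex below [S0] at depth [D.+1]. Deep
    vertices that are not poor gain at least one and vertices of [top] lose at most one. A poor
    vertex keeps its parent and sinks by at most one, while it may have been counted as deep, hence
    the coefficient two. A rich vertex pays only the ratio of its degree to [k0]. *)
Lemma muE_deep (S0 : {set V}) (k0 : nat) (t : R) :
  S0 \subset level D -> (0 < k0)%N ->
  muE (fun p => (t + 2 * #|poor S0 k0|%:R + #|top p|%:R <= #|deep p|%:R)%R%:R) <=
  expR (- (b * t)) * \prod_(v in C) (Num.max 1 (deg v)%:R) / k0%:R ^+ #|rich S0 k0|.
Proof.
move=> S0L k00; set G := rich S0 k0; set X := poor S0 k0.
pose A := (ball D.-1 :|: S0 :|: G)%SET.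
pose h0 v := if v \in G then D.+1 else d v.
pose moved v := (v \in A) && (v != r).
pose Q v : {set V} := if moved v then
   (if v \in G then [set u in S0 | adj E u v]%SET else choices d v) else [set v]%SET.
have S0P u : u \in S0 -> u \in C /\ d u = D.
  by move=> /(fintype.subsetP S0L); rewrite inE => /andP[? /eqP].
have GC v : v \in G -> [/\ v \in C, (D <= d v)%N & v \notin S0].
  by rewrite inE => /and4P[].
have bP v : (v \in ball D.-1) = (v \in C) && (d v < D)%N.
  by rewrite inE; congr andb; rewrite -[D in RHS](prednK D_gt0) ltnS.
have AC : A \subset C.
  apply/fintype.subsetP => v; rewrite !finset.in_setU -orbA => /or3P[|/S0P[]|/GC[]] //.
  by rewrite bP => /andP[].
have Ar : r \in A by rewrite !finset.in_setU bP component_root gdist_root D_gt0.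
have rG : r \notin G.
  by apply/negP => /GC[_]; rewrite gdist_root leqNgt D_gt0.
have h0r : h0 r = 0%N by rewrite /h0 (negbTE rG) gdist_root.
have Qm v u : moved v -> u \in Q v -> [/\ u \in A, adj E u v & h0 v = (h0 u).+1].
  move=> mv; rewrite /Q mv /h0; case: ifP => [vG|vG].
    rewrite inE => /andP[uS uv]; have [Cu du] := S0P _ uS.
    have uG : u \notin G by apply/negP => /GC[_ _]; rewrite uS.
    by rewrite !finset.in_setU uS orbT (negbTE uG) du.
  case/andP: mv => vA vr; have Cv := fintype.subsetP AC _ vA.
  have nv : nr v by apply/andP.
  rewrite /choices_def nv inE => /andP[uv /eqP dv].
  have Cu : u \in C by apply: (component_adj Cv); rewrite adj_sym.
  have du : (d u < D)%N.
    move: vA; rewrite !finset.in_setU vG orbF bP Cv /= dv => /orP[|/S0P[_]]; first exact: ltnW.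
    by rewrite dv => <-.
  have uG : u \notin G by apply/negP => /GC[_]; rewrite leqNgt du.
  by rewrite !finset.in_setU bP Cu du (negbTE uG).
have Qf v : ~~ moved v -> Q v = [set v]%SET by move=> /negbTE mv; rewrite /Q mv.
have Q0 v : (0 < #|Q v|)%N.
  rewrite /Q; case: ifP => _; last by rewrite cards1.
  case: ifP => [|_]; last exact: choices_gdist_neq0.
  by rewrite inE => /and4P[_ _ _]; apply: leq_trans.
have compl v : v \in C -> v \notin A -> v \in X.
  move=> Cv; rewrite !finset.in_setU bP Cv /= !negb_or -leqNgt => /andP[/andP[Dv vS]].
  by rewrite inE Cv Dv vS /= -ltnNge => vk; rewrite inE Cv Dv vS.
have XA v : v \in X -> v \notin A.
  rewrite inE => /and4P[Cv Dv vS vk]; rewrite !finset.in_setU bP Cv /= ltnNge Dv /=.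
  by rewrite (negbTE vS) inE /= Cv Dv vS /= -ltnNge.
apply: (le_trans (@muE_resample A h0 Q AC Ar h0r Qm Qf Q0 _ t _)).
  move=> p q pp tX qQ; set Y := deep p in tX.
  apply: (@le_trans _ _ (\sum_(v in C) (depth (resample A p q) v)%:R
     + (#|Y|%:R - #|top p|%:R - 2 * #|X|%:R))); first by rewrite lerD2l; lra.
  have indC (B : {set V}) : B \subset C -> #|B|%:R = \sum_(v in C) (v \in B)%:R :> R.
    move=> BC; rewrite -sum1_card natr_sum big_mkcond [RHS]big_mkcond /=; apply: eq_bigr => v _.
    have [vB|] := boolP (v \in B); last by case: ifP.
    by rewrite (fintype.subsetP BC).
  rewrite (indC Y); last by apply/fintype.subsetP => v; rewrite !inE => /andP[/andP[]].
  rewrite (indC (top p)); last by apply/fintype.subsetP => v; rewrite !inE => /andP[/andP[]].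
  rewrite (indC X); last by apply/fintype.subsetP => v; rewrite !inE => /andP[].
  rewrite mulr_sumr -!sumrB -big_split /=; apply: ler_sum => v Cv.
  have [rp rA rC] := resampleP AC Ar h0r Qm pp qQ.
  have h01 w : w \in A -> (h0 w <= depth p w + 1)%N.
    move=> wA; have Cw := fintype.subsetP AC _ wA; have := gdist_le_depth pp Cw.
    rewrite /h0 addn1; case: ifP => [/GC[_ dw _] le|_ le]; last exact: leqW.
    by rewrite ltnS (leq_trans dw).
  have [vA|vA] := boolP (v \in A); last first.
    have := resample_depth_le AC Ar h0r Qm pp qQ h01 Cv.
    rewrite (compl _ Cv vA) -(ler_nat R) natrD.
    by case: (v \in Y); case: (v \in top p) => /=; lra.
  have -> : v \in X = false by apply/negP => /XA; rewrite vA.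
  rewrite rA // mulr0 subr0; have dle := gdist_le_depth pp Cv.
  rewrite /h0; case: ifP => [vG|/negbT vG].
    have [_ Dv vS] := GC _ vG.
    have [|vT] := boolP (v \in top p).
      rewrite inE => /andP[_ /eqP eD]; have -> : v \in Y = false.
        by apply/negP; rewrite inE eD => /andP[_]; rewrite ltnNge ltnW.
      by rewrite eD -natr1 /=; lra.
    have Dv' : (D.+1 <= depth p v)%N.
      rewrite ltn_neqAle (leq_trans Dv dle) andbT; apply: contraNneq vT => eD.
      by rewrite inE inE Cv /= -eD eqxx andbT eqn_leq Dv andbT [X in (_ <= X)%N]eD.
    have [|_] := boolP (v \in Y); last by rewrite subr0 addr0 ler_nat.
    by rewrite inE => /andP[_ lt]; rewrite subr0 natr1 ler_nat.
  have dv : (d v <= D)%N.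
    by move: vA; rewrite !finset.in_setU (negbTE vG) orbF bP Cv /= => /orP[|/S0P[_ ->]] // /ltnW.
  have -> : v \in Y = false by apply/negP; rewrite inE inE Cv /= => /andP[/eqP e _]; rewrite e ltnn in dv.
  have : (d v)%:R <= (depth p v)%:R :> R by rewrite ler_nat.
  by case: (v \in top p) => /=; lra.
rewrite -mulrA ler_wpM2l ?expR_ge0 //.
have AG : \prod_(v | moved v) ((deg v)%:R / #|Q v|%:R) <=
   \prod_(v in C) ((Num.max 1 (deg v)%:R) * (if v \in G then k0%:R^-1 else 1)) :> R.
  rewrite [leLHS]big_mkcond [leRHS]big_mkcond /=; apply: ler_prod => v _.
  have mx : 1 <= Num.max 1 (deg v)%:R :> R by rewrite le_max lexx.
  have mx2 : (deg v)%:R <= Num.max 1 (deg v)%:R :> R by rewrite le_max lexx orbT.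
  case: ifP => [mv|mv]; rewrite ?ler01 ?divr_ge0 //=.
    have Cv : v \in C by case/andP: mv => /(fintype.subsetP AC).
    rewrite Cv; apply: ler_pM => //.
    rewrite /Q mv; case: ifP => [vG|_].
      rewrite lef_pV2 ?posrE ?ltr0n ?ler_nat //; last first.
        by move: vG; rewrite inE => /and4P[_ _ _]; apply: leq_trans.
      by move: vG; rewrite inE => /and4P[].
    by rewrite invf_le1 ?ltr0n ?ler1n choices_gdist_neq0.
  case: ifP => // Cv; case: ifP => [vG|_]; last by rewrite mulr1.
  move: mv; rewrite /moved !finset.in_setU vG orbT /= => /negbT; rewrite negbK => /eqP vr.
  by rewrite -vr vG in rG.
apply: (le_trans AG); rewrite big_split /= le_eqVlt; apply/orP; left; apply/eqP.
congr (_ * _); rewrite -big_mkcondr /= (eq_bigl (mem G)) => [|v].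
  by rewrite prodr_const exprVn.
by apply/andP/idP => [[]//|vG]; have [] := GC _ vG.
Qed.

Lemma level_nonroot u : u \in level D -> nr u.
Proof.
rewrite inE => /andP[Cu /eqP du]; rewrite /nonroot Cu; apply: contraTneq D_gt0 => ur.
by rewrite -du ur gdist_root.
Qed.

Lemma topP p u : u \in top p -> [/\ nr u, d u = D & depth p u = D].
Proof.
rewrite inE => /andP[uL /eqP dp]; rewrite level_nonroot //.
by move: uL; rewrite inE => /andP[_ /eqP].
Qed.

Definition leaves p : {set V} :=
  [set u in top p | [forall v, nr v ==> (p v != u)]]%SET.

Definition move_leaf (u : V) (pu : {ffun V -> V} * V) : {ffun V -> V} :=
  [ffun v => if v == u then pu.2 else pu.1 v].

Lemma move_leafP p u u' : p \in pfun -> u \in leaves p -> u' \in top p ->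
  adj E u' u -> move_leaf u (p, u') \in pfun /\
  pw (move_leaf u (p, u')) = pw p * expR (- b).
Proof.
move=> pp; rewrite inE => /andP[uT /forallP lf] uT' uu'.
have [nu du dpu] := topP uT; have [nu' du' dpu'] := topP uT'.
have u'u : (u' == u) = false by apply: contraTF uu' => /eqP ->; rewrite adj_irr.
pose h v := if v == u then D.+1 else depth p v.
have [mp md] : move_leaf u (p, u') \in pfun /\
    {in C, forall v, depth (move_leaf u (p, u')) v = h v}.
  apply: pfunI => [v nv|v nv|]; rewrite ?ffunE /h /=.
      have [->|vu] := eqVneq v u; first by rewrite u'u dpu'.
      rewrite (pfun_adj pp nv) (depth_step pp nv).
      by have := lf v; rewrite nv /= => /negbTE ->.
    have [vu|_] := eqVneq v u; first by rewrite vu nu in nv.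
    exact: (pfun_fix pp nv).
  have [ru|_] := eqVneq r u; last exact: depth_root.
  by rewrite -ru nonroot_root in nu.
split => //; rewrite /pw_def -expRD; congr expR.
have Cu := nonrootC nu.
have -> : \sum_(v in C) (depth (move_leaf u (p, u')) v)%:R =
    \sum_(v in C) (depth p v)%:R + 1 :> R.
  rewrite (bigD1 u) //= [in RHS](bigD1 u) //= md // /h eqxx dpu addrAC natr1.
  congr (_ + _); apply: eq_bigr => v /andP[Cv /negbTE vu]; rewrite md // /h.
  by rewrite vu.
by ring.
Qed.

(** Moving a leaf [u] from a parent [w] in the level below to [u'] in [top] costs one unit of depth.
    Given [u] and [w] the move can be undone, so the total weight of all images is at most the
    number of pairs [(u, w)]. *)
Lemma muE_leaf_moves :
  expR (- b) * muE (fun p => \sum_(u in leaves p) (nb (top p) u)%:R) <=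
  \sum_(u in level D) (nb (level D.-1) u)%:R.
Proof.
have Z0 : 0 < Z by apply: partition_fun_gt0.
have -> : expR (- b) * muE (fun p => \sum_(u in leaves p) (nb (top p) u)%:R) =
  \sum_(p in pfun) \sum_(u in leaves p) \sum_(u' | (u' \in top p) && adj E u' u)
     (pw (move_leaf u (p, u')) / Z).
  rewrite /muE_def mulr_sumr; apply: eq_bigr => p pp; rewrite !mulr_sumr.
  apply: eq_bigr => u ul; rewrite /nb -sum1_card natr_sum !mulr_sumr.
  rewrite (eq_bigl (fun u' => (u' \in top p) && adj E u' u)) => [|u']; last by rewrite inE.
  apply: eq_bigr => u' /andP[ut uu']; have [_ ->] := move_leafP pp ul ut uu'.
  by ring.
rewrite (exchange_big_dep (mem (level D))) /=; last first.
  by move=> p u _; rewrite !inE => /andP[/andP[]].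
apply: ler_sum => u uL; rewrite pair_big_dep /=.
pose W := [set w in level D.-1 | adj E w u]%SET.
rewrite (partition_big (fun pu : {ffun V -> V} * V => pu.1 u) (mem W)) /=; last first.
  move=> [p u'] /= /andP[/andP[pp ul] _].
  move: (ul); rewrite inE => /andP[/topP[nu du dpu] _].
  rewrite inE (pfun_adj pp nu) andbT inE (pfun_comp pp (nonrootC nu)) /=.
  have := gdist_adj (pfun_comp pp (nonrootC nu)) (pfun_adj pp nu).
  have := gdist_le_depth pp (pfun_comp pp (nonrootC nu)).
  move: dpu; rewrite (depth_step pp nu) du => <- /=; rewrite ltnS => le1 le2.
  by rewrite eqn_leq le1 le2.
rewrite /nb -/W -[leRHS]mulr1 mulr_natl -sumr_const; apply: ler_sum => w wW.
rewrite -[leRHS](_ : \sum_(p in pfun) pw p / Z = 1); last first.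
  by rewrite -mulr_suml divff // gt_eqF.
apply: (@ler_sum_inj R _ _ _ (mem pfun) (move_leaf u) (fun p => pw p / Z)).
    move=> [p1 u1] [p2 u2]; rewrite !unfold_in /=.
    move=> /andP[/andP[_ /andP[_ _]] /eqP e1] /andP[/andP[_ /andP[_ _]] /eqP e2] /ffunP e.
    have := e u; rewrite !ffunE eqxx /= => ->; congr pair; apply/ffunP => v.
    by have := e v; rewrite !ffunE; case: eqP => // ->; rewrite e1 e2.
  move=> [p u']; rewrite unfold_in /= => /andP[/andP[/andP[pp ul] /andP[ut uu']] _].
  by have [] := move_leafP pp ul ut uu'.
by move=> p; rewrite divr_ge0 // ltW // pw_gt0.
Qed.

Variables (qq M : R).
Hypothesis qq_gt0 : 0 < qq.
Hypothesis M_ge0 : 0 <= M.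
Hypothesis jumbled : forall A S, [disjoint A & S] ->
  qq / 2 * #|A|%:R * #|S|%:R - M <= \sum_(v in A) (nb S v)%:R.

(** A large [top] has many leaves by [sum_unhit], and pseudo-randomness joins them to [top] by many
    edges, each of which is a leaf move; [muE_leaf_moves] limits the moves. The coefficient [5 / 4]
    is one [M] from the edge count plus a quarter of [M] from the exceptional vertices in the leaf
    count. *)
Lemma muE_top (e K : R) : 0 < e -> 2 <= K -> (1 + e) / e <= K * qq / 4 ->
  muE (fun p => (K <= #|top p|%:R)%R%:R) *
    (K ^+ 2 * qq / 16 * expR (- ((1 + e) * n / K)) - 5 / 4 * M) <=
  expR b * \sum_(u in level D) (nb (level D.-1) u)%:R.
Proof.
move=> e0 K2 Ke; have K0 : 0 < K by lra.
have Kq : 0 < K * qq by rewrite mulr_gt0.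
pose big p : R := (K <= #|top p|%:R)%R%:R.
pose c0 := K * expR (- ((1 + e) * n / K)) - 4 * M / (K * qq).
have stepa p : big p * (K * qq / 16 * #|leaves p|%:R - M) <=
    \sum_(u in leaves p) (nb (top p) u)%:R.
  rewrite /big; have [KT|_] := boolP (K <= _); last by rewrite mul0r sumr_ge0.
  (* The edge bound requires disjoint sets: half of the leaves are played against the rest of [top],
     which has at least [(K - 1) / 2], hence [K / 4], elements since [K] is at least two. *)
  rewrite mul1r; have [A AL cA] := half_subset (leaves p).
  have AT : A \subset top p.
    by apply: (fintype.subset_trans AL); apply/fintype.subsetP => u; rewrite inE => /andP[].
  have dAS : [disjoint A & top p :\: A] by rewrite -setI_eq0; apply/eqP/setP => x; rewrite !inE; case: (x \in A).
  apply: (@le_trans _ _ (\sum_(u in A) (nb (top p :\: A)%SET u)%:R)); last first.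
    apply: (@le_trans _ _ (\sum_(u in A) (nb (top p) u)%:R)).
      apply: ler_sum => u _; rewrite ler_nat; apply: subset_leq_card.
      by apply/fintype.subsetP => v; rewrite !inE => /andP[/andP[_ ->]].
    rewrite [leLHS]big_mkcond [leRHS]big_mkcond; apply: ler_sum => u _ /=.
    by have [/(fintype.subsetP AL) ->//|_] := boolP (u \in A); case: ifP.
  apply: le_trans (jumbled dAS); rewrite lerD2r.
  have cS : (#|top p|%:R - 1) / 2 <= #|top p :\: A|%:R :> R.
    have := subset_leq_card AT; have := subset_leq_card AL.
    rewrite cardsD (finset.setIidPr AT) cA => l1 l2; rewrite natrB //.
    have : (2 * uphalf #|leaves p| <= #|top p| + 1)%N.
      have : (#|leaves p| <= #|top p|)%N.
        by apply: subset_leq_card; apply/fintype.subsetP => u; rewrite inE => /andP[].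
      clear; rewrite uphalf_half; have := odd_double_half #|leaves p|.
      by case: (odd _) => /=; rewrite -muln2; move: #|leaves p| #|top p| => x y; lia.
    by rewrite -(ler_nat R) natrD natrM; lra.
  have cL : #|leaves p|%:R / 2 <= #|A|%:R :> R.
    rewrite cA uphalf_half natrD; have := odd_double_half #|leaves p|.
    move=> /(congr1 (fun k => k%:R : R)); rewrite natrD -muln2 natrM.
    by case: (odd _) => /=; lra.
  apply: (@le_trans _ _ (qq / 2 * (#|leaves p|%:R / 2) * (K / 4))).
    by rewrite le_eqVlt; apply/orP; left; apply/eqP; field.
  rewrite -!mulrA ler_wpM2l ?(ltW qq_gt0) // ler_wpM2l ?invr_ge0 //.
  rewrite [leLHS]mulrA; apply: ler_pM.
        by rewrite divr_ge0.
      by rewrite divr_ge0 // ltW.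
    exact: cL.
  by apply: le_trans cS; lra.
have stepb : muE big * c0 <= muE (fun p => big p * #|leaves p|%:R).
  rewrite mulrC -muEZ /muE_def !sum_pfun_depth; apply: ler_sum => h dfh.
  set Ch := choices (fun v => h v : nat).
  pose S := [set u in level D | (h u : nat) == D]%SET.
  have H p : p \in box Ch -> p \in pfun /\ {in C, forall v, depth p v = h v}.
    by move=> /boxP; apply: (@choicesP V E r (fun v => h v) p (depth_fun_root dfh)).
  have topE p : p \in box Ch -> top p = S.
    move=> /H[pp pd]; apply/setP => u; rewrite [LHS]inE [RHS]inE.
    by have [|//] := boolP (u \in level D); rewrite inE => /andP[Cu _]; rewrite pd.
  have e1 p : p \in box Ch -> pw p / Z = expR (- (b * \sum_(v in C) (h v)%:R)) / Z.
    by move=> pb; rewrite (card_box_depth b dfh pb).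
  rewrite (eq_bigr (fun p => expR (- (b * \sum_(v in C) (h v)%:R)) / Z *
     (c0 * (K <= #|S|%:R)%R%:R))); last by move=> p pb; rewrite e1 // /big topE.
  rewrite [leRHS](eq_bigr (fun p => expR (- (b * \sum_(v in C) (h v)%:R)) / Z *
     ((K <= #|S|%:R)%R%:R * #|leaves p|%:R))); last by move=> p pb; rewrite e1 // /big topE.
  rewrite -!mulr_sumr ler_wpM2l //.
    by rewrite divr_ge0 ?expR_ge0 // ltW // partition_fun_gt0.
  have [KS|_] := boolP (K <= #|S|%:R); last by rewrite sumr_const mul0rn mulr0 mul0r.
  rewrite mul1r sumr_const [leLHS]mulrC.
  pose N := [set v | nr v && ((h v : nat) == D.+1)]%SET.
  (* The vertices of depth [D.+1] with too few possible parents in [S] violate [Ch_big].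
     Pseudo-randomness makes them few, and each of them spoils at most one leaf. *)
  pose B := [set v in N | ((nb S v)%:R < K * qq / 4)%R]%SET.
  have dBS : [disjoint B & S].
    rewrite -setI_eq0; apply/eqP/setP => x; rewrite !inE; apply/negP.
    move=> /andP[/andP[/andP[_ /eqP hx] _] /andP[_ /eqP hx']]; move: hx; rewrite hx' => /eqP.
    by rewrite -[X in X == _]addn0 -addn1 eqn_add2l.
  have cB : #|B|%:R <= 4 * M / (K * qq).
    rewrite ler_pdivlMr //.
    have := jumbled dBS => j1.
    have j2 : \sum_(v in B) (nb S v)%:R <= #|B|%:R * (K * qq / 4).
      rewrite mulr_natl -sumr_const; apply: ler_sum => v; rewrite inE => /andP[_]; exact: ltW.
    have j3 : qq / 2 * #|B|%:R * K <= qq / 2 * #|B|%:R * #|S|%:R.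
      by rewrite ler_wpM2l // mulr_ge0 // divr_ge0 // ltW.
    have : qq / 2 * #|B|%:R * K <= #|B|%:R * (K * qq / 4) + M by lra.
    by lra.
  apply: (@le_trans _ _ (\sum_(p in box Ch) (#|unhit S (N :\: B) p|%:R - #|B|%:R))).
    rewrite sumrB sumr_const -[#|B|%:R *+ _]mulr_natl /c0 mulrBr lerB //.
      apply: sum_unhit => // v; rewrite !inE => /andP[] /[swap] nv; rewrite nv /= -leNgt.
      move=> le; apply: (le_trans Ke); apply: (le_trans le); rewrite ler_nat.
      apply: subset_leq_card; apply/fintype.subsetP => u; rewrite inE => /andP[uS uv].
      case/andP: nv => nv /eqP hv; rewrite /Ch /choices_def nv inE uv hv.
      by move: uS; rewrite inE => /andP[_ /eqP ->] /=.
    by rewrite ler_wpM2l.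
  apply: ler_sum => p pb; rewrite lerBlDr -natrD ler_nat.
  have [pp pd] := H _ pb.
  apply: (@leq_trans #|(leaves p :|: (p @: B))%SET|).
    apply: subset_leq_card; apply/fintype.subsetP => u; rewrite inE => /andP[uS /forall_inP H1].
    have uT : u \in top p by rewrite topE.
    rewrite finset.in_setU inE uT /=.
    apply/orP; have [|] := boolP [forall v, nr v ==> (p v != u)]; first by left.
    rewrite negb_forall => /existsP[v]; rewrite negb_imply negbK => /andP[nv /eqP pv]; right.
    apply/imsetP; exists v => //; apply/negPn/negP => vB.
    have /H1 : v \in (N :\: B)%SET.
      rewrite finset.in_setD vB inE nv /= -pd ?(nonrootC nv) // (depth_step pp nv) pv.
      by have [_ _ ->] := topP uT.
    by rewrite pv eqxx.
  by apply: (leq_trans (leq_card_setU _ _)); rewrite leq_add2l leq_imset_card.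
have stepc : muE (fun p => big p * (K * qq / 16 * #|leaves p|%:R - M)) <=
    expR b * \sum_(u in level D) (nb (level D.-1) u)%:R.
  apply: (le_trans (muE_le b (fun p _ => stepa p))).
  rewrite -[leLHS]mul1r -[X in X * _](expRxMexpNx_1 b) -mulrA ler_wpM2l ?expR_ge0 //.
  exact: muE_leaf_moves.
apply: le_trans stepc.
have -> : muE (fun p => big p * (K * qq / 16 * #|leaves p|%:R - M)) =
   K * qq / 16 * muE (fun p => big p * #|leaves p|%:R) + (- M) * muE big.
  by rewrite -!muEZ -muED; apply: eq_bigr => p _; congr (_ * _); ring.
apply: (@le_trans _ _ (K * qq / 16 * (muE big * c0) + (- M) * muE big)).
  rewrite le_eqVlt; apply/orP; left; apply/eqP; rewrite /c0 -/big; field.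
  by rewrite !gt_eqF.
by rewrite lerD2r ler_wpM2l // divr_ge0 // ltW.
Qed.

(** ** Lower bounds on the Wasserstein distance *)

Lemma W1_ge_pfun (F G : {ffun V -> V} -> R) :
  (forall q p, q \in spt -> p \in pfun -> F q + G p <= (pdiff E r q p)%:R) ->
  \sum_(q in spt) #|spt|%:R^-1 * F q + muE G <=
  W1 (hamming E r) (gibbs_inf R E r) (gibbs b E r).
Proof.
move=> FG.
pose inv T := odflt [ffun v => v] [pick p | (p \in pfun) && (tree_of p == T)].
have invK p : p \in pfun -> inv (tree_of p) = p.
  move=> pp; rewrite /inv; case: pickP => [q /andP[qp /eqP e]|/(_ p)] /=.
    exact: (tree_of_inj qp pp e).
  by rewrite pp eqxx.
have -> : \sum_(q in spt) #|spt|%:R^-1 * F q = \sum_T gibbs_inf R E r T * F (inv T).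
  rewrite (@sum_gibbs_inf R V E r E_pairs (fun T => F (inv T))).
  by apply: eq_bigr => q qs; rewrite invK ?spt_pfun.
have -> : muE G = \sum_T gibbs b E r T * G (inv T).
  rewrite (@sum_gibbs R V E r b E_pairs (fun T => G (inv T))).
  by apply: eq_bigr => q qs; rewrite /= invK.
apply: W1_ge; rewrite ?gibbs_sum1 ?gibbs_inf_sum1 //.
    by move=> T; apply: gibbs_inf_ge0.
  by move=> T; apply: gibbs_ge0.
move=> T T' T0 T0'.
have /imsetP[q qs ->] : T \in [set tree_of q | q in spt]%SET.
  by move: T0; rewrite /gibbs_inf shortest_path_treesE //; case: ifP => //; rewrite ltxx.
have /imsetP[p pp ->] : T' \in [set tree_of q | q in pfun]%SET.
  by move: T0'; rewrite /gibbs spanning_treesE //; case: ifP => //; rewrite ltxx.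
have qp := spt_pfun qs; rewrite (invK _ qp) (invK _ pp) (hamming_tree qp pp).
exact: FG.
Qed.

(** A vertex of the level [D] that keeps its shortest path parent has a parent at distance [D - 1]:
    either this parent has the right depth and the vertex is in [top], or the vertex is a late
    child. The bound holds for every shortest path tree, so the dual function [F] is zero. *)
Lemma W1_high_level :
  muE (fun p => #|level D|%:R - #|top p|%:R - #|late_children D.-1 p|%:R) <=
  W1 (hamming E r) (gibbs_inf R E r) (gibbs b E r).
Proof.
rewrite -[leLHS]add0r.
have -> : 0 = \sum_(q in spt) #|spt|%:R^-1 * (0 : R).
  by rewrite big1 // => q _; rewrite mulr0.
apply: W1_ge_pfun => q p qs pp; rewrite add0r.
rewrite !lerBlDr -!natrD ler_nat.
apply: (@leq_trans #|([set v | nr v && (q v != p v)] :|: late_children D.-1 p :|: top p)%SET|).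
  apply: subset_leq_card; apply/fintype.subsetP => v vL.
  have nv := level_nonroot vL; have Cv := nonrootC nv.
  have dv : d v = D by move: vL; rewrite inE => /andP[_ /eqP].
  rewrite !finset.in_setU -orbA; have [e|ne] := eqVneq (q v) (p v); last by rewrite inE nv ne.
  have := boxP _ _ qs v; rewrite /choices_def nv inE e dv => /andP[_ /eqP dpv].
  rewrite inE e eqxx andbF /= inE Cv dv dpv /= ltnSn leqnn /=.
  rewrite inE vL /= -[X in _ || (_ == X)]dv.
  have := gdist_le_depth pp Cv; have := gdist_le_depth pp (pfun_comp pp Cv).
  rewrite (depth_step pp nv) dv dpv leq_eqVlt => /orP[/eqP <-|->//] _.
  by rewrite eqxx orbT.
apply: (leq_trans (leq_card_setU _ _)); rewrite leq_add2r.
exact: leq_card_setU.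
Qed.

Definition children q u : R := \sum_(v | nr v) (q v == u)%:R.

(** For each [u] the number of children is a sum of independent indicators with mean [wt u], so its
    variance is at most [wt u], and the weights add up to at most [n]. *)
Lemma children_variance :
  \sum_(q in spt) #|spt|%:R^-1 * \sum_(u in level D) (children q u - wt u) ^+ 2 <= n.
Proof.
pose ww v x : R := (x \in choices d v)%:R / #|choices d v|%:R.
have c0 v : 0 < #|choices d v|%:R :> R by apply: card_choices_gt0.
have ww0 v x : 0 <= ww v x by rewrite divr_ge0.
have ww1 v : \sum_x ww v x = 1.
  rewrite -mulr_suml -natr_sum -[RHS](divff (lt0r_neq0 (c0 v))); congr (_%:R / _).
  by rewrite -sum1_card [RHS]big_mkcond; apply: eq_bigr => x _; case: (_ \in _).
have E1 F : \sum_(q in spt) #|spt|%:R^-1 * F q = pE ww F.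
  rewrite /pE big_mkcond; apply: eq_bigr => q _; rewrite /pweight big_split /=.
  rewrite prodfV -[X in _ * X^-1 * _]natr_prod -card_spt.
  have [qs|] := boolP (q \in spt).
    by rewrite big1 ?mul1r // => v _; rewrite (boxP _ _ qs v).
  rewrite inE negb_forall => /existsP[v /negbTE qv].
  by rewrite (bigD1 v) //= qv !mul0r.
rewrite E1 pE_sum; apply: (@le_trans _ _ (\sum_(u in level D) wt u)); last first.
  rewrite sum_wt; apply: le_trans (card_nonroot_le R E r); apply: ler_sum => v nv.
  by rewrite ler_pdivrMr // mul1r ler_nat subset_leq_card // finset.subsetIl.
apply: ler_sum => u _.
have wE : wt u = \sum_(v | nr v) (u \in choices d v)%:R / #|choices d v|%:R.
  rewrite /wt_def big_mkcondr /=; apply: eq_bigr => v _; case: ifP; rewrite ?mul1r ?mul0r //.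
have co v : pE ww (fun q => (q v == u)%:R) = (u \in choices d v)%:R / #|choices d v|%:R.
  rewrite (pE_coord ww1 v (fun x => (x == u)%:R)) (bigD1 u) //= eqxx mulr1.
  by rewrite big1 ?addr0 // => x /negbTE ->; rewrite mulr0.
rewrite wE /children; apply: pE_variance => // [v q _|i j _ _ ij].
  by case: (q v == u); rewrite ?expr1n ?expr0n.
rewrite (pE_indep ww1 (P := pred1 i)) ?co //.
  by move=> f g fg; rewrite fg ?inE.
by move=> f g fg; rewrite fg // inE /= eq_sym.
Qed.

(** A vertex of the level [D.+1] that keeps its parent is deep or has its shortest path parent in
    [top]. The latter number mixes both trees; the bound [X <= wt + tau / 2 + (X - wt) ^ 2 / (2
    tau)] for each number of children [X], with the squares summed over the whole level, separates
    it into a function of [p] and a function of [q], as duality requires. *)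
Lemma W1_high_next (K W tau : R) : 0 < tau -> 0 <= K ->
  (forall S, S \subset level D -> #|S|%:R <= K -> \sum_(u in S) wt u <= W) -> 0 <= W ->
  muE (fun p => #|level D.+1|%:R - W - tau * K / 2 - #|deep p|%:R
                - n * (K < #|top p|%:R)%R%:R) - n / (2 * tau) <=
  W1 (hamming E r) (gibbs_inf R E r) (gibbs b E r).
Proof.
move=> tau0 K0 WS W0.
pose Qf q : R := \sum_(u in level D) (children q u - wt u) ^+ 2.
pose F q : R := - (Qf q / (2 * tau)).
have t2 : 0 < 2 * tau by lra.
have Qf0 q : 0 <= Qf q by apply: sumr_ge0 => u _; apply: sqr_ge0.
set G := (X in muE X).
have FG q p : q \in spt -> p \in pfun -> F q + G p <= (pdiff E r q p)%:R.
  move=> qs pp; have Fq : F q <= 0 by rewrite oppr_le0 divr_ge0 // ltW.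
  have tK : 0 <= tau * K / 2 by rewrite !mulr_ge0 // ltW.
  rewrite /G; have [lt|le] := ltP K #|top p|%:R.
    have : #|level D.+1|%:R <= n by rewrite ler_nat max_card.
    have : 0 <= (pdiff E r q p)%:R :> R by [].
    have : 0 <= #|deep p|%:R :> R by [].
    by rewrite mulr1 => h1 h2 h3; lra.
  have qP v : nr v -> adj E (q v) v /\ d v = (d (q v)).+1.
    move=> nv; have := boxP _ _ qs v; rewrite /choices_def nv inE => /andP[-> /eqP].
    by [].
  pose H := [set v in level D.+1 | q v \in top p]%SET.
  have cH : #|H|%:R <= \sum_(u in top p) children q u.
    rewrite /children exchange_big /= -sum1_card natr_sum big_mkcond [leRHS]big_mkcond /=.
    apply: ler_sum => v _; have [vH|_] := boolP (v \in H); last first.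
      by case: ifP => // _; apply: sumr_ge0.
    move: vH; rewrite inE => /andP[]; rewrite inE => /andP[Cv /eqP dv] qT.
    have nv : nr v by rewrite /nonroot Cv; apply: contra_eqN dv => /eqP ->; rewrite gdist_root.
    by rewrite nv (bigD1 (q v)) //= eqxx lerDl sumr_ge0.
  have topL : top p \subset level D by apply/fintype.subsetP => u; rewrite inE => /andP[].
  have bH : #|H|%:R <= W + tau * K / 2 + Qf q / (2 * tau).
    apply: (le_trans cH).
    apply: (@le_trans _ _ (\sum_(u in top p) (wt u + (tau / 2 + (children q u - wt u) ^+ 2 / (2 * tau))))).
      apply: ler_sum => u _; rewrite -lerBlDl.
      set x := children q u - wt u.
      have -> : tau / 2 + x ^+ 2 / (2 * tau) = x + (tau - x) ^+ 2 / (2 * tau) by field; lra.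
      by rewrite lerDl divr_ge0 ?sqr_ge0 // ltW.
    rewrite big_split /= big_split /= -addrA; apply: lerD; first exact: WS.
    apply: lerD.
      rewrite sumr_const -[leLHS]mulr_natr [leRHS](_ : _ = tau / 2 * K); last by ring.
      by rewrite ler_wpM2l // divr_ge0 // ltW.
    rewrite -mulr_suml ler_wpM2r ?invr_ge0 ?(ltW t2) // /Qf.
    rewrite [leLHS]big_mkcond [leRHS]big_mkcond; apply: ler_sum => u _ /=.
    have [/(fintype.subsetP topL) ->//|_] := boolP (u \in top p).
    by case: ifP => // _; apply: sqr_ge0.
  have cL : #|level D.+1|%:R <= (pdiff E r q p)%:R + #|H|%:R + #|deep p|%:R :> R.
    rewrite -!natrD ler_nat.
    apply: (@leq_trans #|([set v | nr v && (q v != p v)] :|: H :|: deep p)%SET|).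
      apply: subset_leq_card; apply/fintype.subsetP => v vL.
      have [Cv dv] : v \in C /\ d v = D.+1 by move: vL; rewrite inE => /andP[? /eqP].
      have nv : nr v by rewrite /nonroot Cv; apply: contra_eqN dv => /eqP ->; rewrite gdist_root.
      rewrite !finset.in_setU -orbA; have [e|ne] := eqVneq (q v) (p v); last by rewrite inE nv ne.
      have [qa] := qP _ nv; rewrite dv => -[dq].
      rewrite inE e eqxx andbF /= inE vL /= [X in _ || X]inE vL /=.
      rewrite (depth_step pp nv) ltnS -e in dq *; rewrite inE inE.
      rewrite (component_adj Cv) 1?adj_sym //= -dq eqxx /= dq.
      have Cq : q v \in C by rewrite (component_adj Cv) // adj_sym.
      by have := gdist_le_depth pp Cq; rewrite -dq leq_eqVlt eq_sym => /orP[->|->]; rewrite ?orbT.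
    apply: (leq_trans (leq_card_setU _ _)); rewrite leq_add2r.
    exact: leq_card_setU.
  by rewrite mulr0 subr0 /F; lra.
apply: le_trans (W1_ge_pfun FG); rewrite addrC lerD2r.
have -> : \sum_(q in spt) #|spt|%:R^-1 * F q =
    - ((\sum_(q in spt) #|spt|%:R^-1 * Qf q) / (2 * tau)).
  rewrite mulr_suml -sumrN; apply: eq_bigr => q _; rewrite /F; ring.
by rewrite lerN2 ler_wpM2r ?invr_ge0 ?(ltW t2) // children_variance.
Qed.

End LevelD.
End HighTemperature.

(** * Consequences of pseudo-randomness *)

Section PseudoRandom.
Variables (R : realType) (V : finType) (E : {set {set V}}) (r : V).
Variables (a q e l : R).
Local Notation n := (#|V|%:R : R).
Local Notation C := (component E r).
Local Notation d := (gdist E r).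
Local Notation nr := (nonroot E r).
Local Notation choices := (choices E r).
Local Notation deg := (deg E).
Local Notation nb := (nb E).
Local Notation wt := (wt R E r).
Local Notation level := (level E r).
Local Notation ball := (ball E r).
Hypothesis a_gt0 : 0 < a.
Hypothesis aE : a = n * q.
Hypothesis e_gt0 : 0 < e.
Hypothesis e_le : e <= 4^-1.
Hypothesis l_gt0 : 0 < l.
Implicit Types (A S X Y Z : {set V}).

(** Lower bounds on edge counts suffice, as upper bounds come from the degrees. The additive error
    of order [n] is the price of holding for all pairs of sets at once. *)
Definition jumbled_graph := forall A S, [disjoint A & S] ->
  (1 - e) * q * #|A|%:R * #|S|%:R - 3 / e * n <= \sum_(v in A) (nb S v)%:R.

Definition concentrated_degrees := \sum_v ((deg v)%:R - a) ^+ 2 <= n * a * l.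

Hypothesis jumbled : jumbled_graph.
Hypothesis degrees : concentrated_degrees.
Local Notation M := (3 / e * n).

Let n_gt0 : 0 < n.
Proof. by rewrite ltr0n; apply/card_gt0P; exists r. Qed.

Let q_gt0 : 0 < q.
Proof. by move: a_gt0; rewrite aE pmulr_rgt0 // n_gt0. Qed.

Let M_ge0 : 0 <= M.
Proof. by rewrite mulr_ge0 // divr_ge0 // ltW. Qed.

Lemma jumbled_half A S : [disjoint A & S] ->
  q / 2 * #|A|%:R * #|S|%:R - M <= \sum_(v in A) (nb S v)%:R.
Proof.
move=> dAS; apply: le_trans (jumbled dAS); rewrite lerD2r -!mulrA mulrCA.
by rewrite ler_wpM2r ?mulr_ge0 ?(ltW q_gt0) //; move: e_le e_gt0; lra.
Qed.

(** Each degree exceeds [a] by at most [tau / 2 + (deg - a) ^ 2 / (2 tau)]; the choice of [tau]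
    balances the size of [S] against the total variance. *)
Lemma sum_deg_le S (tau : R) : 0 < tau ->
  \sum_(v in S) (deg v)%:R <= #|S|%:R * (a + tau / 2) + n * a * l / (2 * tau).
Proof.
move=> t0; have t2 : 0 < 2 * tau by lra.
apply: (@le_trans _ _ (\sum_(v in S) (a + tau / 2 + ((deg v)%:R - a) ^+ 2 / (2 * tau)))).
  apply: ler_sum => v _; set x := (deg v)%:R.
  have -> : a + tau / 2 + (x - a) ^+ 2 / (2 * tau) = x + (tau - (x - a)) ^+ 2 / (2 * tau).
    by field; lra.
  by rewrite lerDl divr_ge0 ?sqr_ge0 // ltW.
rewrite big_split /= sumr_const -[(a + tau / 2) *+ _]mulr_natl lerD2l -mulr_suml ler_wpM2r ?invr_ge0 ?(ltW t2) //.
apply: le_trans degrees; rewrite [leLHS]big_mkcond; apply: ler_sum => v _.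
by case: ifP => // _; apply: sqr_ge0.
Qed.

Lemma sum_nb_le A S : \sum_(v in A) (nb S v)%:R <= \sum_(u in S) (deg u)%:R :> R.
Proof.
rewrite -!natr_sum ler_nat sum_nb; apply: leq_sum => u _; exact: nb_le_deg.
Qed.

(** The edges between [Z] and [X] are at most [1 - 2 e] times their expected number, while
    pseudo-randomness guarantees [1 - e] up to [M]; the gap [e] bounds [Z]. *)
Lemma few_poor X Z : (0 < #|X|)%N -> [disjoint Z & X] ->
  (forall z, z \in Z -> (nb X z)%:R <= (1 - 2 * e) * (#|X|%:R * q)) ->
  #|Z|%:R <= M / e / (#|X|%:R * q).
Proof.
move=> X0 dZX Zp; have j := jumbled dZX.
have Xq : 0 < #|X|%:R * q by rewrite mulr_gt0 ?ltr0n // q_gt0.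
rewrite ler_pdivlMr // ler_pdivlMr //.
have : \sum_(v in Z) (nb X v)%:R <= #|Z|%:R * ((1 - 2 * e) * (#|X|%:R * q)).
  by rewrite mulr_natl -sumr_const; apply: ler_sum.
by lra.
Qed.

Lemma ballC_disjoint k (P : pred V) :
  [disjoint [set v | (v \notin ball k) && P v]%SET & level k].
Proof.
rewrite -setI_eq0; apply/eqP/setP => v; rewrite finset.in_setI finset.in_set0; apply/negP.
by rewrite !inE => /andP[/andP[+ _] /andP[Cv /eqP dv]]; rewrite Cv dv leqnn.
Qed.

Lemma adj_level k x y : x \in level k -> y \notin ball k -> adj E x y ->
  [/\ nr y, d y = k.+1 & choices d y = [set u in level k | adj E u y]%SET].
Proof.
move=> xL yB xy; have [Cx dx] : x \in C /\ d x = k by move: xL; rewrite inE => /andP[? /eqP].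
have Cy := component_adj Cx xy.
have dy : d y = k.+1.
  apply/eqP; rewrite eqn_leq -{1}dx gdist_adj //=.
  by move: yB; rewrite inE Cy /= -ltnNge.
have ny : nr y by rewrite /nonroot Cy; apply: contra_eqN dy => /eqP ->; rewrite gdist_root.
split => //; rewrite /choices_def ny dy; apply/setP => u; rewrite inE [RHS]inE.
have [uy|] := boolP (adj E u y); last by rewrite andbF.
by rewrite andbT inE (component_adj Cy) 1?adj_sym //= eqSS eq_sym.
Qed.

(** Few vertices outside the ball have less than half the expected number of neighbours in the level
    [k], and they contribute at most one each. For the others, these neighbours are exactly the
    choices. Vertices beyond distance [k + 1] have no such neighbour and belong to the
    exceptions. *)
Lemma inv_choices_tail k : (0 < #|level k|)%N ->
  \sum_(v | nr v && (k < d v)%N) #|choices d v|%:R^-1 <=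
  (M / e + 2 * n) / (#|level k|%:R * q).
Proof.
move=> X0; set X := level k; have q0 := q_gt0.
have Xq : 0 < #|X|%:R * q by rewrite mulr_gt0 // ltr0n.
pose P v : bool := (nb X v)%:R <= (1 - 2 * e) * (#|X|%:R * q).
pose Z := [set v | (v \notin ball k) && P v]%SET.
have cZ : #|Z|%:R <= M / e / (#|X|%:R * q).
  by apply: few_poor X0 (ballC_disjoint k P) _ => z; rewrite inE => /andP[_].
rewrite (bigID P) /= mulrDl; apply: lerD.
  apply: le_trans cZ; rewrite -sum1_card natr_sum [leRHS]big_mkcond [leLHS]big_mkcond /=.
  apply: ler_sum => v _; case: ifP => [/andP[/andP[nv kv] Pv]|_]; last by case: ifP.
  have -> : v \in Z by rewrite inE Pv andbT inE (nonrootC nv) /= -ltnNge.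
  by rewrite invf_le1 ?ltr0n ?ler1n choices_gdist_neq0.
apply: (@le_trans _ _ (\sum_(v : V) 2 / (#|X|%:R * q))); last first.
  by rewrite sumr_const -[leLHS]mulr_natr mulrAC.
rewrite [leLHS]big_mkcond; apply: ler_sum => v _; case: ifP => [|_]; last first.
  by rewrite divr_ge0 // ltW.
move=> /andP[/andP[nv kv]]; rewrite /P -ltNge => big.
have vB : v \notin ball k by rewrite inE (nonrootC nv) /= -ltnNge.
have [x /andP[xX xv]] : exists x, (x \in X) && adj E x v.
  have : (0 < nb X v)%N.
    rewrite -(ltr_nat R); apply: le_lt_trans big; rewrite mulr_ge0 ?(ltW Xq) //.
    by move: e_le; lra.
  by move/card_gt0P => [x]; rewrite inE; exists x.
have [_ _ ->] := adj_level xX vB xv.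
rewrite -[leRHS]invrK lef_pV2 ?posrE ?invr_gt0 ?divr_gt0 //; last first.
  by rewrite ltr0n; apply/card_gt0P; exists x; rewrite inE xX.
rewrite invf_div; apply: le_trans (ltW big).
by rewrite mulrC ler_wpM2r ?(ltW Xq) //; move: e_le; lra.
Qed.

Definition moderate k (t : R) : {set V} :=
  [set y | (y \notin ball k) && ((nb (level k) y)%:R <= t)]%SET.

(** A neighbour outside the ball with at most [t] neighbours in the level picks [x] as its parent
    with probability at least [1 / t]. *)
Lemma wt_ge k t x : 0 < t -> x \in level k ->
  (nb (moderate k t) x)%:R / t <= wt x.
Proof.
move=> t0 xL; rewrite /nb -sum1_card natr_sum mulr_suml /wt_def.
rewrite [leLHS]big_mkcond [leRHS]big_mkcond; apply: ler_sum => y _ /=.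
have [|_] := boolP (y \in _); last by case: ifP => // _; rewrite invr_ge0.
rewrite inE => /andP[]; rewrite inE => /andP[yB yt] yx.
have xy : adj E x y by rewrite adj_sym.
have [ny _ ch] := adj_level xL yB xy.
rewrite ny ch inE xL xy mul1r lef_pV2 ?posrE //.
by rewrite ltr0n; apply/card_gt0P; exists x; rewrite inE xL.
Qed.

Lemma sum_expR_wt k t (c : R) : 0 < t -> 0 <= c -> (0 < #|moderate k t|)%N ->
  \sum_(x in level k) expR (- (c * wt x)) <=
  #|level k|%:R * expR (- (c * ((1 - 2 * e) * (#|moderate k t|%:R * q) / t)))
  + M / e / (#|moderate k t|%:R * q).
Proof.
move=> t0 c0 Y0; set Y := moderate k t; have q0 := q_gt0.
have Yq : 0 < #|Y|%:R * q by rewrite mulr_gt0 // ltr0n.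
pose P x : bool := (nb Y x)%:R <= (1 - 2 * e) * (#|Y|%:R * q).
pose Z := [set x in level k | P x]%SET.
have dZY : [disjoint Z & Y].
  rewrite fintype.disjoint_sym; apply: fintype.disjointWr (ballC_disjoint k _).
  by apply/fintype.subsetP => x; rewrite inE => /andP[].
have cZ : #|Z|%:R <= M / e / (#|Y|%:R * q).
  by apply: few_poor => // z; rewrite inE => /andP[_].
rewrite (bigID P) /= addrC; apply: lerD.
  rewrite mulr_natl -sumr_const [leRHS]big_mkcond [leLHS]big_mkcond /=.
  apply: ler_sum => x _; case: (boolP (x \in level k)) => //= xL.
  case: ifP => [|_]; last exact: expR_ge0.
  rewrite /P -ltNge => big; rewrite ler_expR lerN2 ler_wpM2l //.
  apply: le_trans (wt_ge t0 xL); rewrite ler_wpM2r ?invr_ge0 ?(ltW t0) //.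
  exact: ltW.
apply: le_trans cZ; rewrite -sum1_card natr_sum [leRHS]big_mkcond [leLHS]big_mkcond /=.
apply: ler_sum => x _; have -> : (x \in Z) = (x \in level k) && P x by rewrite inE.
case: ifP => // _.
by rewrite -expR0 ler_expR oppr_le0 mulr_ge0 // wt_ge0.
Qed.

Lemma card_ballC k (P : pred V) :
  n = #|ball k|%:R + (#|[set v | (v \notin ball k) && P v]%SET|%:R +
      #|[set v | (v \notin ball k) && ~~ P v]%SET|%:R) :> R.
Proof.
rewrite -!natrD; congr _%:R; rewrite -(cardsC (ball k)); congr addn.
rewrite -(cardsID [set v | P v]%SET (~: ball k)); congr addn.
  by apply: eq_card => v; rewrite !inE.
by apply: eq_card => v; rewrite !inE andbC.
Qed.

(** Markov's inequality for the number of neighbours in the level: its sum is at most [n t / 4] for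
    this [t], so at most a quarter of the vertices exceed [t], and the ball takes at most another
    quarter. *)
Lemma moderate_crude k : #|ball k|%:R <= n / 4 ->
  n / 2 <= #|moderate k (8 * (#|level k|%:R * q) + 4 * l)|%:R.
Proof.
move=> bk; set m := #|level k|%:R * q; set t := 8 * m + 4 * l.
have q0 := q_gt0; have m0 : 0 <= m by rewrite mulr_ge0 // ltW.
have t0 : 0 < t by rewrite /t; move: l_gt0; lra.
pose P y : bool := (nb (level k) y)%:R <= t.
set Y := [set v | (v \notin ball k) && ~~ P v]%SET.
have cY : t * #|Y|%:R <= n * (3 / 2 * m + l / 2).
  apply: (@le_trans _ _ (\sum_(v in Y) (nb (level k) v)%:R)).
    rewrite mulr_natr -sumr_const; apply: ler_sum => v.
    by rewrite inE /P -ltNge => /andP[_ /ltW].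
  apply: (le_trans (sum_nb_le _ _)); apply: (le_trans (sum_deg_le _ a_gt0)).
  rewrite le_eqVlt; apply/orP; left; apply/eqP.
  rewrite /m; have -> : q = a / n by rewrite aE mulrC mulKf // gt_eqF // n_gt0.
  by field; rewrite !gt_eqF // n_gt0.
have : n * (3 / 2 * m + l / 2) <= n * (t / 4).
  by rewrite ler_wpM2l // /t; move: l_gt0; lra.
move=> h; have {h} h := le_trans cY h.
have {h} : #|Y|%:R <= n / 4.
  by rewrite -(ler_pM2l t0); apply: (le_trans h); rewrite le_eqVlt; apply/orP; left; apply/eqP; ring.
by have := card_ballC k P; rewrite -/Y /moderate -/P; lra.
Qed.

(** The total number of edges leaving the level is close to its mean, and the vertices that are not
    above [(1 + f) m] receive nearly [m] each by pseudo-randomness. So the excess [f m] of the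
    others adds up to at most [4 e m n], which is at most [f ^ 2 m n]. *)
Lemma moderate_sharp k (f : R) : 0 < f -> (0 < #|level k|)%N ->
  4 * e <= f ^+ 2 -> #|ball k|%:R <= e * n -> (l / 2 + 3) / e / (#|level k|%:R * q) <= e ->
  (1 - e - f) * n <= #|moderate k ((1 + f) * (#|level k|%:R * q))|%:R.
Proof.
move=> f0 X0 ef bk small; set m := #|level k|%:R * q in small *.
have q0 := q_gt0; have n0 := n_gt0.
have m0 : 0 < m by rewrite mulr_gt0 // ltr0n.
pose P y : bool := (nb (level k) y)%:R <= (1 + f) * m.
set Y := [set v | (v \notin ball k) && P v]%SET.
set Y2 := [set v | (v \notin ball k) && ~~ P v]%SET.
have cE := card_ballC k P; rewrite -/Y -/Y2 in cE.
have c1 : (1 - e) * m * #|Y|%:R - M <= \sum_(v in Y) (nb (level k) v)%:R.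
  by have := jumbled (ballC_disjoint k P); rewrite -/Y /m; lra.
have c2 : (1 + f) * m * #|Y2|%:R <= \sum_(v in Y2) (nb (level k) v)%:R.
  rewrite mulr_natr -sumr_const; apply: ler_sum => v.
  by rewrite inE /P -ltNge => /andP[_ /ltW].
have c3 : \sum_(v in Y) (nb (level k) v)%:R + \sum_(v in Y2) (nb (level k) v)%:R <=
    n * m * (1 + e / 2) + n * l / (2 * e).
  have dY : [disjoint Y & Y2].
    by rewrite -setI_eq0; apply/eqP/setP => v; rewrite !inE; case: (P v); rewrite !(andbF, andbT).
  rewrite -bigU //= (eq_bigl (mem (Y :|: Y2)%SET)) => [|v]; last by rewrite !inE.
  apply: (le_trans (sum_nb_le _ _)); apply: (le_trans (sum_deg_le _ (mulr_gt0 e_gt0 a_gt0))).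
  rewrite le_eqVlt; apply/orP; left; apply/eqP.
  rewrite /m; have -> : q = a / n by rewrite aE mulrC mulKf // gt_eqF.
  by field; rewrite !gt_eqF.
have c4 : (l / 2 + 3) / e * n <= e * m * n.
  by rewrite ler_wpM2r //; move: small; rewrite ler_pdivrMr.
have c5 : f * m * #|Y2|%:R <= f * m * (f * n).
  have e1 : (1 - e) * m * #|Y|%:R = (1 - e) * m * (n - #|ball k|%:R - #|Y2|%:R) by rewrite cE; ring.
  have e2 : n * l / (2 * e) + M = (l / 2 + 3) / e * n by field; rewrite gt_eqF.
  have e3 : m * #|ball k|%:R <= m * (e * n) by rewrite ler_wpM2l // ltW.
  have e4 : e * m * #|Y2|%:R >= 0 by rewrite !mulr_ge0 // ltW.
  have e5 : e * m * #|ball k|%:R >= 0 by rewrite !mulr_ge0 // ltW.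
  have e6 : m * n * (4 * e) <= m * n * (f ^+ 2) by rewrite ler_wpM2l // mulr_ge0 // ltW.
  have e7 : 0 <= e * m * n by rewrite !mulr_ge0 // ltW.
  move: c1 c2 c3 c4; rewrite e1; set y2 := #|Y2|%:R; set bb := #|ball k|%:R.
  move=> c1 c2 c3 c4; rewrite expr2 in e6; lra.
have fm : 0 < f * m by rewrite mulr_gt0.
by move: c5; rewrite ler_pM2l // /moderate -/P -/Y; lra.
Qed.

Lemma sum_nb_level k : \sum_(u in level k.+1) (nb (level k) u)%:R <=
  n * (3 / 2 * (#|level k|%:R * q) + l / 2).
Proof.
apply: (le_trans (sum_nb_le _ _)); apply: (le_trans (sum_deg_le _ a_gt0)).
rewrite le_eqVlt; apply/orP; left; apply/eqP.
have -> : q = a / n by rewrite aE mulrC mulKf // gt_eqF // n_gt0.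
by field; rewrite !gt_eqF // n_gt0.
Qed.

(** From [deg / a <= exp (deg / a - 1)]: irregular degrees cost only a factor exponential in [n],
    negligible against energies of order [l n]. *)
Lemma prod_max_deg A : expR 1 <= a -> l <= a ->
  \prod_(v in A) (Num.max 1 (deg v)%:R) <= a ^+ #|A| * expR (2 * n).
Proof.
move=> ea la.
apply: (@le_trans _ _ (\prod_(v in A) (a * expR ((deg v)%:R / a - 1)))).
  apply: ler_prod => v _; rewrite le_max ler01 /= ge_max; apply/andP; split.
    rewrite expRD expRN mulrCA; apply: (@le_trans _ _ (expR ((deg v)%:R / a) * 1)).
      by rewrite mulr1 -[leLHS]expR0 ler_expR divr_ge0 // ltW.
    by rewrite ler_wpM2l ?expR_ge0 // ler_pdivlMr ?expR_gt0 // mul1r.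
  rewrite -ler_pdivrMl // mulrC; apply: le_trans (expR_ge1Dx _).
  by rewrite addrC subrK.
rewrite big_split /= prodr_const ler_wpM2l ?exprn_ge0 ?(ltW a_gt0) //.
rewrite -expR_sum ler_expR sumrB -mulr_suml lerBlDr.
apply: (@le_trans _ _ ((\sum_(v in A) (deg v)%:R) / a)) => //.
rewrite ler_pdivrMr //; apply: (le_trans (sum_deg_le _ a_gt0)).
have -> : n * a * l / (2 * a) = n * l / 2 by field; rewrite gt_eqF.
have : n * l <= n * a by rewrite ler_wpM2l.
have : #|A|%:R * a <= n * a by rewrite ler_wpM2r ?(ltW a_gt0) // ler_nat max_card.
have : 0 <= (\sum_(v in A) (1 : R)) * a by rewrite mulr_ge0 ?sumr_ge0 // ltW.
by rewrite mulrDl; lra.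
Qed.

(** An ordinary vertex has nearly [#|level k| q] choices, so the weight of [S] is about the number
    of edges leaving [S], at most about [K a], over that number. Exceptional vertices count at most
    one each. *)
Lemma sum_wt_le k S (K : R) : (0 < #|level k|)%N -> S \subset level k -> #|S|%:R <= K ->
  \sum_(u in S) wt u <=
  ((K * a * (1 + e / 2) + n * l / (2 * e)) / (1 - 2 * e) + M / e) / (#|level k|%:R * q).
Proof.
move=> X0 SX SK; set X := level k; have q0 := q_gt0; have n0 := n_gt0.
have Xq : 0 < #|X|%:R * q by rewrite mulr_gt0 // ltr0n.
have e12 : 0 < 1 - 2 * e by move: e_le; lra.
pose P v : bool := (nb X v)%:R <= (1 - 2 * e) * (#|X|%:R * q).
pose Z := [set v | (v \notin ball k) && P v]%SET.
have cZ : #|Z|%:R <= M / e / (#|X|%:R * q).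
  by apply: few_poor X0 (ballC_disjoint k P) _ => z; rewrite inE => /andP[_].
have SL u : u \in S -> u \in C /\ d u = k.
  by move=> /(fintype.subsetP SX); rewrite inE => /andP[? /eqP].
have next v u : nr v -> u \in S -> u \in choices d v ->
    [/\ v \notin ball k, adj E u v & choices d v = [set w in X | adj E w v]%SET].
  move=> nv uS; rewrite {1}/choices_def nv inE => /andP[uv /eqP dv].
  have vB : v \notin ball k by rewrite inE (nonrootC nv) dv (SL _ uS).2 /= ltnn.
  by have [_ _ ch] := adj_level (fintype.subsetP SX _ uS) vB uv.
rewrite sum_wt (bigID P) /= addrC mulrDl; apply: lerD; last first.
  apply: le_trans cZ; rewrite -sum1_card natr_sum [leRHS]big_mkcond [leLHS]big_mkcond /=.
  apply: ler_sum => v _; case: ifP => [/andP[nv Pv]|_]; last by case: ifP.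
  have [e0|[u]] := set_0Vmem (choices d v :&: S)%SET; first by rewrite e0 cards0 mul0r; case: ifP.
  rewrite finset.in_setI => /andP[uc uS]; have [vB _ _] := next _ _ nv uS uc.
  rewrite [v \in Z]inE vB Pv /= ler_pdivrMr ?ltr0n ?choices_gdist_neq0 // mul1r ler_nat.
  by rewrite subset_leq_card // finset.subsetIl.
apply: (@le_trans _ _ (\sum_(v : V) (nb S v)%:R / ((1 - 2 * e) * (#|X|%:R * q)))).
  rewrite [leLHS]big_mkcond; apply: ler_sum => v _ /=.
  have r0 : 0 <= (nb S v)%:R / ((1 - 2 * e) * (#|X|%:R * q)) by rewrite divr_ge0 // mulr_ge0 ?ltW.
  case: ifP => // /andP[nv]; rewrite /P -ltNge => big.
  have [e0|[u]] := set_0Vmem (choices d v :&: S)%SET; first by rewrite e0 cards0 mul0r.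
  rewrite finset.in_setI => /andP[uc uS]; have [vB uv ch] := next _ _ nv uS uc.
  apply: ler_pM => //; rewrite ?invr_ge0 //.
    rewrite ler_nat subset_leq_card //; apply/fintype.subsetP => w.
    by rewrite ch !inE => /andP[/andP[_ ->] ->].
  rewrite ch lef_pV2 ?posrE ?(mulr_gt0 e12 Xq) //; first exact: ltW.
  exact: lt_trans (mulr_gt0 e12 Xq) big.
rewrite -mulr_suml invfM mulrA ler_wpM2r ?invr_ge0 ?(ltW Xq) // ler_wpM2r ?invr_ge0 ?(ltW e12) //.
apply: (@le_trans _ _ (\sum_(v in [set: V]%SET) (nb S v)%:R)).
  by rewrite [leRHS]big_mkcond; apply: ler_sum => v _; rewrite finset.in_setT.
apply: (le_trans (sum_nb_le _ _)); apply: (le_trans (sum_deg_le _ (mulr_gt0 e_gt0 a_gt0))).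
have -> : n * a * l / (2 * (e * a)) = n * l / (2 * e) by field; rewrite !gt_eqF.
rewrite lerD2r [leRHS](_ : _ = K * (a + e * a / 2)); last by ring.
by rewrite ler_wpM2r // addr_ge0 ?divr_ge0 ?mulr_ge0 ?ltW.
Qed.

Lemma card_next_level k : (0 < #|level k|)%N ->
  n - #|ball k|%:R - M / e / (#|level k|%:R * q) <= #|level k.+1|%:R.
Proof.
move=> X0; have q0 := q_gt0.
have Xq : 0 < #|level k|%:R * q by rewrite mulr_gt0 // ltr0n.
have e12 : 0 < 1 - 2 * e by move: e_le; lra.
pose P v : bool := nb (level k) v == 0%N.
have cZ : #|[set v | (v \notin ball k) && P v]%SET|%:R <= M / e / (#|level k|%:R * q).
  apply: few_poor X0 (ballC_disjoint k P) _ => z; rewrite inE => /andP[_ /eqP ->].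
  by rewrite mulr_ge0 // ltW.
have cY : #|[set v | (v \notin ball k) && ~~ P v]%SET|%:R <= #|level k.+1|%:R :> R.
  rewrite ler_nat subset_leq_card //; apply/fintype.subsetP => v.
  rewrite inE -lt0n => /andP[vB /card_gt0P[x]]; rewrite inE => /andP[xX xv].
  by have [nv dv _] := adj_level xX vB xv; rewrite inE (nonrootC nv) dv eqxx.
by have := card_ballC k P; lra.
Qed.

End PseudoRandom.

(** * The random graph as a product measure *)

(** Concavity of [1 - exp (- y)], which vanishes at zero. Multiplicative comparisons are needed
    because [1 - lambda] may itself tend to zero. *)
Lemma expRN_le_convex (R : realType) (c y : R) : 0 <= c -> c <= 1 ->
  c * (1 - expR (- y)) <= 1 - expR (- (c * y)).
Proof.
move=> c0 c1; have := expR_gt0 (- (c * y)); set u := expR _ => u0.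
have -> : expR (- y) = u * expR (- ((1 - c) * y)) by rewrite /u -expRD; congr expR; ring.
have h1 := ler_wpM2l c0 (expR_ge1Dx (- ((1 - c) * y))).
have h2 : u * (1 + c * y) <= 1.
  have e : u * expR (c * y) = 1 by rewrite /u -expRD addNr expR0.
  by rewrite -[leRHS]e ler_wpM2l ?(ltW u0) // expR_ge1Dx.
have {}h1 := ler_wpM2l (ltW u0) h1; have c2 : 0 <= 1 - c by lra.
have {}h2 := ler_wpM2l c2 h2; lra.
Qed.

Lemma expRN_ge_concave (R : realType) (c y : R) : 1 <= c ->
  1 - expR (- (c * y)) <= c * (1 - expR (- y)).
Proof.
move=> c1; have c0 : 0 < c by lra.
have := @expRN_le_convex R c^-1 (c * y); rewrite mulKf ?gt_eqF // ler_pdivrMl //.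
by apply; rewrite ?invr_ge0 ?invf_le1 // ltW.
Qed.

Lemma expRN_le_sqr (R : realType) (u : R) : 0 <= u -> expR (- u) <= 1 - u + u ^+ 2.
Proof.
move=> u0; apply: (@le_trans _ _ ((1 + u)^-1)).
  by rewrite expRN lef_pV2 ?posrE ?expR_gt0 ?expR_ge1Dx //; lra.
rewrite -[leLHS]mul1r ler_pdivrMr; last by lra.
have : 0 <= u ^+ 3 by rewrite exprn_ge0.
by rewrite !exprS expr0; lra.
Qed.

(** Propagation of relative errors over one exploration step. The fluctuation is [zk]; of the drift
    [6 a A / n], four parts are for the vertices already explored and two for the quadratic term in
    the probability [w] of being reached. *)
Lemma level_step_arith (R : realType) (n q a x U x1 w s s1 zk A : R) :
  0 < n -> 0 <= q -> a = n * q -> 8 <= a -> 0 < A -> 0 <= U -> U <= n -> U <= 4 * A ->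
  0 <= s -> 0 <= zk -> s + (zk + 6 * (a * A) / n) <= s1 -> s1 <= 2^-1 ->
  (1 - s) * A <= x -> x <= (1 + 2 * s) * A ->
  q * x - (q * x) ^+ 2 <= w -> w <= q * x -> 0 <= w ->
  `| x1 - (n - U) * w | < zk * (a * x) ->
  [/\ (1 - s1) * (a * A) <= x1, x1 <= (1 + 2 * s1) * (a * A) & U + x1 <= 4 * (a * A)].
Proof.
move=> n0 q0 aE a8 A0 U0 Un UA s0 zk0 ss s1h xl xu wl wu w0; rewrite ltr_norml => /andP[lo hi].
have a0 : 0 < a by lra.
have aA0 : 0 < a * A by rewrite mulr_gt0.
have t0 : 0 <= 6 * (a * A) / n by rewrite divr_ge0 ?(ltW n0) // mulr_ge0 // ltW.
have sh : s <= 2^-1 by lra.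
have x0 : 0 <= x by apply: le_trans xl; rewrite mulr_ge0 ?(ltW A0) //; lra.
have xb : x <= 2 * A by have := ler_wpM2r (ltW A0) sh; lra.
have nqx : n * (q * x) = a * x by rewrite aE mulrA.
have ax0 : 0 <= a * x by rewrite mulr_ge0 // ltW.
have up : x1 <= a * x * (1 + zk).
  have : (n - U) * w <= n * (q * x) by apply: ler_pM => //; lra.
  by rewrite nqx; lra.
have qb : q * x <= 2 * (a * A) / n.
  have -> : 2 * (a * A) / n = q * (2 * A) by rewrite aE; field; rewrite gt_eqF.
  by rewrite ler_wpM2l.
have low : a * x * (1 - (zk + 6 * (a * A) / n)) <= x1.
  have nU : 0 <= n - U by lra.
  have l1 := ler_wpM2l nU wl.
  have l2 : n * (q * x) * (1 - U / n - q * x) <= (n - U) * (q * x - (q * x) ^+ 2).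
    have -> : n * (q * x) * (1 - U / n - q * x) =
        (n - U) * (q * x - (q * x) ^+ 2) - U * (q * x) ^+ 2.
      by field; rewrite gt_eqF.
    by rewrite gerBl mulr_ge0 // sqr_ge0.
  have l3 : U / n <= 4 * (a * A) / n.
    rewrite ler_wpM2r ?invr_ge0 ?(ltW n0) //.
    by have := ler_wpM2r (ltW A0) a8; lra.
  have l4 : a * x * (1 - 6 * (a * A) / n) <= a * x * (1 - U / n - q * x).
    rewrite ler_wpM2l //.
    have -> : 6 * (a * A) / n = 4 * (a * A) / n + 2 * (a * A) / n by field; rewrite gt_eqF.
    by lra.
  by rewrite nqx in l2; lra.
set u := zk + 6 * (a * A) / n in ss low.
have u0 : 0 <= u by rewrite addr_ge0.
have zu : zk <= u by rewrite /u lerDl.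
split.
    apply: le_trans low; apply: (@le_trans _ _ (a * ((1 - s) * A) * (1 - u))).
      have su : 0 <= s * u by rewrite mulr_ge0.
      have : 1 - s1 <= (1 - s) * (1 - u) by lra.
      by move=> /(ler_wpM2r (ltW aA0)); lra.
    by rewrite ler_wpM2r ?ler_wpM2l ?(ltW a0) //; lra.
  apply: (le_trans up); apply: (@le_trans _ _ (a * ((1 + 2 * s) * A) * (1 + zk))).
    by rewrite ler_wpM2r ?ler_wpM2l ?(ltW a0) //; lra.
  have : 2 * s * zk <= 1 * zk by rewrite ler_wpM2r //; lra.
  move=> sz; have : (1 + 2 * s) * (1 + zk) <= 1 + 2 * s1 by lra.
  by move=> /(ler_wpM2r (ltW aA0)); lra.
have : a * x * (1 + zk) <= a * (2 * A) * (3 / 2).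
  apply: ler_pM => //; [by lra | by rewrite ler_wpM2l ?(ltW a0) | by lra].
by have := ler_wpM2r (ltW A0) a8; lra.
Qed.

Section RandomGraph.
Variables (R : realType) (V : finType) (q : R).
Hypothesis q_ge0 : 0 <= q.
Hypothesis q_le1 : q <= 1.
Local Notation n := (#|V|%:R : R).
Local Notation pairs := (vertex_pairs V).
Implicit Types (f : {ffun {set V} -> bool}) (E : {set {set V}}) (A S U X Y : {set V}).

(** Coordinates are indexed by all sets of vertices, and those that are not pairs are absent with
    probability one; the product space then carries the law of the graph without a type of pairs. *)
Definition edge_law (e : {set V}) (x : bool) : R :=
  if e \in pairs then (if x then q else 1 - q) else (~~ x)%:R.

Definition graph_of f : {set {set V}} := [set e | f e]%SET.

Definition erE (F : {set {set V}} -> R) : R := pE edge_law (fun f => F (graph_of f)).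

Lemma edge_law_ge0 e x : 0 <= edge_law e x.
Proof. by rewrite /edge_law; case: ifP => // _; case: x => //; rewrite subr_ge0. Qed.

Lemma edge_law_sum1 e : \sum_x edge_law e x = 1.
Proof.
by rewrite big_bool /edge_law /=; case: ifP => _; rewrite ?add0r // addrC subrK.
Qed.

Local Hint Resolve edge_law_ge0 edge_law_sum1 : core.

Lemma erE_le F G : (forall E, E \subset pairs -> F E <= G E) -> erE F <= erE G.
Proof.
move=> FG; apply: ler_sum => f _; have [sub|] := boolP (graph_of f \subset pairs).
  by rewrite ler_wpM2l ?FG // pweight_ge0.
move=> /fintype.subsetPn[e ef ep]; have -> : pweight edge_law f = 0; last by rewrite !mul0r.
by rewrite inE in ef; rewrite /pweight (bigD1 e) //= /edge_law (negbTE ep) ef mul0r.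
Qed.

Lemma erE_cst c : erE (fun=> c) = c. Proof. exact: pE_cst. Qed.

Lemma erE_ge0 F : (forall E, E \subset pairs -> 0 <= F E) -> 0 <= erE F.
Proof. by move=> F0; rewrite -(erE_cst 0); apply: erE_le. Qed.

Lemma erED F G : erE (fun E => F E + G E) = erE F + erE G.
Proof. exact: pED. Qed.

Lemma erEZ c F : erE (fun E => c * F E) = c * erE F.
Proof. exact: pEZ. Qed.

Lemma erE_sum (J : finType) (P : pred J) (F : J -> {set {set V}} -> R) :
  erE (fun E => \sum_(j | P j) F j E) = \sum_(j | P j) erE (F j).
Proof. exact: pE_sum. Qed.

Lemma erE_markov (A : pred {set {set V}}) F c : 0 < c ->
  (forall E, E \subset pairs -> 0 <= F E) ->
  (forall E, E \subset pairs -> A E -> c <= F E) ->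
  erE (fun E => (A E)%:R) <= erE F / c.
Proof.
move=> c0 F0 AF; rewrite ler_pdivlMr // mulrC -erEZ; apply: erE_le => E EP.
by case: (boolP (A E)) => [/(AF _ EP)|_]; rewrite ?mulr1 ?mulr0 // F0.
Qed.

Lemma erE_union (A B : pred {set {set V}}) :
  erE (fun E => (A E || B E)%:R) <= erE (fun E => (A E)%:R) + erE (fun E => (B E)%:R).
Proof.
by rewrite -erED; apply: erE_le => E _; case: (A E); case: (B E) => /=; lra.
Qed.

Definition pair_edge (x y : V) : {set V} := [set x; y]%SET.

Lemma pair_edgeP x y : x != y -> pair_edge x y \in pairs.
Proof. by move=> xy; rewrite inE cards2 xy. Qed.

Lemma adj_graph_of f x y : x != y -> adj (graph_of f) x y = f (pair_edge x y).
Proof. by move=> xy; rewrite /adj xy inE. Qed.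

Lemma pE_edge x y : x != y -> pE edge_law (fun f => (f (pair_edge x y))%:R) = q.
Proof.
move=> xy; rewrite (pE_coord edge_law_sum1 _ (fun b : bool => b%:R)).
by rewrite big_bool /= /edge_law pair_edgeP // mulr1 mulr0 addr0.
Qed.

Lemma pair_edge_neq v x y : x != v -> x != y -> pair_edge x v != pair_edge y v.
Proof.
move=> xv xy; apply/eqP => e; have := finset.set21 x v; rewrite -/(pair_edge x v) e in_set2.
by rewrite (negbTE xy) (negbTE xv).
Qed.

(** The mean degree is [n q - q] rather than [n q]; the factor two absorbs the square of this
    bias. *)
Lemma erE_degrees :
  erE (fun E => \sum_v ((deg E v)%:R - n * q) ^+ 2) <= 2 * n * (n * q).
Proof.
rewrite erE_sum; have -> : 2 * n * (n * q) = \sum_(v : V) 2 * (n * q).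
  by rewrite sumr_const -[RHS]mulr_natr; ring.
apply: ler_sum => v _.
pose m := \sum_(y | y != v) q.
have mE : m = n * q - q.
  rewrite /m sumr_const -[LHS]mulr_natl -[X in _ = _ - X]mul1r -mulrBl; congr (_ * _).
  have -> : #|(fun i : V => i != v)| = #|V|.-1 by rewrite -(cardC1 v).
  by rewrite -subn1 natrB //; apply/card_gt0P; exists v.
apply: (@le_trans _ _ (erE (fun E => 2 * ((deg E v)%:R - m) ^+ 2 + 2 * q ^+ 2))).
  apply: erE_le => E _; rewrite mE; set x := (deg E v)%:R.
  have : 0 <= (x - (n * q - q) + q) ^+ 2 by apply: sqr_ge0.
  by rewrite !expr2; lra.
rewrite erED erE_cst erEZ.
have H : erE (fun E => ((deg E v)%:R - m) ^+ 2) <= m.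
  have degE f : (deg (graph_of f) v)%:R = \sum_(y | y != v) (f (pair_edge y v))%:R :> R.
    rewrite /deg -sum1_card natr_sum big_mkcond [RHS]big_mkcond /=; apply: eq_bigr => y _.
    rewrite inE; have [->|yv] := eqVneq y v; first by rewrite adj_irr.
    by rewrite adj_graph_of //; case: (f _).
  rewrite /erE (@eq_pE _ _ _ _ _ (fun f => (\sum_(y | y != v) (f (pair_edge y v))%:R - m) ^+ 2)).
    apply: pE_variance => // [y f _|y yv|x y xv yv xy].
        by case: (f _); rewrite ?expr1n ?expr0n.
      exact: pE_edge.
    rewrite (pE_indep edge_law_sum1 (P := pred1 (pair_edge x v))) ?pE_edge //.
      by move=> f g fg; rewrite fg ?inE.
    by move=> f g fg; rewrite fg // inE /= eq_sym pair_edge_neq.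
  by move=> f; rewrite degE.
have : q ^+ 2 <= q by rewrite expr2 ler_piMr.
by move: H; rewrite mE; lra.
Qed.

Section Jumbled.
Variables (e : R).
Hypothesis e_gt0 : 0 < e.
Hypothesis e_lt1 : e < 1.

Lemma one_sub_expRN : e * (1 - e) <= 1 - expR (- e).
Proof.
by have := expRN_le_sqr (ltW e_gt0); rewrite expr2; lra.
Qed.

Lemma erE_edges A S : [disjoint A & S] ->
  erE (fun E => expR (- (e * \sum_(v in A) (nb E S v)%:R))) <=
  expR (- (e * (1 - e) * q * #|A|%:R * #|S|%:R)).
Proof.
move=> dAS.
have neq x y : x \in A -> y \in S -> y != x.
  move=> xA yS; apply: contraTneq yS => ->.
  by move: dAS => /pred0P/(_ x) /=; rewrite xA /= => ->.
pose Q := [set pair_edge xy.2 xy.1 | xy in finset.setX A S]%SET.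
have inj : {in finset.setX A S &, injective (fun xy : V * V => pair_edge xy.2 xy.1)}.
  move=> [x y] [x' y']; rewrite !finset.in_setX /= => /andP[xA yS] /andP[xA' yS'] eq.
  have [[-> ->]//|[yx xy]] := eq_set2 (neq _ _ xA yS) eq.
  by have := neq _ _ xA' yS; rewrite yx eqxx.
have cQ : #|Q| = (#|A| * #|S|)%N by rewrite card_in_imset // cardsX.
have QP z : z \in Q -> z \in pairs.
  move=> /imsetP[[x y]]; rewrite finset.in_setX => /andP[xA yS] ->.
  by rewrite pair_edgeP // neq.
have sE f : \sum_(v in A) (nb (graph_of f) S v)%:R = \sum_(z in Q) (f z)%:R :> R.
  rewrite big_imset //= (eq_bigl (fun xy => (xy.1 \in A) && (xy.2 \in S))); last first.
    by case=> x y; rewrite finset.in_setX.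
  rewrite -(pair_big (mem A) (mem S) (fun x y => (f (pair_edge y x))%:R : R)) /=.
  apply: eq_bigr => x xA; rewrite /nb -sum1_card natr_sum big_mkcond [RHS]big_mkcond /=.
  apply: eq_bigr => y _; rewrite inE; case: (boolP (y \in S)) => //= yS.
  by rewrite adj_graph_of ?neq //; case: (f _).
pose phi (z : {set V}) (x : bool) : R := if z \in Q then expR (- (e * x%:R)) else 1.
rewrite /erE (@eq_pE _ _ _ _ _ (fun f => \prod_z phi z (f z))); last first.
  move=> f; rewrite sE mulr_sumr -sumrN expR_sum big_mkcond /=.
  by apply: eq_bigr => z _; rewrite /phi.
rewrite pE_prod.
apply: (@le_trans _ _ (\prod_z (if z \in Q then expR (- (e * (1 - e) * q)) else 1))).
  apply: ler_prod => z _; apply/andP; split.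
    by apply: sumr_ge0 => x _; rewrite mulr_ge0 // /phi; case: ifP; rewrite ?expR_ge0.
  rewrite /phi; case: ifP => [zQ|_]; last first.
    by under eq_bigr do rewrite mulr1; rewrite edge_law_sum1.
  rewrite big_bool /= /edge_law QP // mulr1 mulr0 oppr0 expR0 mulr1.
  apply: le_trans (expR_ge1Dx _).
  by have := ler_wpM2l q_ge0 one_sub_expRN; lra.
rewrite -big_mkcond /= prodr_const cQ -expRM_natl ler_expR natrM.
by rewrite le_eqVlt; apply/orP; left; apply/eqP; ring.
Qed.

Definition jumbledb E : bool :=
  [forall A : {set V}, forall S : {set V}, [disjoint A & S] ==>
   ((1 - e) * q * #|A|%:R * #|S|%:R - 3 / e * n <= \sum_(v in A) (nb E S v)%:R)].

Lemma jumbledP E : jumbledb E -> jumbled_graph E q e.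
Proof. by move=> /forallP H A S dAS; have /forallP/(_ S)/implyP := H A; apply. Qed.

(** Chernoff bound with parameter [e] for each pair of sets, whose failure probability [exp (- 3 n)]
    survives the union over [4 ^ n <= exp (2 n)] pairs. *)
Lemma erE_jumbled : erE (fun E => (~~ jumbledb E)%:R) <= expR (- n).
Proof.
pose bad A S E : bool := [disjoint A & S] &&
  (\sum_(v in A) (nb E S v)%:R < (1 - e) * q * #|A|%:R * #|S|%:R - 3 / e * n).
have one A S : erE (fun E => (bad A S E)%:R) <= expR (- (3 * n)).
  have [dAS|dAS] := boolP [disjoint A & S]; last first.
    apply: (@le_trans _ _ (erE (fun=> 0))); last by rewrite erE_cst expR_ge0.
    by apply: erE_le => E _; rewrite /bad (negbTE dAS).
  set c := expR (- (e * (1 - e) * q * #|A|%:R * #|S|%:R) + 3 * n).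
  apply: (le_trans (@erE_markov (bad A S)
    (fun E => expR (- (e * \sum_(v in A) (nb E S v)%:R))) c (expR_gt0 _) _ _)).
      by move=> E _; apply: expR_ge0.
    move=> E _ /andP[_ lt]; rewrite ler_expR.
    have := ler_wpM2l (ltW e_gt0) (ltW lt); have : e * (3 / e * n) = 3 * n by field; rewrite gt_eqF.
    by lra.
  rewrite ler_pdivrMr ?expR_gt0 //; apply: (le_trans (erE_edges dAS)).
  by rewrite /c -expRD ler_expR; lra.
apply: (@le_trans _ _ (erE (fun E => \sum_A \sum_S (bad A S E)%:R))).
  apply: erE_le => E _; have [_|] := boolP (jumbledb E).
    by apply: sumr_ge0 => A _; apply: sumr_ge0.
  rewrite negb_forall => /existsP[A]; rewrite negb_forall => /existsP[S].
  rewrite negb_imply -ltNge => /andP[dAS lt].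
  rewrite (bigD1 A) //= (bigD1 S) //= /bad dAS lt /= -addrA lerDl addr_ge0 ?sumr_ge0 //.
  by move=> A' _; apply: sumr_ge0.
rewrite erE_sum; under eq_bigr do rewrite erE_sum.
apply: (@le_trans _ _ (\sum_(A : {set V}) \sum_(S : {set V}) expR (- (3 * n)))).
  by apply: ler_sum => A _; apply: ler_sum => S _; apply: one.
rewrite !sumr_const -mulrnA -[leLHS]mulr_natl.
have -> : (#|{set V}| * #|{set V}|)%N = (4 ^ #|V|)%N.
  have cS : #|{: {set V}}| = (2 ^ #|V|)%N.
    by rewrite -(cardsT {set V}) -powersetT card_powerset cardsT.
  by rewrite cS -expnMn.
rewrite natrX; have -> : expR (- n) = expR (2 * n) * expR (- (3 * n)) :> R.
  by rewrite -expRD; congr expR; ring.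
rewrite ler_wpM2r ?expR_ge0 // [2 * n]mulrC expRM_natl lerXn2r ?nnegrE ?expR_ge0 //.
have -> : 2 = 1 + 1 :> R by []; rewrite expRD.
by have := expR_ge1Dx (1 : R); set x := expR 1 => h; nra.
Qed.

End Jumbled.

(** ** Breadth-first exploration *)

Section Exploration.
Variable r : V.

Fixpoint bfs E k : {set V} :=
  if k is k'.+1 then
    (bfs E k' :|: [set y | [exists x in bfs E k', adj E x y]])%SET
  else [set r]%SET.

(** Before the first step nothing has been explored, so the last level [bfs E k :\: bfs_prev E k] is
    the root alone for [k = 0]. *)
Definition bfs_prev E k : {set V} := if k is k'.+1 then bfs E k' else finset.set0.

Lemma bfs_ball E k : bfs E k = ball E r k.
Proof.
elim: k => [|k IH]; apply/setP => v.
  rewrite inE /= inE leqn0; apply/eqP/andP => [->|[Cv /eqP d0]].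
    by rewrite component_root gdist_root.
  have [//|/andP[_ vr]] := root_or_nonroot Cv.
  by have [u [_ _]] := gdist_pred Cv vr; rewrite d0.
rewrite /= finset.in_setU IH; apply/orP/idP => [[|]|].
    by rewrite !inE => /andP[-> /leqW].
  rewrite inE => /existsP[x /andP[]]; rewrite inE => /andP[Cx dx] xv.
  by rewrite inE (component_adj Cx xv) (leq_trans (gdist_adj Cx xv)).
move=> vb; have /andP[Cv] : (v \in component E r) && (gdist E r v <= k.+1)%N by move: vb; rewrite inE.
rewrite leq_eqVlt ltnS => /orP[/eqP dv|dv]; last first.
  by left; rewrite inE Cv.
have vr : v != r by apply: contra_eqN dv => /eqP ->; rewrite gdist_root.
have [u [Cu uv]] := gdist_pred Cv vr; rewrite dv => -[du]; right.
by rewrite inE; apply/existsP; exists u; rewrite uv andbT inE Cu du leqnn.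
Qed.

Lemma bfs_prevE E k : bfs E k :\: bfs_prev E k = level E r k.
Proof.
case: k => [|k]; rewrite /bfs_prev ?finset.setD0 !bfs_ball; apply/setP => v.
  by rewrite inE [RHS]inE leqn0.
rewrite inE [RHS]inE inE [v \in ball E r k.+1]inE; case: (v \in component E r) => //=.
by rewrite -ltnNge eqn_leq andbC.
Qed.

Definition meets U : pred {set V} := fun e => ~~ [disjoint e & U].

Lemma pair_meets U x y : x \in U -> meets U (pair_edge x y).
Proof.
move=> xU; apply/negP => /pred0P/(_ x) /=.
by rewrite xU in_set2 eqxx.
Qed.

Lemma pair_notin_meets U x y : x \notin U -> y \notin U -> ~~ meets U (pair_edge x y).
Proof.
move=> xU yU; rewrite negbK; apply/pred0P => z /=; rewrite in_set2.
by apply/negP => /andP[/orP[/eqP->|/eqP->]]; apply/negP.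
Qed.

Lemma bfs_local E E' k : {in meets (bfs_prev E k), E =i E'} ->
  forall j, (j <= k)%N -> bfs E j = bfs E' j.
Proof.
move=> EE'.
have mono i j : (i <= j)%N -> bfs E i \subset bfs E j.
  by move=> ij; rewrite !bfs_ball; apply/fintype.subsetP => v; rewrite !inE => /andP[-> /leq_trans]; apply.
elim=> [//|j IH] jk /=; rewrite -IH 1?ltnW //; congr finset.setU; apply/setP => y; rewrite !inE.
apply: eq_existsb => x; have [xb|//] := boolP (x \in bfs E j); rewrite /= /adj.
congr andb; apply: EE'; apply: pair_meets.
case: k jk {IH} => // k; rewrite ltnS => jk /=; exact: (fintype.subsetP (mono _ _ jk)).
Qed.

(** The exploration up to step [k] reads only edges that meet [bfs_prev]. On the event that this set
    is [U'], the edges avoiding [U'] are therefore still fresh. *)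
Lemma bfs_event_depends k U' U :
  depends_on (meets U')
    (fun f => (bfs_prev (graph_of f) k == U') && (bfs (graph_of f) k == U)).
Proof.
have H (f g : {ffun {set V} -> bool}) : {in meets U', f =1 g} -> bfs_prev (graph_of f) k = U' ->
    bfs_prev (graph_of g) k = U' /\ bfs (graph_of f) k = bfs (graph_of g) k.
  move=> fg fU; have loc : {in meets (bfs_prev (graph_of f) k), graph_of f =i graph_of g}.
    by rewrite fU => e eU; rewrite !inE fg.
  have L := bfs_local loc; rewrite (L k) //; split => //.
  rewrite -fU; case: (k) L => // j L; rewrite /= L //.
move=> f g fg; apply/andP/andP => -[/eqP p1 /eqP p2].
  by have [-> <-] := H _ _ fg p1; rewrite p2 !eqxx.
have gf : {in meets U', g =1 f} by move=> e eU; rewrite fg.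
by have [-> <-] := H _ _ gf p1; rewrite p2 !eqxx.
Qed.

Definition hit X y f : bool := [exists x in X, f (pair_edge x y)].

Lemma pE_hit X y : y \notin X ->
  pE edge_law (fun f => (hit X y f)%:R) = 1 - (1 - q) ^+ #|X|.
Proof.
move=> yX.
pose phi (z : {set V}) (b : bool) : R := if z \in [set pair_edge x y | x in X]%SET then (~~ b)%:R else 1.
have xy x : x \in X -> x != y by move=> xX; apply: contraNneq yX => <-.
have inj : {in X &, injective (pair_edge^~ y)}.
  move=> x x' xX x'X e; apply/eqP; apply: contraTT isT => ne.
  by have := pair_edge_neq (xy _ xX) ne; rewrite e eqxx.
rewrite (@eq_pE _ _ _ _ _ (fun f => 1 + (-1) * \prod_z phi z (f z))); last first.
  move=> f; rewrite mulN1r /hit; have [/existsP[x /andP[xX fx]]|] := boolP [exists x in X, f (pair_edge x y)].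
    have xi : pair_edge x y \in [set pair_edge x y | x in X]%SET by apply/imsetP; exists x.
    by rewrite (bigD1 (pair_edge x y)) //= /phi xi fx mul0r subr0.
  rewrite negb_exists => /forallP H; rewrite big1 ?subrr // => z _; rewrite /phi.
  by case: ifP => // /imsetP[x xX ->]; have := H x; rewrite xX /= => ->.
rewrite pED // pE_cst // pEZ mulN1r pE_prod; congr (1 - _).
rewrite -(card_in_imset inj) -prodr_const [RHS]big_mkcond; apply: eq_bigr => z _.
rewrite big_bool /= /phi; case: ifP => [/imsetP[x xX ->]|_].
  by rewrite mulr0 add0r mulr1 /edge_law pair_edgeP // xy.
by rewrite !mulr1; have := edge_law_sum1 z; rewrite big_bool.
Qed.

Lemma hit_depends X y : depends_on (mem [set pair_edge x y | x in X]%SET) (hit X y).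
Proof.
move=> f g fg; apply: eq_existsb => x; case: (boolP (x \in X)) => //= xX.
by rewrite fg //; apply: imset_f.
Qed.

Lemma pE_hit_variance X Y : [disjoint X & Y] ->
  pE edge_law (fun f => (\sum_(y in Y) (hit X y f)%:R -
      #|Y|%:R * (1 - (1 - q) ^+ #|X|)) ^+ 2) <= #|Y|%:R * (1 - (1 - q) ^+ #|X|).
Proof.
move=> dXY; have nX y : y \in Y -> y \notin X.
  by move=> yY; move: dXY => /pred0P/(_ y) /=; rewrite yY andbT => ->.
have -> : #|Y|%:R * (1 - (1 - q) ^+ #|X|) = \sum_(y in Y) (1 - (1 - q) ^+ #|X|) :> R.
  by rewrite sumr_const mulr_natl.
apply: pE_variance => // [y f _|y yY|x y xY yY xy].
    by case: (hit _ _ _); rewrite ?expr1n ?expr0n.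
  by rewrite pE_hit // nX.
rewrite (pE_indep edge_law_sum1 (P := mem [set pair_edge z x | z in X]%SET)) ?pE_hit ?nX //.
  by move=> f g fg; rewrite (hit_depends fg).
move=> f g fg; rewrite (@hit_depends X y f g) // => e /imsetP[z zX ->].
apply: fg; rewrite inE /=; apply/negP => /imsetP[z' z'X e'].
have zy : z != y by apply: contraTneq zX => ->; apply: nX.
have [[_ yx]|[_ yz']] := eq_set2 zy e'; first by rewrite yx eqxx in xy.
by rewrite -yz' in z'X; case/negP: (nX _ yY).
Qed.

(** Chebyshev's inequality conditionally on the last two explored sets [U'] and [U]: the edges from
    [U :\: U'] to the complement of [U] avoid [U'] and are independent of this conditioning. The
    predicate [P] retains the histories for which the tolerance [t] is adequate. *)
Lemma erE_exploration k (P : rel {set V}) (t : {set V} -> {set V} -> R) (c : R) :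
  0 <= c ->
  (forall U' U, P U' U -> U' \subset U ->
    0 < t U' U /\ #|~: U|%:R * (1 - (1 - q) ^+ #|U :\: U'|) <= c * t U' U ^+ 2) ->
  erE (fun E => (P (bfs_prev E k) (bfs E k) &&
    (t (bfs_prev E k) (bfs E k) <=
     `| #|level E r k.+1|%:R - #|~: bfs E k|%:R * (1 - (1 - q) ^+ #|level E r k|) |))%:R) <= c.
Proof.
move=> c0 Pt.
pose H U' U f : bool := (bfs_prev (graph_of f) k == U') && (bfs (graph_of f) k == U).
pose g U' U f : R := (\sum_(y in ~: U) (hit (U :\: U') y f)%:R -
      #|~: U|%:R * (1 - (1 - q) ^+ #|U :\: U'|)) ^+ 2.
have subU E : bfs_prev E k \subset bfs E k.
  by case: k {Pt H g} => [|j]; rewrite ?finset.sub0set //= finset.subsetUl.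
apply: (@le_trans _ _ (pE edge_law (fun f => \sum_(UU : {set V} * {set V} |
    P UU.1 UU.2 && (UU.1 \subset UU.2)) (H UU.1 UU.2 f)%:R * (g UU.1 UU.2 f / t UU.1 UU.2 ^+ 2)))).
  rewrite /erE; apply: pE_le => // f; set U' := bfs_prev _ _; set U := bfs _ _.
  have rhs0 (UU : {set V} * {set V}) : 0 <= (H UU.1 UU.2 f)%:R * (g UU.1 UU.2 f / t UU.1 UU.2 ^+ 2).
    by rewrite mulr_ge0 // divr_ge0 ?sqr_ge0.
  have [PU|_] := boolP (P U' U); last by rewrite sumr_ge0.
  rewrite (bigD1 (U', U)) /=; last by rewrite PU subU.
  apply: (@le_trans _ _ ((H U' U f)%:R * (g U' U f / t U' U ^+ 2))); last first.
    by rewrite lerDl sumr_ge0.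
  rewrite /H !eqxx mul1r; have [t0 _] := Pt _ _ PU (subU _).
  have gE : g U' U f = (#|level (graph_of f) r k.+1|%:R -
      #|~: U|%:R * (1 - (1 - q) ^+ #|level (graph_of f) r k|)) ^+ 2.
    rewrite /g -(bfs_prevE _ k) -/U -/U'; congr ((_ - _) ^+ 2).
    rewrite -(bfs_prevE _ k.+1) /= -/U -sum1_card natr_sum big_mkcond [RHS]big_mkcond /=.
    apply: eq_bigr => y _; rewrite finset.in_setC finset.in_setD finset.in_setU.
    have [yU|yU] := boolP (y \in U); rewrite //= inE.
    (* An edge from [U'] to [y] would have put [y] into [U] already, so only the last level can
       reach it. *)
    have -> : hit (U :\: U') y f = [exists x in U, adj (graph_of f) x y].
      apply: eq_existsb => x; rewrite finset.in_setD.
      have [xU|xU] := boolP (x \in U); rewrite ?andbF ?andbT //.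
      have xy : x != y by apply: contraNneq yU => <-.
      rewrite adj_graph_of //; have [xU'|//] := boolP (x \in U'); rewrite /=.
      apply/esym/negP => fxy; case/negP: yU; move: xU'; rewrite /U /U'.
      case: (k) => [|j] /=; first by rewrite finset.in_set0.
      move=> xU'; rewrite finset.in_setU inE; apply/orP; right; apply/existsP.
      by exists x; rewrite xU' adj_graph_of.
    by case: [exists x in U, _].
  rewrite gE ler_pdivlMr ?exprn_gt0 //.
  case: (boolP (t U' U <= _)) => [le|_]; last by rewrite mul0r sqr_ge0.
  by rewrite mul1r -[leRHS]real_normK ?num_real // lerXn2r ?nnegrE ?(ltW t0).
rewrite pE_sum.
apply: (@le_trans _ _ (\sum_(UU : {set V} * {set V} |
    P UU.1 UU.2 && (UU.1 \subset UU.2)) c * pE edge_law (fun f => (H UU.1 UU.2 f)%:R))).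
  apply: ler_sum => -[U' U] /= /andP[PU sub]; have [t0 tc] := Pt _ _ PU sub.
  have dg : depends_on (predC (meets U')) (fun f => g U' U f / t U' U ^+ 2).
    move=> f f' ff'; rewrite /g; congr ((_ - _) ^+ 2 / _); apply: eq_bigr => y yU.
    rewrite (@hit_depends _ _ f f') // => e /imsetP[x]; rewrite finset.in_setD => /andP[xU' _] ->.
    apply: ff'; rewrite inE pair_notin_meets //.
    by apply: contra (fintype.subsetP sub y) _; rewrite finset.in_setC in yU.
  rewrite (pE_indep edge_law_sum1 (P := meets U')) //; last first.
    by move=> f f' ff'; congr (_%:R); rewrite /H (@bfs_event_depends k U' U f f' ff').
  rewrite mulrC ler_wpM2r ?pE_ge0 //.
  rewrite (@eq_pE _ _ _ _ _ (fun f => (t U' U ^+ 2)^-1 * g U' U f)) => [|f]; last by rewrite mulrC.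
  rewrite pEZ mulrC ler_pdivrMr ?exprn_gt0 //; apply: le_trans tc.
  apply: pE_hit_variance; apply/pred0P => y /=; rewrite finset.in_setD finset.in_setC.
  by case: (y \in U); rewrite ?andbF.
rewrite -mulr_sumr -[leRHS]mulr1 ler_wpM2l // -pE_sum -[leRHS](pE_cst edge_law_sum1 1).
apply: pE_le => // f; rewrite big_mkcond (bigD1 (bfs_prev (graph_of f) k, bfs (graph_of f) k)) //=.
rewrite big1 ?addr0; first by case: ifP => // _; case: (H _ _ _).
move=> [U' U] /=; rewrite xpair_eqE negb_and /H => ne; case: ifP => // _.
by move: ne; rewrite ![_ == U']eq_sym ![_ == U]eq_sym; case: eqP => //=; case: eqP.
Qed.

Lemma one_sub_expr_le x : 1 - (1 - q) ^+ x <= q * x%:R.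
Proof.
elim: x => [|x IH]; first by rewrite expr0 subrr mulr0.
have : 0 <= (1 - q) ^+ x by rewrite exprn_ge0 // subr_ge0.
have : (1 - q) ^+ x <= 1 by rewrite exprn_ile1 ?subr_ge0 // lerBlDr lerDl.
by rewrite exprS -natr1 => h1 h2; have := ler_wpM2l q_ge0 h1; lra.
Qed.

Lemma expr_le_expR x : (1 - q) ^+ x <= expR (- (q * x%:R)).
Proof.
rewrite -mulNr expRM_natr lerXn2r ?nnegrE ?expR_ge0 ?subr_ge0 //.
exact: expR_ge1Dx.
Qed.

Lemma one_sub_expr_ge x : q * x%:R - (q * x%:R) ^+ 2 <= 1 - (1 - q) ^+ x.
Proof.
have u0 : 0 <= q * x%:R by rewrite mulr_ge0.
have := le_trans (expr_le_expR x) (expRN_le_sqr u0).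
by move: ((1 - q) ^+ x) (q * x%:R) => u v; lra.
Qed.

Section LevelSizes.
Variables (a z : R).
Hypothesis aE : a = n * q.
Hypothesis a_ge8 : 8 <= a.
Hypothesis z_gt0 : 0 < z.

(** The first term sums the tolerances [z / 2 ^ j] of the steps before [k]; the second dominates the
    accumulated drifts, since these grow at least by the factor [a] from step to step. *)
Definition slack k : R := z * (2 - 2 / 2 ^+ k) + 12 * a ^+ k / n.

Definition size_ok k U' U : bool :=
  [&& (1 - slack k) * a ^+ k <= #|U :\: U'|%:R,
      #|U :\: U'|%:R <= (1 + 2 * slack k) * a ^+ k & #|U|%:R <= 4 * a ^+ k].

Definition sizes k E : bool := size_ok k (bfs_prev E k) (bfs E k).

Let n_gt0 : 0 < n. Proof. by rewrite ltr0n; apply/card_gt0P; exists r. Qed.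
Let a_gt0 : 0 < a. Proof. by move: a_ge8; lra. Qed.
Let ak_gt0 k : 0 < a ^+ k. Proof. by rewrite exprn_gt0. Qed.

Lemma slack_ge0 k : 0 <= slack k.
Proof.
rewrite /slack addr_ge0 ?divr_ge0 ?mulr_ge0 ?(ltW (ak_gt0 _)) ?(ltW z_gt0) //.
rewrite subr_ge0 ler_pdivrMr ?exprn_gt0 // ler_peMr // exprn_ege1 //.
by lra.
Qed.

Lemma slack_step k : slack k + (z / 2 ^+ k + 6 * a ^+ k.+1 / n) <= slack k.+1.
Proof.
rewrite /slack; have p0 : 0 < 2 ^+ k :> R by rewrite exprn_gt0.
have -> : 2 / 2 ^+ k.+1 = 1 / 2 ^+ k :> R by rewrite exprS; field; rewrite gt_eqF.
have h : 12 * a ^+ k / n + 6 * a ^+ k.+1 / n <= 12 * a ^+ k.+1 / n.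
  rewrite -mulrDl ler_wpM2r ?invr_ge0 ?(ltW n_gt0) // exprS.
  by have := ler_wpM2r (ltW (ak_gt0 k)) a_ge8; have := ak_gt0 k; lra.
have -> : z * (2 - 2 / 2 ^+ k) = 2 * z - 2 * (z / 2 ^+ k) by field; rewrite gt_eqF.
have -> : z * (2 - 1 / 2 ^+ k) = 2 * z - z / 2 ^+ k by field; rewrite gt_eqF.
by lra.
Qed.

Lemma slack_mono j k : (j <= k)%N -> slack j <= slack k.
Proof.
move=> /subnK <-; elim: (k - j)%N => [|i IH]; first by rewrite add0n.
apply: (le_trans IH); apply: le_trans (slack_step _); rewrite lerDl addr_ge0 //.
  by rewrite divr_ge0 ?(ltW z_gt0) // exprn_ge0.
by rewrite divr_ge0 // mulr_ge0 // ltW.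
Qed.

Lemma sizes0 E : sizes 0 E.
Proof.
rewrite /sizes /size_ok /= finset.setD0 cards1 !expr0 !mulr1.
by have := slack_ge0 0 => h; apply/and3P; split; lra.
Qed.

Lemma card_setC_real U : #|~: U|%:R = n - #|U|%:R :> R.
Proof. by rewrite -[#|V|](cardsC U) natrD addrAC subrr add0r. Qed.

(** With tolerance [z / 2 ^ k] Chebyshev's inequality gives [4 ^ k / (z ^ 2 a x)] for a level of
    size [x]. Levels grow so fast that [8 ^ k <= a ^ k <= 2 x], which leaves a summable bound. *)
Lemma erE_sizes_step k : slack k.+1 <= 2^-1 ->
  erE (fun E => (sizes k E && ~~ sizes k.+1 E)%:R) <= 2 / 2 ^+ k / (z ^+ 2 * a).
Proof.
move=> sk1.
have p0 : 0 < 2 ^+ k :> R by rewrite exprn_gt0.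
have sstep := slack_step k; have s0 := slack_ge0 k.
have zk : 0 <= z / 2 ^+ k by rewrite divr_ge0 ?(ltW z_gt0) // ltW.
have ak1 : 0 <= 6 * a ^+ k.+1 / n by rewrite divr_ge0 // mulr_ge0 // ltW.
have sk : slack k <= 2^-1 by lra.
pose t (U' U : {set V}) : R := z / 2 ^+ k * (a * #|U :\: U'|%:R).
have x_ge U' U : size_ok k U' U -> a ^+ k <= 2 * #|U :\: U'|%:R.
  by move=> /and3P[h _ _]; have := ler_wpM2r (ltW (ak_gt0 k)) sk; lra.
have x_le U' U : size_ok k U' U -> #|U :\: U'|%:R <= 2 * a ^+ k.
  by move=> /and3P[_ h _]; have := ler_wpM2r (ltW (ak_gt0 k)) sk; lra.
apply: le_trans (@erE_exploration k (size_ok k) t (2 / 2 ^+ k / (z ^+ 2 * a)) _ _).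
      apply: erE_le => E _; rewrite -/(sizes k E); have [sE|//] := boolP (sizes k E).
    rewrite /=; have [//|nS] := boolP (sizes k.+1 E).
    rewrite ler_nat lt0b; apply: contraNT nS; rewrite -ltNge => lt.
    have cU : #|bfs E k.+1|%:R = #|bfs E k|%:R + #|level E r k.+1|%:R :> R.
      rewrite -(bfs_prevE E k.+1) -natrD; congr _%:R.
      rewrite /bfs_prev cardsD (finset.setIidPr _) ?subnKC //=; last exact: finset.subsetUl.
      by rewrite subset_leq_card // finset.subsetUl.
    move: sE lt => /and3P[]; rewrite /t bfs_prevE card_setC_real => xl xu Uk lt.
    have [] := level_step_arith n_gt0 q_ge0 aE a_ge8 (ak_gt0 k) (ler0n _ _) _ Uk s0 zk
      (s1 := slack k.+1) _ sk1 xl xu (one_sub_expr_ge _) (one_sub_expr_le _) _ lt.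
          by rewrite ler_nat max_card.
        by rewrite -exprS.
      by rewrite subr_ge0 exprn_ile1 ?subr_ge0 // lerBlDr lerDl.
    by rewrite -exprS -cU => h1 h2 h3; apply/and3P; rewrite bfs_prevE.
  by rewrite !divr_ge0 // ?mulr_ge0 ?sqr_ge0 // ltW.
move=> U' U ok _; have xg := x_ge _ _ ok; set x := #|U :\: U'| in xg *.
have x0 : 0 < x%:R :> R by have := ak_gt0 k; lra.
split; first by rewrite /t !mulr_gt0 ?invr_gt0.
apply: (@le_trans _ _ (a * x%:R)).
  rewrite aE -mulrA; apply: ler_pM => //.
    by rewrite subr_ge0 exprn_ile1 ?subr_ge0 // lerBlDr lerDl.
    by rewrite ler_nat max_card.
  exact: one_sub_expr_le.
rewrite /t -/x [leRHS](_ : _ = a * x%:R * (2 * x%:R / (2 ^+ k) ^+ 3)); last first.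
  by field; rewrite !gt_eqF.
rewrite -[leLHS]mulr1 ler_wpM2l ?mulr_ge0 ?(ltW a_gt0) // ler_pdivlMr ?exprn_gt0 // mul1r.
apply: le_trans xg; rewrite -exprM mulnC exprM lerXn2r ?nnegrE ?exprn_ge0 ?(ltW a_gt0) //.
by apply: le_trans a_ge8; rewrite !exprS expr0; lra.
Qed.

Lemma erE_sizes k : slack k <= 2^-1 ->
  erE (fun E => (~~ sizes k E)%:R) <= 4 / (z ^+ 2 * a) * (1 - 1 / 2 ^+ k).
Proof.
elim: k => [|k IH] sk.
  rewrite expr0 divr1 subrr mulr0 -(erE_cst 0); apply: erE_le => E _.
  by rewrite sizes0.
have sk' : slack k <= 2^-1 by apply: le_trans sk; apply: slack_mono.
apply: (@le_trans _ _ (erE (fun E => (~~ sizes k E || (sizes k E && ~~ sizes k.+1 E))%:R))).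
  by apply: erE_le => E _; case: (sizes k E) => //=; case: (sizes k.+1 E).
apply: (le_trans (erE_union _ _)).
apply: (le_trans (lerD (IH sk') (erE_sizes_step sk))).
have p0 : 2 ^+ k != 0 :> R by rewrite expf_neq0.
rewrite [2 ^+ k.+1]exprS le_eqVlt; apply/orP; left; apply/eqP; field.
by rewrite p0 !gt_eqF.
Qed.

(** At the level [D] the mean [y] need not be small and the linear estimate of the hitting
    probability fails; it is compared directly with [1 - exp (- y)]. *)
Lemma erE_last_level k (h y : R) : y = a ^+ k.+1 / n -> 0 < h -> h <= 8^-1 -> slack k <= h ->
  4 * a ^+ k / n <= h -> q <= h / (1 + h) ->
  erE (fun E => (sizes k E && ~~ (((1 - 3 * h) * (n * (1 - expR (- y))) <= #|level E r k.+1|%:R) &&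
     (#|level E r k.+1|%:R <= (1 + 5 * h) * (n * (1 - expR (- y))))))%:R)
  <= 2 / (h ^+ 2 * (n * (1 - expR (- y)))).
Proof.
move=> yD h0 h8 sh ah qh.
have y0 : 0 < y by rewrite yD divr_gt0.
have L0 : 0 < 1 - expR (- y) by rewrite subr_gt0 -[ltRHS]expR0 ltr_expR oppr_lt0.
set L := 1 - expR (- y) in L0 *.
have nL : 0 < n * L by rewrite mulr_gt0.
have yE : q * a ^+ k = y by rewrite yD exprS {2}aE; field; rewrite gt_eqF.
have piU (U' U : {set V}) : size_ok k U' U ->
    1 - (1 - q) ^+ #|U :\: U'| <= (1 + 4 * h) * L.
  move=> /and3P[_ hx _]; set x := #|_| in hx *.
  apply: (@le_trans _ _ (1 - expR (- ((1 + 4 * h) * y)))); last first.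
    by apply: expRN_ge_concave; lra.
  rewrite lerD2l lerN2; apply: (@le_trans _ _ (expR (- ((1 + h) * q)) ^+ x)); last first.
    rewrite lerXn2r ?nnegrE ?expR_ge0 ?subr_ge0 //; exact: expR_le_1B.
  rewrite -expRM_natl ler_expR mulrN lerN2 -yE.
  have q1 := ler_wpM2l q_ge0 hx.
  have e1 : 0 <= 1 + h by lra.
  have q2 := ler_wpM2l e1 q1; apply: (@le_trans _ _ ((1 + h) * (q * ((1 + 2 * slack k) * a ^+ k)))).
    by lra.
  have qa : 0 <= q * a ^+ k by rewrite mulr_ge0 // ltW.
  have s0 := slack_ge0 k.
  have : (1 + h) * (1 + 2 * slack k) <= 1 + 4 * h by nra.
  by move=> /(ler_wpM2r qa); lra.
have piL (U' U : {set V}) : size_ok k U' U ->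
    (1 - h) * L <= 1 - (1 - q) ^+ #|U :\: U'|.
  move=> /and3P[hx _ _]; set x := #|_| in hx *.
  apply: (@le_trans _ _ (1 - expR (- ((1 - h) * y)))).
    by apply: expRN_le_convex; lra.
  rewrite lerD2l lerN2; apply: (le_trans (expr_le_expR x)).
  rewrite ler_expR lerN2 -yE.
  have q1 := ler_wpM2l q_ge0 hx; apply: le_trans q1.
  have qa : 0 <= q * a ^+ k by rewrite mulr_ge0 // ltW.
  by have := ler_wpM2l qa sh; lra.
pose t (U' U : {set V}) : R := h * (n * L).
apply: le_trans (@erE_exploration k (size_ok k) t _ _ _).
    apply: erE_le => E _; rewrite -/(sizes k E); have [sE|//] := boolP (sizes k E).
    rewrite /=; set b := (X in (~~ X)%:R <= _); have [//|nbb] := boolP b.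
    rewrite ler_nat lt0b; apply: contraNT nbb; rewrite -ltNge => lt.
    rewrite /b; have up := piU _ _ sE; have low := piL _ _ sE.
    move: sE => /and3P[_ _ Uk]; rewrite bfs_prevE in up low.
    move: lt; rewrite /t card_setC_real ltr_norml; move: Uk.
    set U := #|bfs E k|%:R; set x1 := #|level E r k.+1|%:R => Uk.
    set w := 1 - _ in up low * => /andP[lo hi].
    have U0 : 0 <= U by [].
    have Un : U <= h * n.
      apply: (le_trans Uk); move: ah; rewrite ler_pdivrMr //.
    have w0 : 0 <= w by apply: le_trans low; rewrite mulr_ge0 ?(ltW L0) //; lra.
    have Unn : 0 <= n - U by rewrite subr_ge0 ler_nat max_card.
    have h1 : (n - U) * w <= n * ((1 + 4 * h) * L) by apply: ler_pM => //; lra.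
    have h2 : ((1 - h) * n) * ((1 - h) * L) <= (n - U) * w.
      by apply: ler_pM => //; rewrite ?mulr_ge0 ?(ltW L0) //; lra.
    have h3 : (1 - 2 * h) * (n * L) <= ((1 - h) * n) * ((1 - h) * L).
      have : 0 <= h ^+ 2 * (n * L) by rewrite mulr_ge0 ?sqr_ge0 // ltW.
      by rewrite expr2; lra.
    by apply/andP; split; lra.
  by rewrite divr_ge0 // mulr_ge0 ?sqr_ge0 // ltW.
move=> U' U ok _; split; first by rewrite /t mulr_gt0.
rewrite /t [leRHS](_ : _ = 2 * (n * L)); last by field; rewrite !gt_eqF.
apply: (@le_trans _ _ (n * ((1 + 4 * h) * L))).
  apply: ler_pM => //; rewrite ?ler_nat ?max_card //; last exact: piU ok.
  by apply: le_trans (piL _ _ ok); rewrite mulr_ge0 ?(ltW L0) //; lra.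
by have : (1 + 4 * h) * (n * L) <= 2 * (n * L) by [rewrite ler_wpM2r ?(ltW nL) //; lra]; lra.
Qed.

End LevelSizes.

End Exploration.

End RandomGraph.

(** * Good graphs *)

Lemma truncn_bounds (R : realType) (z : R) : 2 <= z -> z / 2 <= (Num.truncn z)%:R <= z.
Proof.
move=> z2; have z0 : 0 <= z by lra.
have /andP[t1 t2] := Num.Theory.truncn_itv z0; rewrite t1 andbT.
by move: t2; rewrite -natr1; lra.
Qed.

Section GoodGraph.
Variables (R : realType) (V : finType) (r : V) (k : nat) (q a e h l : R).
Local Notation n := (#|V|%:R : R).
Implicit Type E : {set {set V}}.

(** With [k.+2] equal to [d_star] this is [log (1 / lambda_n)], and the fraction below is
    [1 - lambda_n]. *)
Definition last_mean : R := a ^+ k.+2 / n.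
Local Notation y := last_mean.
Definition last_fraction : R := 1 - expR (- y).
Local Notation L := last_fraction.

(** The index [k.+2] stands for the level [D]. Everything about the random graph that the two
    temperature regimes use is gathered here. *)
Definition good E : bool :=
  [&& jumbledb q e E, (\sum_v ((deg E v)%:R - a) ^+ 2 <= n * a * l),
      (#|ball E r k|%:R <= 4 * a ^+ k), (#|ball E r k.+1|%:R <= 4 * a ^+ k.+1),
      ((1 - h) * a ^+ k.+1 <= #|level E r k.+1|%:R),
      (#|level E r k.+1|%:R <= (1 + 2 * h) * a ^+ k.+1),
      ((1 - 3 * h) * (n * L) <= #|level E r k.+2|%:R) &
      (#|level E r k.+2|%:R <= (1 + 5 * h) * (n * L))].

Hypothesis q_gt0 : 0 < q.
Hypothesis aE : a = n * q.
Hypothesis e_gt0 : 0 < e.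
Hypothesis e_le : e <= 4^-1.
Hypothesis h_gt0 : 0 < h.
Hypothesis h_le : h <= 8^-1.
Hypothesis l_ge : 4 <= l.
Hypothesis a_ge : l ^+ 3 <= a.
Hypothesis ak_le : a ^+ k.+1 <= n / l ^+ 2.
Hypothesis L_ge : (2 * l ^+ 2)^-1 <= L.

Let n_gt0 : 0 < n. Proof. by rewrite ltr0n; apply/card_gt0P; exists r. Qed.
Let l_gt0 : 0 < l. Proof. by move: l_ge; lra. Qed.
Let a_ge64 : 64 <= a.
Proof.
apply: le_trans a_ge; have -> : 64 = 4 ^+ 3 :> R by rewrite !exprS expr0; lra.
by rewrite lerXn2r ?nnegrE // ltW.
Qed.
Let a_gt0 : 0 < a. Proof. by move: a_ge64; lra. Qed.
Let l2_gt0 : 0 < l ^+ 2. Proof. by rewrite exprn_gt0. Qed.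
Let y_gt0 : 0 < y. Proof. by rewrite divr_gt0 // exprn_gt0. Qed.
Let L_gt0 : 0 < L.
Proof. by apply: lt_le_trans L_ge; rewrite invr_gt0 mulr_gt0. Qed.

Lemma erE_good (z : R) : q <= h / (1 + h) -> 0 < z -> 2 * z + 12 / l ^+ 2 <= h ->
  erE q (fun E => (~~ good E)%:R) <=
  expR (- n) + 2 / l + 8 / (z ^+ 2 * a) + 2 / (h ^+ 2 * (n * L)).
Proof.
move=> qh z0 zh; have q0 := ltW q_gt0.
have q1 : q <= 1.
  by apply: (le_trans qh); rewrite ler_pdivrMr; move: h_gt0; lra.
have e1 : e < 1 by move: e_le; lra.
have a8 : 8 <= a by move: a_ge64; lra.
have sl : slack V a z k.+1 <= h.
  rewrite /slack; apply: le_trans zh; apply: lerD.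
    rewrite mulrC ler_wpM2r ?(ltW z0) // gerBl divr_ge0 // exprn_ge0 //.
  by rewrite ler_pdivrMr // mulrAC -mulrA ler_wpM2l // mulrC.
have sk1 : slack V a z k.+1 <= 2^-1 by move: h_le; lra.
have sk : slack V a z k <= 2^-1 by apply: le_trans sk1; apply: slack_mono.
have ah : 4 * a ^+ k.+1 / n <= h.
  apply: le_trans zh; rewrite ler_pdivrMr //.
  have : 4 * a ^+ k.+1 <= 12 * (n / l ^+ 2) by have := ak_le; have := exprn_gt0 k.+1 a_gt0; lra.
  by have : 0 <= 2 * z * n by [rewrite !mulr_ge0 // ltW]; lra.
have p2 j : 1 - 1 / 2 ^+ j <= 1 :> R by rewrite gerBl divr_ge0 // exprn_ge0.
have B0 : 0 <= 4 / (z ^+ 2 * a) by rewrite divr_ge0 // mulr_ge0 ?sqr_ge0 // ltW.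
have S j : slack V a z j <= 2^-1 -> erE q (fun E => (~~ sizes r a z j E)%:R) <= 4 / (z ^+ 2 * a).
  move=> sj; apply: (le_trans (erE_sizes q0 q1 r aE a8 z0 sj)).
  by rewrite ler_piMr.
pose lastb E : bool := ((1 - 3 * h) * (n * L) <= #|level E r k.+2|%:R) &&
     (#|level E r k.+2|%:R <= (1 + 5 * h) * (n * L)).
have Lst := erE_last_level q0 q1 r aE a8 z0 (erefl y) h_gt0 h_le sl ah qh.
have Deg : erE q (fun E => (~~ (\sum_v ((deg E v)%:R - a) ^+ 2 <= n * a * l))%:R) <= 2 / l.
  have nal : 0 < n * a * l by rewrite !mulr_gt0.
  apply: (le_trans (@erE_markov _ _ _ q0 q1 _ (fun E => \sum_v ((deg E v)%:R - a) ^+ 2) _ nal _ _)).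
      by move=> E _; apply: sumr_ge0 => v _; apply: sqr_ge0.
    by move=> E _; rewrite -ltNge => /ltW.
  rewrite ler_pdivrMr // aE; apply: (le_trans (erE_degrees V q0 q1)).
  by rewrite le_eqVlt; apply/orP; left; apply/eqP; field; rewrite gt_eqF.
have Jmb := erE_jumbled V q0 q1 e_gt0.
apply: (@le_trans _ _ (erE q (fun E => (~~ jumbledb q e E)%:R +
  ((~~ (\sum_v ((deg E v)%:R - a) ^+ 2 <= n * a * l))%:R +
  ((~~ sizes r a z k E)%:R + ((~~ sizes r a z k.+1 E)%:R +
  (sizes r a z k.+1 E && ~~ lastb E)%:R)))))).
  apply: erE_le => // E _; have [//|ng] := boolP (good E); first by rewrite !addr_ge0.
  rewrite /=; have [J|_] := boolP (jumbledb q e E); last by rewrite lerDl !addr_ge0.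
  rewrite add0r; set dd := (X in ~~ X); have [Dg|_] := boolP dd; last by rewrite lerDl !addr_ge0.
  rewrite add0r; have [s1|_] := boolP (sizes r a z k E); last by rewrite lerDl !addr_ge0.
  rewrite add0r; have [s2|_] := boolP (sizes r a z k.+1 E); last by rewrite lerDl.
  rewrite add0r /=; have [l1|//] := boolP (lastb E).
  case/negP: ng; rewrite /good J (Dg : \sum_v ((deg E v)%:R - a) ^+ 2 <= n * a * l) /=.
  move: s1 s2 => /and3P[_ _ b1] /and3P[]; rewrite bfs_prevE !bfs_ball in b1 * => c1 c2 b2.
  rewrite b1 b2 /= (l1 : _ && _) andbT; have ak0 := exprn_gt0 k.+1 a_gt0.
  have := ler_wpM2r (ltW ak0) sl => sa.
  by apply/andP; split; lra.
rewrite !erED.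
have := S _ sk; have := S _ sk1; move: Lst Deg Jmb; rewrite -/L -/(lastb _).
set x1 := erE _ _; set x2 := erE _ _; set x3 := erE _ _; set x4 := erE _ _; set x5 := erE _ _.
have -> : 8 / (z ^+ 2 * a) = 4 / (z ^+ 2 * a) + 4 / (z ^+ 2 * a) by rewrite -mulrDl; congr (_ / _); lra.
by lra.
Qed.

Variables (E : {set {set V}}).
Hypothesis E_pairs : E \subset vertex_pairs V.
Hypothesis E_good : good E.
Local Notation C := (component E r).
Local Notation d := (gdist E r).
Local Notation nr := (nonroot E r).
Local Notation choices := (choices E r).
Local Notation deg := (deg E).
Local Notation wt := (wt R E r).
Local Notation level := (level E r).
Local Notation ball := (ball E r).

Let J : jumbled_graph E q e. Proof. by apply: jumbledP; case/and5P: E_good. Qed.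
Let Dg : concentrated_degrees E a l. Proof. by case/and5P: E_good. Qed.
Let ball0 : #|ball k|%:R <= 4 * a ^+ k. Proof. by case/and5P: E_good. Qed.
Let ball1 : #|ball k.+1|%:R <= 4 * a ^+ k.+1. Proof. by case/and5P: E_good. Qed.
Let lev1 : (1 - h) * a ^+ k.+1 <= #|level k.+1|%:R <= (1 + 2 * h) * a ^+ k.+1.
Proof. by case/and5P: E_good => _ _ _ _ /and4P[-> ->]. Qed.
Let lev2 : (1 - 3 * h) * (n * L) <= #|level k.+2|%:R <= (1 + 5 * h) * (n * L).
Proof. by case/and5P: E_good => _ _ _ _ /and4P[_ _ -> ->]. Qed.

Let ak_gt0 j : 0 < a ^+ j. Proof. by rewrite exprn_gt0. Qed.

Lemma level1_q : y / 2 <= #|level k.+1|%:R * q <= 2 * y.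
Proof.
have yE : y = a ^+ k.+1 * q by rewrite /y exprS {1}aE; field; rewrite gt_eqF.
rewrite yE; case/andP: lev1 => h1 h2; have := ak_gt0 k.+1 => A0.
have l1 : 2^-1 * a ^+ k.+1 <= #|level k.+1|%:R.
  apply: le_trans h1; rewrite ler_wpM2r ?(ltW A0) //; move: h_le; lra.
have l2 : #|level k.+1|%:R <= 2 * a ^+ k.+1.
  apply: (le_trans h2); rewrite ler_wpM2r ?(ltW A0) //; move: h_le; lra.
by have := ler_wpM2r (ltW q_gt0) l1; have := ler_wpM2r (ltW q_gt0) l2 => u1 u2;
  apply/andP; split; lra.
Qed.

Lemma level1_gt0 : (0 < #|level k.+1|)%N.
Proof.
rewrite -(ltr_nat R); case/andP: lev1 => h1 _; apply: lt_le_trans h1.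
by rewrite mulr_gt0 //; move: h_le; lra.
Qed.

Lemma level2_ge : n / (4 * l ^+ 2) <= #|level k.+2|%:R.
Proof.
case/andP: lev2 => h1 _; apply: le_trans h1.
have -> : n / (4 * l ^+ 2) = 2^-1 * (n * (2 * l ^+ 2)^-1) by field; rewrite !gt_eqF.
apply: ler_pM; rewrite ?mulr_ge0 ?invr_ge0 ?mulr_ge0 ?(ltW l_gt0) //.
  by move: h_le; lra.
by rewrite ler_wpM2l.
Qed.

Lemma level2_gt0 : (0 < #|level k.+2|)%N.
Proof.
by rewrite -(ltr_nat R); apply: lt_le_trans level2_ge; rewrite divr_gt0 // mulr_gt0.
Qed.

Lemma ball1_le : #|ball k.+1|%:R <= 4 * n / l ^+ 2.
Proof. by apply: (le_trans ball1); rewrite -mulrA ler_wpM2l. Qed.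

Lemma l2_ge16 : 16 <= l ^+ 2.
Proof.
have -> : 16 = 4 ^+ 2 :> R by rewrite !exprS expr0; lra.
by rewrite lerXn2r ?nnegrE // ltW.
Qed.

Lemma ball1_quarter : #|ball k.+1|%:R <= n / 4.
Proof.
apply: (le_trans ball1_le); rewrite ler_pdivrMr //.
by have := ler_wpM2l (ltW n_gt0) l2_ge16; lra.
Qed.

Lemma y_le : y <= a / l ^+ 2.
Proof.
have -> : y = a * (a ^+ k.+1 / n) by rewrite /y exprS; field; rewrite gt_eqF.
by rewrite ler_wpM2l ?(ltW a_gt0) // ler_pdivrMr // mulrC.
Qed.

(** ** Low temperature *)

Section Low.
Variables (b s T : R).
Hypothesis b_ge0 : 0 <= b.
Hypothesis s_gt0 : 0 < s.
Hypothesis s_le : s <= 2^-1.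
Hypothesis a_small : a * expR (- (l ^+ 2 / 160)) <= 1.
Hypothesis T_ge : \sum_(v | nr v && (k.+1 < d v)%N)
  expR (- ((1 - s) * wt v)) / #|choices d v|%:R <= T.

Let f v : R := expR (- ((1 - s) * wt v)) / #|choices d v|%:R.

Lemma f_le1 v : f v <= 1.
Proof.
rewrite /f ler_pdivrMr ?card_choices_gt0 // mul1r; apply: (@le_trans _ _ 1).
  rewrite -[leRHS]expR0 ler_expR oppr_le0 mulr_ge0 ?wt_ge0 //.
  by move: s_le; lra.
by rewrite ler1n choices_gdist_neq0.
Qed.

Lemma f_ge0 v : 0 <= f v.
Proof. by rewrite divr_ge0 ?expR_ge0. Qed.

(** On the level [D - 1] a vertex may have a single choice, but its weight is large because nearly
    the whole graph lies further out: the tilted exponent is at least [l ^ 2 / 160] for most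
    vertices, and this beats [a]. *)
Lemma sum_level1 : \sum_(v in level k.+1) expR (- ((1 - s) * wt v)) <=
  2 * n / a + 6 / e ^+ 2 * (n / a).
Proof.
set t := 8 * (#|level k.+1|%:R * q) + 4 * l.
case/andP: level1_q => m1 m2; set m := _ * q in m1 m2 t.
have t0 : 0 < t by rewrite /t; move: y_gt0 l_gt0; lra.
have Y := moderate_crude a_gt0 aE l_gt0 Dg ball1_quarter; rewrite -/m -/t in Y.
have Y0 : (0 < #|moderate E r k.+1 t|)%N.
  by rewrite -(ltr_nat R); apply: lt_le_trans Y; rewrite divr_gt0.
have s1 : 0 <= 1 - s by move: s_le; lra.
have M0 : 0 <= 3 / e * n by rewrite mulr_ge0 // divr_ge0 // ltW.
apply: (le_trans (sum_expR_wt a_gt0 aE e_gt0 J t0 s1 Y0)).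
set Yc := #|moderate E r k.+1 t|%:R in Y *.
have Yq : n / 2 * q <= Yc * q by rewrite ler_wpM2r // ltW.
have naq : n / 2 * q = a / 2 by rewrite aE mulrAC.
have a2 : 0 < a / 2 by rewrite divr_gt0.
apply: lerD; last first.
  apply: (@le_trans _ _ (3 / e * n / e / (a / 2))).
    rewrite ler_wpM2l ?divr_ge0 ?(ltW e_gt0) // lef_pV2 ?posrE -?naq //.
    by apply: lt_le_trans Yq; rewrite naq.
    by rewrite naq.
  by rewrite le_eqVlt; apply/orP; left; apply/eqP; field; rewrite !gt_eqF.
have t20 : t <= 20 * a / l ^+ 2.
  have yl := y_le; have : l <= a / l ^+ 2 by rewrite ler_pdivlMr // -exprS.
  have -> : 20 * a / l ^+ 2 = 20 * (a / l ^+ 2) by rewrite mulrA.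
  by rewrite /t; lra.
have ex : l ^+ 2 / 160 <= (1 - s) * ((1 - 2 * e) * (Yc * q) / t).
  have -> : l ^+ 2 / 160 = 2^-1 * (2^-1 * (a / 2) / (20 * a / l ^+ 2)).
    by field; rewrite !gt_eqF.
  have a40 : 0 < 20 * a / l ^+ 2 by rewrite divr_gt0 // mulr_gt0.
  apply: ler_pM => //; first by rewrite !mulr_ge0 ?invr_ge0 ?(ltW a_gt0) ?(ltW a40).
    by move: s_le; lra.
  apply: ler_pM; rewrite ?invr_ge0 ?(ltW a40) ?mulr_ge0 ?(ltW a_gt0) //.
    apply: ler_pM; rewrite ?mulr_ge0 ?(ltW a_gt0) -?naq //.
    by move: e_le; lra.
  by rewrite lef_pV2 ?posrE.
have lc : #|level k.+1|%:R <= 2 * n.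
  by apply: (@le_trans _ _ n); [rewrite ler_nat max_card | move: n_gt0; lra].
apply: (@le_trans _ _ (2 * n * expR (- (l ^+ 2 / 160)))).
  by apply: ler_pM; rewrite ?expR_ge0 // ler_expR lerN2.
rewrite ler_pdivlMr //.
have n2 : 0 <= 2 * n by rewrite mulr_ge0.
by have := ler_wpM2l n2 a_small; lra.
Qed.

(** A degree above [2 a] is at most [2 (deg - a) ^ 2 / a], so irregular degrees are charged to the
    variance and all others to [2 a]. Then the ball is paid for by its size, the level [D - 1] by
    its weights and the rest by [T]. *)
Lemma sum_bad_factor : \sum_(v | nr v) bad_factor E r b s v <=
  expR (1 + s - b) * (n * (2 * l + 12 + 12 / e ^+ 2) + 2 * a * T).
Proof.
have -> : \sum_(v | nr v) bad_factor E r b s v =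
    expR (1 + s - b) * \sum_(v | nr v) (deg v)%:R * f v.
  by rewrite mulr_sumr; apply: eq_bigr => v _; rewrite /bad_factor /f; ring.
rewrite ler_wpM2l ?expR_ge0 //.
apply: (@le_trans _ _ (\sum_(v | nr v) (2 * (((deg v)%:R - a) ^+ 2 / a) + 2 * a * f v))).
  apply: ler_sum => v _; set x := (deg v)%:R; have fl := f_le1 v; have fg := f_ge0 v.
  have x0 : 0 <= x by [].
  have s0 : 0 <= (x - a) ^+ 2 / a by rewrite divr_ge0 ?sqr_ge0 // ltW.
  have [xa|xa] := leP x (2 * a).
    by have := ler_wpM2r fg xa; lra.
  have : x <= 2 * ((x - a) ^+ 2 / a).
    rewrite mulrA ler_pdivlMr // expr2; nra.
  by have := ler_wpM2l x0 fl; have : 0 <= 2 * a * f v by [rewrite !mulr_ge0 // ltW]; lra.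
rewrite big_split /= -!mulr_sumr -mulr_suml.
have D2 : 2 * ((\sum_(v | nr v) ((deg v)%:R - a) ^+ 2) / a) <= 2 * (n * l).
  rewrite ler_wpM2l // ler_pdivrMr // mulrAC; apply: le_trans Dg.
  by rewrite [leLHS]big_mkcond; apply: ler_sum => v _; case: ifP => // _; apply: sqr_ge0.
have FS : \sum_(v | nr v) f v <= 4 * a ^+ k + (2 * n / a + 6 / e ^+ 2 * (n / a)) + T.
  rewrite (bigID (fun v => (k.+1 < d v)%N)) /= addrC; apply: lerD => //.
  rewrite (bigID (fun v => (d v <= k)%N)) /=; apply: lerD.
    apply: le_trans ball0; rewrite -sum1_card natr_sum big_mkcond [leRHS]big_mkcond.
    apply: ler_sum => v _; case: ifP => [/andP[/andP[nv _] dv]|_]; last by case: ifP.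
    by rewrite inE (nonrootC nv) dv f_le1.
  apply: le_trans sum_level1; rewrite big_mkcond [leRHS]big_mkcond.
  apply: ler_sum => v _; case: ifP => [/andP[/andP[nv]]|_]; last first.
    by case: ifP => // _; apply: expR_ge0.
  rewrite -!ltnNge => d1 d2; have dv : d v == k.+1 by rewrite eqn_leq -ltnS d1 d2.
  rewrite inE (nonrootC nv) dv /= /f ler_pdivrMr ?card_choices_gt0 // ler_peMr ?expR_ge0 //.
  by rewrite ler1n choices_gdist_neq0.
have ak4 : a * (4 * a ^+ k) <= 4 * n.
  rewrite mulrCA -exprS ler_wpM2l //; apply: (le_trans ak_le).
  by rewrite ler_pdivrMr // ler_peMr ?(ltW n_gt0) //; have := l2_ge16; lra.
have := ler_wpM2l (ltW a_gt0) FS.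
have -> : a * (4 * a ^+ k + (2 * n / a + 6 / e ^+ 2 * (n / a)) + T) =
   a * (4 * a ^+ k) + (2 * n + 6 / e ^+ 2 * n) + a * T.
  by field; rewrite !gt_eqF.
have -> : 12 / e ^+ 2 = 2 * (6 / e ^+ 2) by rewrite mulrA; congr (_ / _); lra.
set w := 6 / e ^+ 2; lra.
Qed.

Lemma W1_low_good (x : R) : 0 < x ->
  expR (1 + s - b) * (n * (2 * l + 12 + 12 / e ^+ 2) + 2 * a * T) <= s * x * n / 4 ->
  2 * expR (- (s * x * n / 4)) <= x / 2 ->
  W1 (hamming E r) (gibbs_inf R E r) (gibbs b E r) <= x * n.
Proof.
move=> x0 h1 h2; have t0 : 0 <= x * n / 2 by rewrite divr_ge0 // mulr_ge0 // ltW.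
apply: (le_trans (W1_low r E_pairs b_ge0 (ltW s_gt0) t0)).
set S := \sum_(v | _) _.
have hX : expR (S - s * (x * n / 2)) <= expR (- (s * x * n / 4)).
  by rewrite ler_expR; have := le_trans sum_bad_factor h1; rewrite -/S; lra.
have h20 : 0 <= 2 :> R by [].
by have := ler_wpM2l (ltW n_gt0) (le_trans (ler_wpM2l h20 hX) h2); lra.
Qed.

End Low.

Lemma inv_choices_tail1 : \sum_(v | nr v && (k.+1 < d v)%N) #|choices d v|%:R^-1 <=
  2 * (3 / e ^+ 2 + 2) * n / y.
Proof.
apply: (le_trans (inv_choices_tail a_gt0 aE e_gt0 e_le J level1_gt0)).
case/andP: level1_q => m1 _.
apply: (@le_trans _ _ ((3 / e * n / e + 2 * n) / (y / 2))).
  apply: ler_wpM2l; first by rewrite addr_ge0 // ?mulr_ge0 ?invr_ge0 ?(ltW e_gt0).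
  by rewrite lef_pV2 ?posrE ?divr_gt0 //; apply: lt_le_trans m1; rewrite divr_gt0.
by rewrite le_eqVlt; apply/orP; left; apply/eqP; field; rewrite !gt_eqF.
Qed.

Lemma level2_q : a / (4 * l ^+ 2) <= #|level k.+2|%:R * q.
Proof.
have := ler_wpM2r (ltW q_gt0) level2_ge; apply: le_trans.
by rewrite mulrAC -aE.
Qed.

Let level2_q_gt0 : 0 < #|level k.+2|%:R * q.
Proof. by apply: lt_le_trans level2_q; rewrite divr_gt0 // mulr_gt0. Qed.

Lemma inv_level2_q (x : R) : 0 <= x -> x / (#|level k.+2|%:R * q) <= x * (4 * l ^+ 2) / a.
Proof.
move=> x0; rewrite -mulrA ler_wpM2l // -[leRHS]invrK lef_pV2 ?posrE //.
  by rewrite invf_div; exact: level2_q.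
by rewrite invr_gt0 divr_gt0 // mulr_gt0.
Qed.

Lemma ball2_le : #|ball k.+2|%:R <= 4 * n / l ^+ 2 + (1 + 5 * h) * (n * L).
Proof.
case/andP: lev2 => _ h2; apply: (le_trans _ (lerD ball1_le h2)).
rewrite -natrD ler_nat; apply: leq_trans (leq_card_setU _ _); apply: subset_leq_card.
apply/fintype.subsetP => v; rewrite !inE => /andP[-> /=].
by rewrite leq_eqVlt orbC ltnS => /orP[->|->]; rewrite ?orbT.
Qed.

(* Needed when [kappa] is finite, where bounding [expR (- wt)] by [1] loses too much. *)
Lemma sharp_tail (s f : R) : 0 < s -> s <= 2^-1 -> 0 < f -> f <= 4^-1 ->
  4 * e <= f ^+ 2 -> 4 / l ^+ 2 + 2 * L <= e -> (l / 2 + 3) * (4 * l ^+ 2) <= e ^+ 2 * a ->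
  \sum_(v | nr v && (k.+1 < d v)%N) expR (- ((1 - s) * wt v)) / #|choices d v|%:R <=
  n * expR (- ((1 - s) * ((1 - 2 * e) * (1 - e - f) / ((1 + f) * (1 + 5 * h))) / L)) +
  6 / e ^+ 2 * (n / a) + (3 / e ^+ 2 + 2) * n * (4 * l ^+ 2) / a.
Proof.
move=> s0 s2 f0 f4 ef Le la; have e0 := e_gt0; have e4 := e_le.
set m := #|level k.+2|%:R * q; have m0 : 0 < m by exact: level2_q_gt0.
have bn : #|ball k.+2|%:R <= e * n.
  apply: (le_trans ball2_le).
  have : (1 + 5 * h) * (n * L) <= 2 * L * n.
    rewrite [n * L]mulrC mulrA ler_wpM2r // ler_wpM2r ?(ltW L_gt0) //.
    by move: h_le; lra.
  have := ler_wpM2r (ltW n_gt0) Le; rewrite mulrDl.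
  have -> : 4 / l ^+ 2 * n = 4 * n / l ^+ 2 by rewrite mulrAC.
  lra.
have mq : (l / 2 + 3) / e / m <= e.
  have x0 : 0 <= (l / 2 + 3) / e by rewrite divr_ge0 ?(ltW e0) // addr_ge0 // divr_ge0 // ltW.
  apply: (le_trans (inv_level2_q x0)); rewrite ler_pdivrMr //.
  by rewrite mulrAC ler_pdivrMr // mulrAC -expr2.
have Y := moderate_sharp a_gt0 aE e0 J Dg f0 level2_gt0 ef bn mq; rewrite -/m in Y.
set t := (1 + f) * m in Y *; have t0 : 0 < t by rewrite mulr_gt0 //; lra.
have ef2 : 2^-1 <= 1 - e - f by lra.
have Y2 : n / 2 <= #|moderate E r k.+2 t|%:R.
  by apply: le_trans Y; rewrite mulrC ler_wpM2r.
have Y0 : (0 < #|moderate E r k.+2 t|)%N.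
  by rewrite -(ltr_nat R); apply: lt_le_trans Y2; rewrite divr_gt0.
have s1 : 0 <= 1 - s by lra.
have W := sum_expR_wt a_gt0 aE e0 J t0 s1 Y0.
set Yc := #|moderate E r k.+2 t|%:R in Y Y2 W.
have Yq : a / 2 <= Yc * q.
  by have := ler_wpM2r (ltW q_gt0) Y2; rewrite mulrAC -aE.
have M1 : 3 / e * n / e / (Yc * q) <= 6 / e ^+ 2 * (n / a).
  apply: (@le_trans _ _ (3 / e * n / e / (a / 2))).
    apply: ler_wpM2l; first by rewrite !mulr_ge0 ?invr_ge0 ?(ltW e0).
    by rewrite lef_pV2 ?posrE ?divr_gt0 //; apply: lt_le_trans Yq; rewrite divr_gt0.
  by rewrite le_eqVlt; apply/orP; left; apply/eqP; field; rewrite !gt_eqF.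
have M2 : #|level k.+2|%:R * expR (- ((1 - s) * ((1 - 2 * e) * (Yc * q) / t))) <=
    n * expR (- ((1 - s) * ((1 - 2 * e) * (1 - e - f) / ((1 + f) * (1 + 5 * h))) / L)).
  apply: ler_pM; rewrite ?expR_ge0 ?ler_nat ?max_card // ler_expR lerN2 -[leLHS]mulrA.
  apply: ler_wpM2l => //; case/andP: lev2 => _ lv.
  have h10 : 0 < 1 + 5 * h by move: h_gt0; lra.
  have f10 : 0 < 1 + f by lra.
  have e20 : 0 < 1 - 2 * e by lra.
  have -> : (1 - 2 * e) * (1 - e - f) / ((1 + f) * (1 + 5 * h)) / L =
    (1 - 2 * e) * ((1 - e - f) * n * q / ((1 + f) * ((1 + 5 * h) * (n * L) * q))).
    by field; rewrite !gt_eqF.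
  rewrite -[leRHS]mulrA ler_wpM2l ?(ltW e20) //.
  have z0 : 0 < (1 - e - f) * n * q by rewrite !mulr_gt0 //; lra.
  have t1 : t <= (1 + f) * ((1 + 5 * h) * (n * L) * q).
    by rewrite /t ler_wpM2l ?(ltW f10) // /m ler_wpM2r // ltW.
  apply: ler_pM; rewrite ?(ltW z0) ?invr_ge0 ?(ltW (lt_le_trans t0 t1)) //.
    by rewrite ler_wpM2r // ltW.
  by rewrite lef_pV2 ?posrE // (lt_le_trans t0 t1).
rewrite (bigID (fun v => d v == k.+2)) /=; apply: lerD.
  apply: (@le_trans _ _ (\sum_(v in level k.+2) expR (- ((1 - s) * wt v)))); last first.
    by apply: (le_trans W); apply: lerD.
  rewrite big_mkcond [leRHS]big_mkcond; apply: ler_sum => v _.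
  case: ifP => [/andP[/andP[nv _] dv]|_]; last by case: ifP => // _; apply: expR_ge0.
  rewrite inE (nonrootC nv) dv /= ler_pdivrMr ?card_choices_gt0 // ler_peMr ?expR_ge0 //.
  by rewrite ler1n choices_gdist_neq0.
apply: (@le_trans _ _ (\sum_(v | nr v && (k.+2 < d v)%N) #|choices d v|%:R^-1)).
  rewrite big_mkcond [leRHS]big_mkcond; apply: ler_sum => v _.
  case: ifP => [/andP[/andP[nv d1] d2]|_]; last by case: ifP => // _; rewrite invr_ge0.
  rewrite nv ltn_neqAle eq_sym d2 d1 /= ler_piMl ?invr_ge0 //.
  by rewrite -[leRHS]expR0 ler_expR oppr_le0 mulr_ge0 ?wt_ge0.
apply: (le_trans (inv_choices_tail a_gt0 aE e0 e4 J level2_gt0)).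
have -> : 3 / e * n / e + 2 * n = (3 / e ^+ 2 + 2) * n by field; rewrite gt_eqF.
by apply: inv_level2_q; rewrite mulr_ge0 // addr_ge0 // divr_ge0 // ltW // exprn_gt0.
Qed.


(** ** High temperature *)

Section High.
Variables (b x c g tau : R).
Hypothesis b_ge0 : 0 <= b.
Hypothesis x_gt0 : 0 < x.
Hypothesis c_gt0 : 0 < c.
Hypothesis g_gt0 : 0 < g.
Hypothesis tau_gt0 : 0 < tau.
Hypothesis a_le : a <= expR (2 * l).
Hypothesis n_ge : 16 * l ^+ 2 <= n.
Hypothesis a_ge128 : 128 * l ^+ 2 <= a.
Hypothesis poor_small : 192 * l ^+ 2 <= x * e ^+ 2 * a.
Hypothesis poor_small' : 48 * l ^+ 3 <= e ^+ 2 * a.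
Hypothesis rich_large : 128 * l ^+ 2 <= expR (b * x / 4).
Hypothesis exp_small : expR (7 * n - b * x * n / 4) <= x.
Hypothesis K_ge2 : 2 * l <= c * n.
Hypothesis K_large : 4 * l * (1 + g) <= g * c * a.
Hypothesis top_small : expR b * (3 * y + l / 2) <=
  x * (c ^+ 2 * a / (16 * l ^+ 2) * expR (- ((1 + g) * l / c)) - 15 / (4 * e)).

Let K : R := c * n / l.
Local Notation W1b := (W1 (hamming E r) (gibbs_inf R E r) (gibbs b E r)).

(** [muE_top] at [K = c n / l], where [n / K] becomes [l / c]. The edges between the levels [D - 1]
    and [D] number at most [n (3 y + l / 2)], which turns the comparison into [top_small]. *)
Lemma prob_top : muE E r b (fun p => (K <= #|top E r k.+2 p|%:R)%R%:R) <= x.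
Proof.
have H := @jumbled_half _ _ _ r _ _ _ a_gt0 aE e_gt0 e_le J.
have K2 : 2 <= K by rewrite /K ler_pdivlMr.
have Kg : (1 + g) / g <= K * q / 4.
  have -> : K * q / 4 = c * a / (4 * l) by rewrite /K aE; field; rewrite gt_eqF.
  rewrite ler_pdivrMr //; have -> : c * a / (4 * l) * g = g * c * a / (4 * l) by ring.
  by rewrite ler_pdivlMr ?mulr_gt0 //; move: K_large; lra.
have := muE_top r b (ltn0Sn k.+1) q_gt0 H g_gt0 K2 Kg; set P := muE _ _ _ _ => /= top1.
have nn := n_gt0.
have B := sum_nb_level r a_gt0 aE Dg k.+1.
have [_ m2] := andP level1_q.
have eb := expR_gt0 b.
have B0 : 0 < expR b * (3 * y + l / 2).
  by apply: mulr_gt0 => //; apply: addr_gt0; [apply: mulr_gt0 | apply: divr_gt0].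
have -> : x = x * (n * (c ^+ 2 * a / (16 * l ^+ 2) * expR (- ((1 + g) * l / c)) - 15 / (4 * e))) /
   (n * (c ^+ 2 * a / (16 * l ^+ 2) * expR (- ((1 + g) * l / c)) - 15 / (4 * e))).
  rewrite mulfK // mulf_neq0 ?(gt_eqF nn) //.
  apply/eqP => z0; move: top_small; by rewrite z0 mulr0 leNgt B0.
set Z := c ^+ 2 * a / (16 * l ^+ 2) * _ - _.
have Z0 : 0 < Z.
  by rewrite -(pmulr_rgt0 _ x_gt0); apply: lt_le_trans top_small.
rewrite ler_pdivlMr ?mulr_gt0 //.
have ZE : n * Z = K ^+ 2 * q / 16 * expR (- ((1 + g) * n / K)) - 5 / 4 * (3 / e * n).
  rewrite /Z /K aE; have -> : (1 + g) * n / (c * n / l) = (1 + g) * l / c.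
    by field; rewrite !gt_eqF.
  by field; rewrite !gt_eqF.
rewrite ZE; apply: (le_trans top1); rewrite -ZE mulrCA.
apply: (@le_trans _ _ (n * (expR b * (3 * y + l / 2)))); last by rewrite ler_wpM2l // ltW.
rewrite mulrCA ler_wpM2l ?expR_ge0 //; apply: (le_trans B); rewrite ler_wpM2l ?(ltW nn) //.
lra.
Qed.

Lemma expRM_pow (N : nat) : a ^+ N <= expR (2 * l * N%:R).
Proof.
rewrite [2 * l * _]mulrC expRM_natl; apply: lerXn2r; rewrite ?nnegrE ?expR_ge0 //.
exact: ltW.
Qed.

Let la : l <= a.
Proof.
apply: le_trans a_ge; rewrite exprS ler_peMr ?(ltW l_gt0) //.
by have := l2_ge16; lra.
Qed.

Let expR1_le : expR 1 <= a.
Proof.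
have : expR 1 <= 4 :> R.
  have h2 : expR 2^-1 <= 2 :> R.
    rewrite -[leLHS]invrK -[leRHS]invrK lef_pV2 ?posrE ?invr_gt0 ?expR_gt0 // -expRN.
    by have := expR_ge1Dx (- 2^-1 : R); lra.
  have -> : 1 = 2^-1 + 2^-1 :> R by lra.
  by rewrite expRD; have := ler_pM (expR_ge0 _) (expR_ge0 _) h2 h2; lra.
by move: a_ge64; lra.
Qed.

Let lln : 2 * l * (4 * n / l ^+ 2) <= 2 * n.
Proof.
have -> : 2 * l * (4 * n / l ^+ 2) = 8 * n / l by field; rewrite gt_eqF.
by rewrite ler_pdivrMr //; have := ler_wpM2l (ltW n_gt0) l_ge; lra.
Qed.

(** Resampling the ball costs at most [exp (4 n)], because it has at most [4 n / l ^ 2] vertices at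
    a price of about [l] each. The gain [b x n] is larger as [b] is of order [l]. *)
Lemma prob_late : muE E r b (fun p => (x * n <= #|late_children E r k.+1 p|%:R)%R%:R) <= x.
Proof.
apply: (le_trans (muE_late_children E r b_ge0 k.+1 _)).
apply: le_trans exp_small.
apply: (@le_trans _ _ (expR (- (b * (x * n))) * (a ^+ #|ball k.+1| * expR (2 * n)))).
  rewrite ler_wpM2l ?expR_ge0 //.
  apply: le_trans (prod_max_deg a_gt0 Dg _ expR1_le la).
  rewrite big_mkcond [leRHS]big_mkcond; apply: ler_prod => v _ /=.
  case: (v \in ball k.+1) => /=; last by rewrite ler01 lexx.
  by case: (v != r); rewrite ?le_max ?lexx ?ler01 ?orbT ?ler0n.
have -> : 7 * n - b * x * n / 4 = - (b * (x * n)) + (5 * n + 2 * n + 3 / 4 * (b * (x * n))) by field.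
rewrite expRD ler_wpM2l ?expR_ge0 //.
apply: (@le_trans _ _ (expR (2 * n + 2 * n))).
  rewrite expRD ler_wpM2r ?expR_ge0 //; apply: (le_trans (expRM_pow _)); rewrite ler_expR.
  apply: le_trans lln; rewrite ler_wpM2l ?mulr_ge0 ?(ltW l_gt0) //; exact: ball1_le.
rewrite ler_expR; have : 0 <= b * (x * n) by rewrite !mulr_ge0 // ltW.
by have := n_gt0; lra.
Qed.

(** [S0] is cut down to about [n / l ^ 2] vertices of the level [D], so that resampling it at full
    cost takes only a factor [exp n]. It is still large enough for all but few vertices to have [k0]
    neighbours in it, with [a / k0 <= 128 l ^ 2]: a rich vertex then pays less than a small fraction
    of [b x]. *)
Lemma prob_deep :
  muE E r b (fun p => (x * n + #|top E r k.+2 p|%:R <= #|deep E r k.+2 p|%:R)%R%:R) <= x.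
Proof.
have nn := n_gt0; have e20 : 0 < e ^+ 2 by rewrite exprn_gt0.
have [s1 s2] : n / (16 * l ^+ 2) <= (Num.truncn (n / (8 * l ^+ 2)))%:R /\
    (Num.truncn (n / (8 * l ^+ 2)))%:R <= n / (8 * l ^+ 2).
  have z2 : 2 <= n / (8 * l ^+ 2) by rewrite ler_pdivlMr ?mulr_gt0 //; move: n_ge; lra.
  have /andP[t1 t2] := truncn_bounds z2; split=> //; apply: le_trans t1.
  by rewrite le_eqVlt; apply/orP; left; apply/eqP; field; rewrite gt_eqF.
set s0 := Num.truncn _ in s1 s2.
have s0L : (s0 <= #|level k.+2|)%N.
  rewrite -(ler_nat R); apply: (le_trans s2); apply: le_trans level2_ge.
  by rewrite ler_wpM2l ?(ltW nn) // lef_pV2 ?posrE ?mulr_gt0 // ler_wpM2r ?(ltW l2_gt0) //; lra.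
have [S0 S0L cS0] := subset_of_card s0L.
have sq : a / (16 * l ^+ 2) <= s0%:R * q.
  by have := ler_wpM2r (ltW q_gt0) s1; rewrite mulrAC -aE.
have sq8 : 8 <= s0%:R * q.
  by apply: le_trans sq; rewrite ler_pdivlMr ?mulr_gt0 //; move: a_ge128; lra.
have [k1 k2] : a / (128 * l ^+ 2) <= (Num.truncn (s0%:R * q / 4))%:R /\
    (Num.truncn (s0%:R * q / 4))%:R <= s0%:R * q / 4.
  have z2 : 2 <= s0%:R * q / 4 by lra.
  have /andP[t1 t2] := truncn_bounds z2; split=> //; apply: le_trans t1.
  have -> : a / (128 * l ^+ 2) = a / (16 * l ^+ 2) / 4 / 2 by field; rewrite gt_eqF.
  lra.
set k0 := Num.truncn _ in k1 k2.
have k0R : 0 < k0%:R :> R by apply: lt_le_trans k1; rewrite divr_gt0 // mulr_gt0.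
have k0p : (0 < k0)%N by rewrite -(ltr_nat R).
have s0p : (0 < #|S0|)%N.
  by rewrite cS0 -(ltr_nat R); apply: lt_le_trans s1; rewrite divr_gt0 // mulr_gt0.
have sqp : 0 < s0%:R * q by lra.
have pr : #|poor E r k.+2 S0 k0|%:R <= 48 * l ^+ 2 * n / (e ^+ 2 * a).
  apply: (@le_trans _ _ (3 / e * n / e / (#|S0|%:R * q))).
    apply: (few_poor r a_gt0 aE e_gt0 J s0p).
      by rewrite disjoint_subset; apply/fintype.subsetP => z; rewrite !inE => /and4P[].
    move=> z; rewrite inE => /and4P[_ _ _ nz]; rewrite cS0.
    apply: (@le_trans _ _ k0%:R); first by rewrite ler_nat ltnW.
    by apply: (le_trans k2); rewrite mulrC ler_wpM2r ?(ltW sqp) //; move: e_le; lra.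
  rewrite cS0; apply: (@le_trans _ _ (3 / e * n / e / (a / (16 * l ^+ 2)))).
    apply: ler_wpM2l; first by rewrite !mulr_ge0 ?invr_ge0 ?(ltW e_gt0).
    by rewrite lef_pV2 ?posrE // divr_gt0 // mulr_gt0.
  by rewrite le_eqVlt; apply/orP; left; apply/eqP; field; rewrite !gt_eqF.
set po := #|poor E r k.+2 S0 k0|%:R in pr.
have pr1 : 2 * po <= x * n / 2.
  have : po <= x * n / 4.
    apply: (le_trans pr); rewrite ler_pdivrMr ?mulr_gt0 //.
    by have := ler_wpM2r (ltW nn) poor_small; lra.
  lra.
have pr2 : po <= n / l.
  apply: (le_trans pr); rewrite ler_pdivrMr ?mulr_gt0 //.
  have -> : n / l * (e ^+ 2 * a) = e ^+ 2 * a * n / l by ring.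
  rewrite ler_pdivlMr //; have := ler_wpM2r (ltW nn) poor_small'; rewrite exprS; lra.
apply: (@le_trans _ _ (muE E r b (fun p => (x * n / 2 + 2 * po + #|top E r k.+2 p|%:R <=
    #|deep E r k.+2 p|%:R)%R%:R))).
  apply: muE_le => p _; rewrite ler_nat; case: (leP _ #|deep E r k.+2 p|%:R) => // h1.
  by rewrite (le_trans _ h1) //; lra.
apply: (le_trans (muE_deep b_ge0 (ltn0Sn k.+1) _ S0L k0p)).
apply: le_trans exp_small.
set ri := #|rich E r k.+2 S0 k0|.
have cC : (#|C| <= #|ball k.+1| + s0 + #|poor E r k.+2 S0 k0| + ri)%N.
  rewrite -cS0; apply: (@leq_trans #|ball k.+1 :|: S0 :|: poor E r k.+2 S0 k0 :|: rich E r k.+2 S0 k0|%SET).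
    apply: subset_leq_card; apply/fintype.subsetP => v vC.
    rewrite !inE in vC *; rewrite vC /=.
    by case: (ltnP k.+1 (d v)) => //= _; case: (v \in S0) => //=; case: leqP; rewrite ?orbT.
  by rewrite (leq_trans (leq_card_setU _ _)) // leq_add2r (leq_trans (leq_card_setU _ _)) //
    leq_add2r leq_card_setU.
have a1 : 1 <= a by move: a_ge64; lra.
have pC : \prod_(v in C) Num.max 1 (deg v)%:R <= expR (5 * n) * a ^+ ri * expR (2 * n).
  apply: (le_trans (prod_max_deg a_gt0 Dg C expR1_le la)); rewrite ler_wpM2r ?expR_ge0 //.
  apply: (le_trans (ler_weXn2l a1 cC)); rewrite exprD ler_wpM2r ?exprn_ge0 ?(ltW a_gt0) //.
  apply: (le_trans (expRM_pow _)); rewrite ler_expR !natrD -/po !mulrDr.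
  have t1 : 2 * l * #|ball k.+1|%:R <= 2 * n.
    by apply: le_trans lln; rewrite ler_wpM2l ?mulr_ge0 ?(ltW l_gt0) //; exact: ball1_le.
  have t2 : 2 * l * s0%:R <= n.
    apply: (@le_trans _ _ (2 * l * (n / (8 * l ^+ 2)))); first by rewrite ler_wpM2l ?mulr_ge0 ?(ltW l_gt0).
    have -> : 2 * l * (n / (8 * l ^+ 2)) = n / (4 * l) by field; rewrite gt_eqF.
    by rewrite ler_pdivrMr ?mulr_gt0 //; have := ler_wpM2l (ltW nn) l_ge; lra.
  have t3 : 2 * l * po <= 2 * n.
    apply: (@le_trans _ _ (2 * l * (n / l))); first by rewrite ler_wpM2l ?mulr_ge0 ?(ltW l_gt0).
    by rewrite le_eqVlt; apply/orP; left; apply/eqP; field; rewrite gt_eqF.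
  lra.
have ak : a <= k0%:R * (128 * l ^+ 2) by rewrite -ler_pdivrMr // mulr_gt0.
have ri_n : ri%:R <= n by rewrite ler_nat max_card.
have rr : a ^+ ri / k0%:R ^+ ri <= expR (b * x * n / 4).
  rewrite -expr_div_n; apply: (@le_trans _ _ (expR (b * x / 4) ^+ ri)).
    rewrite lerXn2r ?nnegrE ?expR_ge0 ?divr_ge0 ?(ltW a_gt0) ?(ltW k0R) //.
    by apply: le_trans rich_large; rewrite ler_pdivrMr // mulrC.
  rewrite -expRM_natl ler_expR.
  have bx : 0 <= b * x / 4 by rewrite !mulr_ge0 // ltW.
  by have -> : b * x * n / 4 = n * (b * x / 4) by [ring]; rewrite ler_wpM2r.
apply: (@le_trans _ _ (expR (- (b * (x * n / 2))) * (expR (5 * n) * expR (2 * n) * expR (b * x * n / 4)))).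
  rewrite -mulrA ler_wpM2l ?expR_ge0 //.
  apply: (@le_trans _ _ (expR (5 * n) * a ^+ ri * expR (2 * n) / k0%:R ^+ ri)).
    by rewrite ler_wpM2r // invr_ge0 exprn_ge0.
  have mulE (u v w z : R) : u * v * w * z = u * w * (v * z) by ring.
  rewrite mulE.
  by rewrite ler_wpM2l ?mulr_ge0 ?expR_ge0.
by rewrite -!expRD le_eqVlt; apply/orP; left; apply/eqP; congr expR; field.
Qed.

Let top_le p : #|top E r k.+2 p|%:R <= K + n * (K <= #|top E r k.+2 p|%:R)%R%:R.
Proof.
case: (leP K) => [_|/ltW]; rewrite ?mulr0 ?addr0 // mulr1.
apply: (@le_trans _ _ n); first by rewrite ler_nat max_card.
by rewrite lerDr /K divr_ge0 ?mulr_ge0 ?ltW.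
Qed.

Lemma W1_high_good_level : (1 - 3 * h) * (n * L) - K - 3 * x * n <= W1b.
Proof.
apply: le_trans (W1_high_level r b E_pairs (ltn0Sn k.+1)); rewrite /=.
have nn := ltW n_gt0.
apply: (@le_trans _ _ (muE E r b (fun p => ((#|level k.+2|%:R - K - x * n) +
   ((- n) * (K <= #|top E r k.+2 p|%:R)%R%:R +
    (- n) * (x * n <= #|late_children E r k.+1 p|%:R)%R%:R))))); last first.
  apply: muE_le => p _; have := top_le p.
  have : #|late_children E r k.+1 p|%:R <= x * n + n * (x * n <= #|late_children E r k.+1 p|%:R)%R%:R.
    case: (leP (x * n)) => [_|/ltW]; rewrite ?mulr0 ?addr0 // mulr1.
    apply: (@le_trans _ _ n); first by rewrite ler_nat max_card.
    by rewrite lerDr mulr_ge0 // ltW.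
  lra.
rewrite muED muE_cst muED !muEZ; have [+ _] := andP lev2.
by have := ler_wpM2l nn prob_top; have := ler_wpM2l nn prob_late; lra.
Qed.

(** The main term is [n (1 - L - c / (l L))], where [l L] is [kappa_n] in the application: the last
    part is the weight of a set of [K] vertices in a level of size [n L]. *)
Lemma W1_high_good_next :
  n - 4 * n / l ^+ 2 - (1 + 5 * h) * (n * L) - 12 * l ^+ 2 / (e ^+ 2 * a) * n
  - (1 + e / 2) / (1 - 2 * e) * (c / ((1 - 3 * h) * (l * L))) * n
  - 4 * l ^+ 2 * (l / e + 3 / e ^+ 2) / a * n
  - (tau / 2 + 1) * K - 4 * x * n - n / (2 * tau) <= W1b.
Proof.
have nn := n_gt0; have e0 := e_gt0; have e4 := e_le; have K0 : 0 <= K.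
  by rewrite /K divr_ge0 ?mulr_ge0 ?ltW.
have h3 : 0 < 1 - 3 * h by move: h_le; lra.
have m0 : 0 < #|level k.+2|%:R :> R by rewrite ltr0n level2_gt0.
pose W : R := (1 + e / 2) / (1 - 2 * e) * (c / ((1 - 3 * h) * (l * L))) * n
  + 4 * l ^+ 2 * (l / e + 3 / e ^+ 2) / a * n.
have e12 : 0 < 1 - 2 * e by lra.
have WP (S : {set V}) : S \subset level k.+2 -> #|S|%:R <= K -> \sum_(u in S) wt u <= W.
  move=> SL SK; apply: (le_trans (sum_wt_le a_gt0 aE e0 e4 J Dg level2_gt0 SL SK)).
  have -> : ((K * a * (1 + e / 2) + n * l / (2 * e)) / (1 - 2 * e) + 3 / e * n / e) / (#|level k.+2|%:R * q) =
     (1 + e / 2) / (1 - 2 * e) * (K * n / #|level k.+2|%:R) +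
     (l / (2 * e * (1 - 2 * e)) + 3 / e ^+ 2) * n / (#|level k.+2|%:R * q).
    by rewrite aE; field; rewrite !gt_eqF.
  apply: lerD.
    rewrite -[leRHS]mulrA ler_wpM2l ?divr_ge0 ?(ltW e12) //; first by lra.
    have [lv _] := andP lev2.
    apply: (@le_trans _ _ (K * n / ((1 - 3 * h) * (n * L)))).
      apply: ler_wpM2l; first by rewrite mulr_ge0 // ltW.
      by rewrite lef_pV2 ?posrE // !mulr_gt0.
    by rewrite /K le_eqVlt; apply/orP; left; apply/eqP; field; rewrite !gt_eqF.
  have lz : l / (2 * e * (1 - 2 * e)) <= l / e.
    rewrite ler_wpM2l ?(ltW l_gt0) // lef_pV2 ?posrE ?mulr_gt0 //.
    have : 0 <= e * (1 - 4 * e) by rewrite mulr_ge0 ?(ltW e0) //; lra.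
    lra.
  have l0 : 0 <= l / (2 * e * (1 - 2 * e)) by rewrite divr_ge0 ?(ltW l_gt0) // !mulr_ge0 ?(ltW e0) ?(ltW e12).
  have e3 : 0 <= 3 / e ^+ 2 by rewrite divr_ge0 // ltW // exprn_gt0.
  apply: (@le_trans _ _ ((l / (2 * e * (1 - 2 * e)) + 3 / e ^+ 2) * n * (4 * l ^+ 2) / a)).
    by apply: inv_level2_q; rewrite mulr_ge0 ?(ltW nn) // addr_ge0.
  have -> : 4 * l ^+ 2 * (l / e + 3 / e ^+ 2) / a * n =
     (l / e + 3 / e ^+ 2) * n * (4 * l ^+ 2) / a by ring.
  rewrite ler_wpM2r ?invr_ge0 ?(ltW a_gt0) // ler_wpM2r ?mulr_ge0 ?(ltW l_gt0) //.
  by rewrite ler_wpM2r ?(ltW nn) // lerD2r.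
have W0 : 0 <= W.
  by have := WP finset.set0; rewrite big_set0 cards0; apply; rewrite ?finset.sub0set.
have := @W1_high_next R V E r b E_pairs k.+2 K W tau tau_gt0 K0 WP W0; apply: le_trans.
have lv3 : n - 4 * n / l ^+ 2 - (1 + 5 * h) * (n * L) - 12 * l ^+ 2 / (e ^+ 2 * a) * n <= #|level k.+3|%:R.
  apply: le_trans (card_next_level a_gt0 aE e0 e4 J level2_gt0).
  have M0 : 0 <= 3 / e * n / e by rewrite !mulr_ge0 ?invr_ge0 ?(ltW e0) ?(ltW nn).
  have := inv_level2_q M0; have := ball2_le.
  have -> : 3 / e * n / e * (4 * l ^+ 2) / a = 12 * l ^+ 2 / (e ^+ 2 * a) * n.
    by field; rewrite !gt_eqF.
  lra.
have mu : #|level k.+3|%:R - W - tau * K / 2 - K - 4 * x * n <=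
  muE E r b (fun p => #|level k.+3|%:R - W - tau * K / 2 - #|deep E r k.+2 p|%:R - n * (K < #|top E r k.+2 p|%:R)%R%:R).
  apply: (@le_trans _ _ (muE E r b (fun p => (#|level k.+3|%:R - W - tau * K / 2 - K - x * n) +
   ((- (2 * n)) * (K <= #|top E r k.+2 p|%:R)%R%:R +
    (- n) * (x * n + #|top E r k.+2 p|%:R <= #|deep E r k.+2 p|%:R)%R%:R)))); last first.
    apply: muE_le => p _; have tp := top_le p.
    have dp : #|deep E r k.+2 p|%:R <= x * n + #|top E r k.+2 p|%:R +
       n * (x * n + #|top E r k.+2 p|%:R <= #|deep E r k.+2 p|%:R)%R%:R.
      case: (leP (x * n + _)) => [_|/ltW]; rewrite ?mulr0 ?addr0 // mulr1.
      apply: (@le_trans _ _ n); first by rewrite ler_nat max_card.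
      by rewrite lerDr addr_ge0 // mulr_ge0 // ltW.
    have kt : n * (K < #|top E r k.+2 p|%:R)%R%:R <= n * (K <= #|top E r k.+2 p|%:R)%R%:R.
      by rewrite ler_wpM2l ?(ltW nn) // ler_nat; case: (ltP K) => // /ltW ->.
    lra.
  rewrite muED muE_cst muED !muEZ.
  by have := ler_wpM2l (ltW nn) prob_top; have := ler_wpM2l (ltW nn) prob_deep; lra.
by move: mu lv3; rewrite /W; set mm := muE _ _ _ _; lra.
Qed.

End High.

End GoodGraph.

Local Open Scope classical_set_scope.
Local Open Scope ring_scope.

(** * Asymptotics *)

Lemma er_probE (R : realType) (n : nat) (q : R) (A : pred (graph n)) :
  er_prob q A = erE q (fun E => (A E)%:R).
Proof.
pose V := vertex n; pose phi (E : {set {set V}}) : {ffun {set V} -> bool} := [ffun e => e \in E].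
have bij : bijective phi.
  exists (@graph_of V) => [E|f]; first by apply/setP => e; rewrite inE ffunE.
  by apply/ffunP => e; rewrite ffunE inE.
rewrite /erE /pE (reindex phi) /=; last exact: onW_bij.
rewrite /er_prob big_mkcond /=; apply: eq_bigr => E _.
have -> : graph_of (phi E) = E by apply/setP => e; rewrite inE ffunE.
rewrite /pweight powersetE; have [EP|] /= := boolP (E \subset _).
  have -> : \prod_e edge_law q e (phi E e) =
    \prod_(e in vertex_pairs V) (if e \in E then q else 1 - q).
    rewrite [RHS]big_mkcond; apply: eq_bigr => e _; rewrite /edge_law ffunE.
    by have [//|neP] := boolP (e \in _); rewrite (contraNN (fintype.subsetP EP e) neP).
  by case: ifP => _; rewrite ?mulr1 ?mulr0.
move=> /fintype.subsetPn[e eE neP]; rewrite (bigD1 e) //= /edge_law ffunE (negbTE neP) eE.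
by rewrite !mul0r.
Qed.

Lemma card_vertex n : (0 < n)%N -> #|vertex n| = n.
Proof. by case: n => // n _; rewrite card_ord. Qed.

(** The least integer exists, so the default [0] of [xget] does not matter. As [A < X] the exponent
    is at least two, which allows the form [k.+2]; negative exponents give powers at most one. *)
Lemma least_int_power (R : realType) (A X : R) : 2 <= A -> A < X ->
  exists k : nat, [/\ xget 0 [set d : int | X <= A ^ d /\
      forall d' : int, X <= A ^ d' -> d <= d'] = k.+2%:Z,
    A ^+ k.+1 <= X & X <= A ^+ k.+2].
Proof.
move=> A2 AX; have A1 : 1 <= A by lra.
have ex : exists m, X <= A ^+ m.
  exists (Num.truncn X).+1; have X0 : 0 <= X by lra.
  have /andP[_ /ltW tX] := Num.Theory.truncn_itv X0; apply: (le_trans tX).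
  apply: (@le_trans _ _ (2 ^+ (Num.truncn X).+1)).
    by rewrite -natrX ler_nat ltnW // ltn_expl.
  by rewrite lerXn2r ?nnegrE //; lra.
case: (ex_minnP ex) => m Xm mmin.
have m2 : (2 <= m)%N.
  by case: m Xm {mmin} => [|[|//]]; rewrite ?expr0 ?expr1; lra.
case: m m2 Xm mmin => [|[|k]] // _ Xm mmin; exists k; split => //; last first.
  by have [//|/ltW/mmin] := leP (A ^+ k.+1) X; rewrite ltnn.
have least (d : int) : X <= A ^ d -> k.+2%:Z <= d.
  case: d => m; first by move=> /mmin.
  rewrite NegzE -exprnN => XA; exfalso.
  have : (A ^+ m.+1)^-1 <= 1 by rewrite invf_le1 ?exprn_gt0 ?exprn_ege1 //; lra.
  by move: XA; lra.
case: xgetP => [d -> [Xd dmin]|/(_ k.+2%:Z)]; last by case.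
by apply/eqP; rewrite eq_le (least _ Xd) andbT; apply: dmin.
Qed.

Lemma liminf_bound (R : realType) (u : nat -> R) : (0 < limn_einf (fun n => (u n)%:E))%E ->
  exists2 c, 0 < c & \forall n \near \oo, c <= u n.
Proof.
rewrite /limn_einf oppe_gt0 => /ereal_inf_lt[_ [V FV <-]] s0.
have [t t0 st] : exists2 t : R, t < 0 & (ereal_sup [set (\- (fun n => (u n)%:E))%E x | x in V] <= t%:E)%E.
  (* The supremum may be [-oo] as an extended real, in which case any negative bound will do. *)
  case: (ereal_sup _) s0 => [t t0|//|_]; first by exists t; rewrite // -lte_fin.
  by exists (-1); rewrite ?leNye //; lra.
exists (- t); first by rewrite oppr_gt0.
apply: filterS FV => n Vn; have : [set (\- (fun n => (u n)%:E))%E x | x in V] (- (u n)%:E)%E by exists n.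
by move=> /ereal_sup_ubound/le_trans/(_ st); rewrite /= lee_fin lerNl.
Qed.

Lemma limsup_bound (R : realType) (u : nat -> R) : (limn_esup (fun n => (u n)%:E) < +oo)%E ->
  exists c, \forall n \near \oo, u n <= c.
Proof.
move=> /ereal_inf_lt[_ [V FV <-]] s0.
have [t st] : exists t : R, (ereal_sup [set (u x)%:E | x in V] <= t%:E)%E.
  by case: (ereal_sup _) s0 => [t t0|//|_]; [exists t | exists 0; rewrite leNye].
exists t; apply: filterS FV => n Vn; have : [set (u x)%:E | x in V] (u n)%:E by exists n.
by move=> /ereal_sup_ubound/le_trans/(_ st); rewrite lee_fin.
Qed.

Lemma steep_bound (R : realType) (l E c z : R) : 4 <= l -> 1 <= E -> 0 <= c -> z <= c * E ->
  2 * l + 204 + 200 * z <= (206 + 200 * c) * l * E.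
Proof.
move=> l4 E1 c0 zc; have l0 : 0 <= l by lra.
have t1 : l <= l * E by rewrite ler_peMr.
have t2 : c * E <= c * E * l by rewrite ler_peMr ?mulr_ge0 //; lra.
lra.
Qed.

Section Scale.
Variables (R : realType) (alpha : nat -> R) (al0 al1 : R).
Hypothesis al0_gt0 : 0 < al0.
Hypothesis alpha_bounds : \forall n \near \oo, al0 <= alpha n <= al1.
Local Notation l := (loglog R).
Local Notation q := (q_ alpha).
Definition mean_degree n : R := n%:R * q n.
Local Notation a := mean_degree.

Lemma near_loglog (c : R) : \forall n \near \oo, c <= l n.
Proof.
near=> n; have hn : expR (expR c) <= n%:R by near: n; apply: nbhs_infty_ger.
have n0 : 0 < n%:R :> R by apply: lt_le_trans hn; apply: expR_gt0.
have ec : expR c <= ln n%:R by rewrite -[leLHS]expRK ler_ln ?posrE ?expR_gt0.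
rewrite -[leLHS]expRK /loglog ler_ln ?posrE ?expR_gt0 //.
by apply: lt_le_trans ec; apply: expR_gt0.
Unshelve. all: by end_near. Qed.

(** Exponentials in [l] beat powers of [l]. With [expR (l n) = ln n] this settles every error term
    below. *)
Lemma near_growth (A d : R) (k : nat) : 0 < d ->
  \forall n \near \oo, A * l n ^+ k <= expR (d * l n).
Proof.
move=> d0; near=> n; have l0 : 0 <= l n by near: n; apply: near_loglog.
pose C := (d / k.+1%:R) ^+ k.+1; have C0 : 0 < C by rewrite exprn_gt0 // divr_gt0.
have lA : `|A| / C <= l n by near: n; apply: near_loglog.
apply: (@le_trans _ _ (`|A| * l n ^+ k)).
  by rewrite ler_wpM2r ?exprn_ge0 // ler_norm.
have -> : d * l n = k.+1%:R * (d / k.+1%:R * l n).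
  by field; rewrite addrC natr1 pnatr_eq0.
rewrite expRM_natl; apply: (@le_trans _ _ ((d / k.+1%:R * l n) ^+ k.+1)); last first.
  rewrite lerXn2r ?nnegrE ?expR_ge0 ?mulr_ge0 ?invr_ge0 ?(ltW d0) //.
  by apply: le_trans (expR_ge1Dx _); rewrite lerDr.
rewrite exprMn -/C exprS mulrA ler_wpM2r ?exprn_ge0 //.
by rewrite -ler_pdivrMl // mulrC.
Unshelve. all: by end_near. Qed.

(** The deterministic facts that hold for all large [n]; [k] varies with [n], so later estimates are
    stated for every [k] with this property. *)
Definition scaled n k : Prop :=
  [/\ #|vertex n|%:R = n%:R :> R, n%:R = expR (expR (l n)), 4 <= l n,
      al0 * expR (l n) <= a n <= al1 * expR (l n) &
  [/\ l n ^+ 3 <= a n, a n ^+ k.+1 <= n%:R / l n ^+ 2,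
      (2 * l n ^+ 2)^-1 <= last_fraction (vertex n) k (a n),
      last_mean (vertex n) k (a n) = expR (Delta_ alpha n * ln (a n)) &
      last_fraction (vertex n) k (a n) = 1 - lambda_ alpha n]].

Lemma near_scaled : \forall n \near \oo, exists k, scaled n k.
Proof.
near=> n.
have l4 : 4 <= l n by near: n; apply: near_loglog.
have n1 : 2 <= n%:R :> R by near: n; apply: nbhs_infty_ger.
have n0 : 0 < n%:R :> R by lra.
have lnn : 0 < ln n%:R :> R by rewrite ln_gt0 //; lra.
have eln : ln n%:R = expR (l n) by rewrite /loglog lnK ?posrE.
have nE : n%:R = expR (expR (l n)) by rewrite -eln lnK ?posrE.
have aE : a n = alpha n * expR (l n).
  by rewrite /a /q_ eln mulrC divfK // gt_eqF.
have /andP[b0 b1] : al0 <= alpha n <= al1 by near: n.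
have el := expR_gt0 (l n).
have ab : al0 * expR (l n) <= a n <= al1 * expR (l n).
  by rewrite aE; apply/andP; split; rewrite ler_wpM2r // ltW.
have g3 : al0^-1 * l n ^+ 3 <= expR (1 * l n) by near: n; apply: near_growth.
have g2 : (al1 + 1) * l n ^+ 2 <= expR (1 * l n) by near: n; apply: near_growth.
have g1 : 2 * l n ^+ 1 <= expR (1 * l n) by near: n; apply: near_growth.
rewrite mul1r expr1 in g1; rewrite mul1r in g2; rewrite mul1r in g3.
have l2 : 0 < l n ^+ 2 by rewrite exprn_gt0 //; lra.
have nl : expR (l n) * expR (l n) <= n%:R.
  by rewrite nE -expRD ler_expR; lra.
have la : l n ^+ 3 <= a n.
  case/andP: ab => ab _; apply: le_trans ab.
  by rewrite -ler_pdivrMl // mulrC [X in X <= _]mulrC.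
have a64 : 64 <= a n.
  apply: le_trans la; have -> : 64 = 4 ^+ 3 :> R by rewrite !exprS expr0; lra.
  by rewrite lerXn2r ?nnegrE //; lra.
have anl : a n < n%:R / l n ^+ 2.
  rewrite ltr_pdivlMr //; case/andP: ab => _ ab.
  apply: (@le_lt_trans _ _ (al1 * expR (l n) * l n ^+ 2)); first by rewrite ler_wpM2r // ltW.
  apply: lt_le_trans nl.
  have -> : al1 * expR (l n) * l n ^+ 2 = expR (l n) * (al1 * l n ^+ 2) by ring.
  by rewrite ltr_pM2l //; lra.
have a2 : 2 <= a n by lra.
have [k [dk k1 k2]] := least_int_power a2 anl.
have cV : #|vertex n|%:R = n%:R :> R by rewrite card_vertex // -(ltr_nat R).
have yE : last_mean (vertex n) k (a n) = a n ^+ k.+2 / n%:R by rewrite /last_mean cV.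
have dE : d_star alpha n = k.+2%:Z by exact: dk.
exists k; split => //; split => //.
    rewrite /last_fraction; set y := last_mean _ _ _.
    have y1 : (l n ^+ 2)^-1 <= y.
      rewrite /y yE ler_pdivlMr // -[leLHS]mulrC; exact: k2.
    have y0 : 0 < y by apply: lt_le_trans y1; rewrite invr_gt0.
    have : expR (- y) <= (1 + y)^-1.
      by rewrite expRN lef_pV2 ?posrE ?expR_gt0 ?expR_ge1Dx //; lra.
    have : (2 * l n ^+ 2)^-1 <= 1 - (1 + y)^-1.
      have -> : 1 - (1 + y)^-1 = y / (1 + y) by field; lra.
      have -> : (2 * l n ^+ 2)^-1 = (l n ^+ 2)^-1 / 2 by field; rewrite gt_eqF //; lra.
      set u := (l n ^+ 2)^-1 in y1 *; have u1 : u <= 1.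
        rewrite /u invf_le1 // expr2; nra.
      have u0 : 0 < u by rewrite invr_gt0.
      rewrite ler_pdivlMr; last by lra.
      nra.
    lra.
  rewrite yE /Delta_ /ell_star -/(a n) dE.
  have lna : 0 < ln (a n) by rewrite ln_gt0 //; lra.
  have -> : (k.+2%:Z%:~R - ln n%:R / ln (a n)) * ln (a n) = k.+2%:R * ln (a n) - ln n%:R :> R.
    by rewrite mulrBl divfK // gt_eqF.
  by rewrite expRD expRN lnK ?posrE // expRM_natl lnK ?posrE //; lra.
by rewrite /last_fraction yE /lambda_ dE.
Unshelve. all: by end_near. Qed.

Lemma scaledP n k : scaled n k ->
  [/\ 0 < l n, 0 < a n, 0 < q n, expR (l n) <= n%:R &
      a n = #|vertex n|%:R * q n /\ a n ^+ k.+1 <= #|vertex n|%:R / l n ^+ 2].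
Proof.
move=> [cV nE l4 /andP[a0 _] [_ ak _ _ _]]; have l0 : 0 < l n by lra.
have ap : 0 < a n by apply: lt_le_trans a0; rewrite mulr_gt0 ?expR_gt0.
have n0 : 0 < n%:R :> R by rewrite nE expR_gt0.
split=> //; last by rewrite cV.
  by move: ap; rewrite pmulr_rgt0.
by rewrite nE; apply: le_trans (expR_ge1Dx _); rewrite lerDr.
Qed.

Lemma near_good (e h eps : R) : 0 < e -> e <= 4^-1 -> 0 < h -> h <= 8^-1 -> 0 < eps ->
  \forall n \near \oo, forall k, scaled n k ->
  erE (q n) (fun E => (~~ good (vertex1 n) k (q n) (a n) e h (l n) E)%:R) <= eps.
Proof.
move=> e0 e4 h0 h8 eps0; near=> n => k /[dup] /scaledP[l0 ap q0 nl [aE ak']] [cV nE l4 /andP[a0 a1] [la ak L0 _ _]].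
have el := expR_gt0 (l n); have l20 : 0 < l n ^+ 2 by rewrite exprn_gt0.
have n0 : 0 < n%:R :> R by rewrite nE expR_gt0.
have qE : q n = a n / n%:R by rewrite aE cV mulrAC mulfV ?mul1r // gt_eqF.
have g1 : 2 * l n ^+ 1 <= expR (1 * l n) by near: n; apply: near_growth.
rewrite mul1r expr1 in g1.
have n2l : expR (l n) * expR (l n) <= n%:R by rewrite nE -expRD ler_expR; lra.
have h1 : 0 < 1 + h by lra.
have qh : q n <= h / (1 + h).
  have g : al1 * (1 + h) / h * l n ^+ 0 <= expR (1 * l n) by near: n; apply: near_growth.
  rewrite mul1r expr0 mulr1 in g.
  rewrite qE ler_pdivrMr //; apply: (le_trans a1).
  apply: (@le_trans _ _ (h / (1 + h) * (expR (l n) * expR (l n)))); last first.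
    by rewrite ler_wpM2l // divr_ge0 // ltW.
  rewrite mulrA ler_wpM2r ?(ltW el) // mulrAC ler_pdivlMr //.
  by move: g; rewrite ler_pdivrMr // => g; lra.
have zh : 2 * (h / 4) + 12 / l n ^+ 2 <= h.
  have lh : 24 / h <= l n by near: n; apply: near_loglog.
  have : 12 / l n ^+ 2 <= h / 2.
    rewrite ler_pdivrMr //; move: lh; rewrite ler_pdivrMr // => lh.
    have : l n <= l n ^+ 2 by rewrite expr2 ler_peMl ?(ltW l0) //; lra.
    by move=> /(ler_wpM2r (ltW h0)); lra.
  lra.
have z0 : 0 < h / 4 by rewrite divr_gt0.
apply: (le_trans (@erE_good _ _ (vertex1 n) _ _ _ _ _ _ q0 aE e0 e4 h0 h8 l4 la ak' _ qh z0 zh)).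
rewrite cV; set L := last_fraction _ _ _ in L0 *.
have Lp : 0 < L by apply: lt_le_trans L0; rewrite invr_gt0 mulr_gt0.
have t1 : expR (- n%:R) <= eps / 4.
  have g : 4 / eps * l n ^+ 0 <= expR (1 * l n) by near: n; apply: near_growth.
  rewrite mul1r expr0 mulr1 in g.
  rewrite expRN -[leRHS]invrK lef_pV2 ?posrE ?invr_gt0 ?divr_gt0 ?expR_gt0 // invf_div.
  apply: (le_trans g); apply: (le_trans nl); apply: le_trans (expR_ge1Dx _); by rewrite lerDr.
have t2 : 2 / l n <= eps / 4.
  have g : 8 / eps <= l n by near: n; apply: near_loglog.
  by rewrite ler_pdivrMr //; move: g; rewrite ler_pdivrMr //; lra.
have t3 : 8 / ((h / 4) ^+ 2 * a n) <= eps / 4.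
  have g : 32 / eps / (h / 4) ^+ 2 / al0 * l n ^+ 0 <= expR (1 * l n) by near: n; apply: near_growth.
  rewrite mul1r expr0 mulr1 ler_pdivrMr // [_ * al0]mulrC in g.
  have z2 : 0 < (h / 4) ^+ 2 by rewrite exprn_gt0.
  have := le_trans g a0; rewrite ler_pdivrMr // ler_pdivrMr // => g'.
  rewrite ler_pdivrMr; last exact: mulr_gt0 z2 ap.
  move: g'; set zz := (h / 4) ^+ 2 => g'.
  have -> : eps / 4 * (zz * a n) = a n * zz * eps / 4 by ring.
  by rewrite ler_pdivlMr //; apply: le_trans g'; lra.
have t4 : 2 / (h ^+ 2 * (n%:R * L)) <= eps / 4.
  have h2 : 0 < h ^+ 2 by rewrite exprn_gt0.
  have g : 16 / eps / h ^+ 2 * l n ^+ 2 <= expR (1 * l n) by near: n; apply: near_growth.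
  rewrite mul1r in g; have := le_trans g nl.
  have -> : 16 / eps / h ^+ 2 * l n ^+ 2 = 16 * l n ^+ 2 / (eps * h ^+ 2) by field; rewrite !gt_eqF.
  rewrite ler_pdivrMr ?mulr_gt0 // => g'.
  have nL : n%:R / (2 * l n ^+ 2) <= n%:R * L by rewrite ler_wpM2l // ltW.
  rewrite ler_pdivrMr ?mulr_gt0 //.
  apply: (@le_trans _ _ (eps / 4 * (h ^+ 2 * (n%:R / (2 * l n ^+ 2))))); last first.
    by rewrite !ler_wpM2l // ?(ltW h2) // divr_ge0 // ltW.
  have -> : eps / 4 * (h ^+ 2 * (n%:R / (2 * l n ^+ 2))) = n%:R * (eps * h ^+ 2) / (8 * l n ^+ 2).
    by field; rewrite gt_eqF.
  by rewrite ler_pdivlMr ?mulr_gt0 //; lra.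
lra.
Unshelve. all: by end_near. Qed.

Local Notation W1n beta n E := (W1 (hamming E (vertex1 n)) (gibbs_inf R E (vertex1 n))
  (gibbs (beta * l n) E (vertex1 n))).

Lemma near_mean_small : \forall n \near \oo, forall k, scaled n k ->
  a n * expR (- (l n ^+ 2 / 160)) <= 1.
Proof.
near=> n => k [_ _ l4 /andP[_ a1] _]; have el := expR_gt0 (l n).
have l320 : 320 <= l n by near: n; apply: near_loglog.
have g1 : al1 * l n ^+ 0 <= expR (1 * l n) by near: n; apply: near_growth.
rewrite expr0 mulr1 mul1r in g1.
rewrite expRN ler_pdivrMr ?expR_gt0 // mul1r; apply: (le_trans a1).
apply: (@le_trans _ _ (expR (l n) * expR (l n))); first by rewrite ler_wpM2r // ltW.
by rewrite -expRD ler_expR ler_pdivlMr // expr2; nra.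
Unshelve. all: by end_near. Qed.

Lemma near_exp_small (s x : R) : 0 < s -> 0 < x -> \forall n \near \oo, forall k, scaled n k ->
  2 * expR (- (s * x * n%:R / 4)) <= x / 2.
Proof.
move=> s0 x0; near=> n => k /scaledP[_ _ _ nl _].
have sx : 0 < s * x by rewrite mulr_gt0.
have g3 : 16 / x / (s * x) * l n ^+ 0 <= expR (1 * l n) by near: n; apply: near_growth.
rewrite expr0 mulr1 mul1r in g3.
have := le_trans g3 nl; rewrite ler_pdivrMr // => xn.
rewrite expRN -[leRHS]invrK -[2 * _]invrK lef_pV2 ?posrE ?invr_gt0 ?mulr_gt0 ?invr_gt0 ?expR_gt0 //.
rewrite !invf_div ler_pdivlMr //.
apply: le_trans (expR_ge1Dx _); rewrite [leLHS](_ : _ = 16 / x / 4); last by field; rewrite gt_eqF.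
lra.
Unshelve. all: by end_near. Qed.

(** Weights are ignored: [exp (- wt)] is bounded by one. The sum of the factors is then at most
    about [n l exp ((1 - Delta - beta + g) l)], and [g] is half the gap, so [exp (- g l)] is left to
    beat the powers of [l]. *)
Lemma near_low_steep (Delta beta x : R) : 0 <= Delta <= 1 ->
  Delta_ alpha n @[n --> \oo] --> Delta -> 0 < beta -> 1 - Delta < beta -> 0 < x ->
  \forall n \near \oo, forall k (E : {set {set vertex n}}), scaled n k -> E \subset vertex_pairs (vertex n) ->
  good (vertex1 n) k (q n) (a n) 4^-1 8^-1 (l n) E -> W1n beta n E <= x * n%:R.
Proof.
move=> /andP[D0 D1] cD b0 bD x0; pose g := (beta - (1 - Delta)) / 2.
have g0 : 0 < g by rewrite divr_gt0 // subr_gt0.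
have rate0 : 0 <= 1 - Delta + g by lra.
have s0 : 0 < 2^-1 :> R by [].
have nms := near_mean_small; have nes := near_exp_small s0 x0.
near=> n => k E Hs EP EG.
have [l0 ap q0 nl [aE ak']] := scaledP Hs.
have [cV nE l4 /andP[a0 a1] [la ak L0 yE _]] := Hs.
have el := expR_gt0 (l n); have n0 : 0 < n%:R :> R by rewrite nE expR_gt0.
have e0 : 0 < 4^-1 :> R by [].
have e4 : 4^-1 <= 4^-1 :> R by [].
have h8 : 8^-1 <= 8^-1 :> R by [].
have s2 : 2^-1 <= 2^-1 :> R by [].
have bl : 0 <= beta * l n by rewrite mulr_ge0 // ltW.
have asm : a n * expR (- (l n ^+ 2 / 160)) <= 1.
  by apply: (near nms n _ k).
pose T : R := 2 * (3 / 4^-1 ^+ 2 + 2) * n%:R / last_mean (vertex n) k (a n).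
have TT : \sum_(v | nonroot E (vertex1 n) v && (k.+1 < gdist E (vertex1 n) v)%N)
   expR (- ((1 - 2^-1) * wt R E (vertex1 n) v)) /
     #|choices E (vertex1 n) (gdist E (vertex1 n)) v|%:R <= T.
  rewrite /T -cV; apply: le_trans (inv_choices_tail1 q0 aE e0 e4 h8 l4 la EG).
  apply: ler_sum => v _; rewrite ler_piMl ?invr_ge0 // -[leRHS]expR0 ler_expR oppr_le0.
  by rewrite mulr_ge0 ?wt_ge0 //; lra.
rewrite -cV; apply: (W1_low_good q0 aE e0 e4 h8 l4 la ak' EP EG bl s0 s2 asm TT x0); rewrite !cV.
  have y0 : 0 < last_mean (vertex n) k (a n) by rewrite yE expR_gt0.
  have a_ge1 : 1 <= a n.
    by apply: le_trans la; rewrite exprn_ege1 //; lra.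
  have lna : 0 <= ln (a n) by rewrite ln_ge0.
  have al1p : 1 <= 1 + `|al1| by rewrite lerDl.
  pose A1 := 1 + `|al1|.
  have lna2 : ln (a n) <= l n + ln A1.
    rewrite -ler_expR lnK ?posrE // expRD lnK ?posrE; last by rewrite /A1; lra.
    apply: (le_trans a1); rewrite mulrC ler_wpM2l ?(ltW el) //.
    by have := ler_norm al1; rewrite /A1; lra.
  have Dg : Delta - g < Delta_ alpha n by near: n; apply: (cvgr_gt Delta cD); lra.
  have ay : a n / last_mean (vertex n) k (a n) <= expR ((1 - Delta + g) * (l n + ln A1)).
    rewrite yE -{1}[a n](lnK) ?posrE // -expRN -expRD ler_expR.
    rewrite -{1}[ln (a n)]mul1r -mulrBl; apply: le_trans (ler_wpM2l rate0 lna2).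
    by rewrite ler_wpM2r //; lra.
  set y := last_mean _ _ _ in T TT ay y0 *.
  have -> : 2 * a n * T = n%:R * (200 * (a n / y)) by rewrite /T; field; rewrite gt_eqF.
  rewrite -mulrDr mulrCA [leRHS](_ : _ = n%:R * (2^-1 * x / 4)); last by ring.
  rewrite ler_wpM2l //.
  pose c1 := expR ((1 - Delta + g) * ln A1).
  have g2 : 8 / x * expR (1 + 2^-1) * (206 + 200 * c1) * l n ^+ 1 <= expR (g * l n).
    by near: n; apply: near_growth.
  rewrite expr1 in g2.
  apply: (@le_trans _ _ (expR (1 + 2^-1 - beta * l n) * ((206 + 200 * c1) * l n * expR ((1 - Delta + g) * l n)))).
    rewrite ler_wpM2l ?expR_ge0 //.
    have E1 : 1 <= expR ((1 - Delta + g) * l n) by rewrite -[leLHS]expR0 ler_expR; apply: mulr_ge0 rate0 (ltW l0).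
    have -> : 2 * l n + 12 + 12 / 4^-1 ^+ 2 = 2 * l n + 204 by field.
    by apply: steep_bound => //; rewrite /c1 ?expR_ge0 // -expRD -mulrDr [ln A1 + _]addrC.
  have -> : 1 + 2^-1 - beta * l n = (1 + 2^-1) + (- (g * l n) - (1 - Delta + g) * l n).
    by rewrite /g; field.
  rewrite !expRD !expRN; set E1 := expR ((1 - Delta + g) * l n); set E2 := expR (g * l n) in g2 *.
  have E10 : 0 < E1 by apply: expR_gt0.
  have E20 : 0 < E2 by apply: expR_gt0.
  have -> : expR 1 * expR 2^-1 * (E2^-1 / E1) * ((206 + 200 * c1) * l n * E1) =
     expR 1 * expR 2^-1 * (206 + 200 * c1) * l n / E2 by field; rewrite !gt_eqF.
  rewrite ler_pdivrMr // -expRD.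
  have -> : 2^-1 * x / 4 * E2 = x / 8 * E2 by field.
  move: g2; have -> : 8 / x * expR (1 + 2^-1) * (206 + 200 * c1) * l n =
     expR (1 + 2^-1) * (206 + 200 * c1) * l n / (x / 8) by field; rewrite gt_eqF.
  by rewrite ler_pdivrMr ?divr_gt0 // [E2 * _]mulrC.
by apply: (near nes n _ k).
Unshelve. all: by end_near. Qed.

End Scale.

(** * Numerical inequalities and the remaining regimes *)

Lemma flat_bound (R : realType) (l u z : R) : 4 <= l -> 0 <= u ->
  2 * l + 12 + 12 * u + 2 * (z + 6 * u + (3 * u + 2) * (4 * l ^+ 2)) <=
  (30 + 48 * u) * l ^+ 2 + 2 * z.
Proof.
move=> l4 u0; have l16 : 4 * l <= l ^+ 2 by rewrite expr2 ler_wpM2r //; lra.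
have := ler_wpM2l u0 l16; have := ler_wpM2l u0 l4; lra.
Qed.

(** Instance [s = h = f] and [e = f ^ 2 / 4] of the rate in [sharp_tail]: all the losses together
    cost at most [12 f]. *)
Lemma flat_rate_ge (R : realType) (f : R) : 0 < f -> f <= 24^-1 ->
  1 - 12 * f <= (1 - f) * ((1 - 2 * (f ^+ 2 / 4)) * (1 - f ^+ 2 / 4 - f) / ((1 + f) * (1 + 5 * f))).
Proof.
move=> f0 f24; rewrite mulrA ler_pdivlMr ?mulr_gt0 //; try lra.
have f2 : 0 <= f ^+ 2 by rewrite sqr_ge0.
have f3 : f ^+ 2 <= f / 24 by rewrite expr2 ler_wpM2l // ltW.
apply: (@le_trans _ _ (1 - 6 * f)).
  have -> : (1 - 12 * f) * ((1 + f) * (1 + 5 * f)) = 1 - 6 * f - 67 * f ^+ 2 - 60 * (f * f ^+ 2) by ring.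
  have : 0 <= f * f ^+ 2 by rewrite mulr_ge0 // ltW.
  lra.
have A : 1 - 2 * f <= (1 - 2 * (f ^+ 2 / 4)) * (1 - f ^+ 2 / 4 - f).
  have : 0 <= 2 * (f ^+ 2 / 4) * (f ^+ 2 / 4 + f) by rewrite mulr_ge0 //; lra.
  lra.
have f1 : 0 <= 1 - f by lra.
have := ler_wpM2l f1 A; lra.
Qed.

Lemma theta_le (R : realType) (d : R) : 0 < d -> d < 1 ->
  (1 + d / 128 / 2) / (1 - 2 * (d / 128)) * (1 + 2 * (d / 128)) / (1 - 3 * (d / 64)) <= 1 + d / 8.
Proof.
move=> d0 d1; rewrite ler_pdivrMr; last by lra.
rewrite mulrAC ler_pdivrMr; last by lra.
have dd : d * d <= d by rewrite ler_piMr // ltW.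
have dd0 : 0 <= d * d by rewrite mulr_ge0 // ltW.
have ddd : d * d * d <= d * d by rewrite ler_piMr // ltW.
have ddd0 : 0 <= d * d * d by rewrite mulr_ge0 // ltW.
lra.
Qed.

(** The exponents compared are [beta + Delta] on the left and [1 - (1 + g) / c] on the right. Of the
    margin [2 eta], one part covers the error in [Delta] and the other the powers of [l] and the
    additive error. *)
Lemma top_bound (R : realType) (beta Delta eta g c x e al c1 l a y : R) :
  0 < beta -> 0 <= Delta -> 0 < eta -> 0 < x -> 0 < c -> 0 < e -> 0 < al -> 0 <= c1 -> 4 <= l ->
  al * expR l <= a -> y <= c1 * expR ((Delta + eta) * l) ->
  (1 + g) * l / c <= (1 - beta - Delta - 2 * eta) * l ->
  16 * (3 * c1 + 1 + 15 * x / (4 * e)) / (x * c ^+ 2 * al) * l ^+ 3 <= expR (eta * l) ->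
  expR (beta * l) * (3 * y + l / 2) <=
  x * (c ^+ 2 * a / (16 * l ^+ 2) * expR (- ((1 + g) * l / c)) - 15 / (4 * e)).
Proof.
move=> b0 D0 eta0 x0 c0 e0 al0 c10 l4 ala yc gc gr.
have l0 : 0 < l by lra.
have l20 : 0 < l ^+ 2 by rewrite exprn_gt0.
have c20 : 0 < c ^+ 2 by rewrite exprn_gt0.
pose F := expR ((beta + Delta + eta) * l).
have F1 : 1 <= F by rewrite /F -[leLHS]expR0 ler_expR mulr_ge0 ?(ltW l0) //; lra.
have bF : expR (beta * l) <= F by rewrite /F ler_expR ler_wpM2r ?(ltW l0) //; lra.
have lhs : expR (beta * l) * (3 * y + l / 2) <= (3 * c1 + l / 2) * F.
  apply: (@le_trans _ _ (3 * c1 * F + l / 2 * F)); last by rewrite -mulrDl lexx.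
  rewrite mulrDr; apply: lerD; last by rewrite mulrC ler_wpM2l // divr_ge0 // ltW.
  have -> : F = expR (beta * l) * expR ((Delta + eta) * l).
    by rewrite /F -expRD -mulrDl addrA.
  by have := ler_wpM2l (expR_ge0 (beta * l)) yc; lra.
set w := 15 * x / (4 * e) in gr; have w0 : 0 < w by rewrite divr_gt0 // mulr_gt0.
set B := 3 * c1 + 1 + w in gr.
have B0 : 0 < B by rewrite /B; lra.
have rhs : F * (B * l) <= x * (c ^+ 2 * a / (16 * l ^+ 2) * expR (- ((1 + g) * l / c))).
  apply: (@le_trans _ _ (x * c ^+ 2 * al / (16 * l ^+ 2) * (F * expR (eta * l)))).
    rewrite [leRHS](_ : _ = F * (x * c ^+ 2 * al / (16 * l ^+ 2) * expR (eta * l))); last by ring.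
    rewrite ler_wpM2l ?expR_ge0 //.
    have k0 : 0 < x * c ^+ 2 * al / (16 * l ^+ 2) by rewrite divr_gt0 ?mulr_gt0.
    have := ler_wpM2l (ltW k0) gr; apply: le_trans.
    by rewrite le_eqVlt; apply/orP; left; apply/eqP; field; rewrite !gt_eqF.
  have -> : F * expR (eta * l) = expR l * expR (- ((1 - beta - Delta - 2 * eta) * l)).
    by rewrite /F -!expRD; congr expR; ring.
  have E1 : expR (- ((1 - beta - Delta - 2 * eta) * l)) <= expR (- ((1 + g) * l / c)).
    by rewrite ler_expR lerN2.
  have -> : x * (c ^+ 2 * a / (16 * l ^+ 2) * expR (- ((1 + g) * l / c))) =
    x * c ^+ 2 / (16 * l ^+ 2) * (a * expR (- ((1 + g) * l / c))) by ring.
  have -> : x * c ^+ 2 * al / (16 * l ^+ 2) * (expR l * expR (- ((1 - beta - Delta - 2 * eta) * l))) =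
    x * c ^+ 2 / (16 * l ^+ 2) * (al * expR l * expR (- ((1 - beta - Delta - 2 * eta) * l))) by ring.
  rewrite ler_wpM2l ?divr_ge0 ?mulr_ge0 ?(ltW x0) ?(ltW l0) ?(ltW c0) //.
  by apply: ler_pM => //; rewrite ?mulr_ge0 ?expR_ge0 // ltW.
apply: (le_trans lhs); rewrite mulrBr; have -> : x * (15 / (4 * e)) = w by rewrite /w; ring.
have : (3 * c1 + l / 2) * F + w <= F * (B * l).
  have : w <= w * F by rewrite ler_peMr // ltW.
  have : (3 * c1 + l / 2 + w) * F <= (B * l) * F.
    rewrite ler_wpM2r ?expR_ge0 // /B.
    have cl : c1 <= c1 * l by rewrite ler_peMr //; lra.
    have wl : w <= w * l by rewrite ler_peMr ?(ltW w0) //; lra.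
    lra.
  lra.
lra.
Qed.

(** The bound from the level [D] is good for large [L], the one from the next level for small [L].
    In their sum [L] cancels up to a multiple of [d], and [1 - Q] exceeds all the errors. *)
Lemma high_sum (R : realType) (d L K t1 t2 t3 t4 t5 Q w : R) :
  0 < d -> d < 1 -> 0 <= L -> L <= 1 -> Q <= (1 + d / 8) * (1 - 15 / 16 * d) ->
  t1 <= d / 64 -> t2 <= d / 64 -> t3 <= d / 64 -> t4 <= d / 64 -> t5 <= d / 64 ->
  (1 - 3 * (d / 64)) * L - t1 - 3 * (d / 64) <= w ->
  1 - t2 - (1 + 5 * (d / 64)) * L - t3 - Q - t4 - t5 - 4 * (d / 64) - d / 16 <= w ->
  d / 8 < w.
Proof.
move=> d0 d1 L0 L1 HQ h1 h2 h3 h4 h5 H1 H2.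
have dL : d * L <= d by rewrite ler_piMr // ltW.
have dd : 0 <= d * d by rewrite mulr_ge0 // ltW.
lra.
Qed.

Lemma flat_small (R : realType) (l e c L : R) : 4 <= l -> 0 < e -> 2 / e <= l -> 4 * c / e <= l ->
  L <= c / l -> 4 / l ^+ 2 + 2 * L <= e.
Proof.
move=> l4 e0 l1 l2 Lc; have l0 : 0 < l by lra.
have l20 : 0 < l ^+ 2 by rewrite exprn_gt0.
rewrite ler_pdivrMr // in l1; rewrite ler_pdivrMr // in l2.
have t1 : 4 / l ^+ 2 <= e / 2.
  rewrite ler_pdivrMr //; have l44 : 4 * l <= l ^+ 2 by rewrite expr2 ler_wpM2r // ltW.
  by have := ler_wpM2r (ltW e0) l44; lra.
have t2 : L <= e / 4 by apply: (le_trans Lc); rewrite ler_pdivrMr //; lra.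
lra.
Qed.

Lemma cubic_le (R : realType) (l : R) : 4 <= l -> (l / 2 + 3) * (4 * l ^+ 2) <= 8 * l ^+ 3.
Proof.
move=> l4; have l0 : 0 < l by lra.
have l20 : 0 < l ^+ 2 by rewrite exprn_gt0.
rewrite [_ ^+ 3]exprSr; have := ler_wpM2r (ltW l20) l4; have := mulr_gt0 l20 l0; lra.
Qed.

Lemma drift_le (R : realType) (b l x n : R) : 32 <= l * (b * x) -> 0 <= n ->
  7 * n - b * l * x * n / 4 <= - n.
Proof. by move=> bx n0; have := ler_wpM2r n0 bx; lra. Qed.

Section Scale.
Variables (R : realType) (alpha : nat -> R) (al0 al1 : R).
Hypothesis al0_gt0 : 0 < al0.
Local Notation l := (loglog R).
Local Notation q := (q_ alpha).
Local Notation a := (mean_degree alpha).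
Local Notation scaled := (scaled alpha al0 al1).
Local Notation W1n beta n E := (W1 (hamming E (vertex1 n)) (gibbs_inf R E (vertex1 n))
  (gibbs (beta * l n) E (vertex1 n))).

(** Here [L] is at most [(kap + f) / l], so weights on the level [D] are at least about [l / kap].
    The assumption is that the exponent [1 - beta - (1 - 12 f) / (kap + f)], which is [- w], is
    negative. *)
Lemma near_low_flat (kap beta x f : R) : 0 < beta -> 0 <= kap -> 0 < x ->
  (kappa_ alpha n)%:E @[n --> \oo] --> kap%:E -> 0 < f -> f <= 24^-1 ->
  (kap + f) * (1 - beta) < 1 - 12 * f ->
  \forall n \near \oo, forall k (E : {set {set vertex n}}), scaled n k ->
  E \subset vertex_pairs (vertex n) ->
  good (vertex1 n) k (q n) (a n) (f ^+ 2 / 4) f (l n) E -> W1n beta n E <= x * n%:R.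
Proof.
move=> b0 kap0 x0 /fine_cvgP[_ ck] f0 f24 kb.
have kf : 0 < kap + f by lra.
pose w := (1 - 12 * f - (kap + f) * (1 - beta)) / (kap + f).
have w0 : 0 < w by rewrite divr_gt0 // subr_gt0.
pose e := f ^+ 2 / 4; have f2 : 0 < f ^+ 2 by rewrite exprn_gt0.
have e0 : 0 < e by rewrite divr_gt0.
have e4 : e <= 4^-1.
  have : f ^+ 2 <= 1 by rewrite expr_le1 ?(ltW f0) //; lra.
  by rewrite /e; lra.
have ef : 4 * e <= f ^+ 2 by rewrite /e; lra.
have h8 : f <= 8^-1 by lra.
have s2 : f <= 2^-1 by lra.
have f12 : 0 <= 1 - 12 * f by lra.
have f4 : f <= 4^-1 by lra.
have e20 : 0 < e ^+ 2 by rewrite exprn_gt0.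
pose u := (e ^+ 2)^-1; have u0 : 0 <= u by rewrite invr_ge0 ltW.
have nms := @near_mean_small _ alpha al0 al1; have nes := @near_exp_small _ alpha al0 al1 al0_gt0 _ _ f0 x0.
near=> n => k E Hs EP EG.
have [l0 ap q0 nl [aE ak']] := scaledP al0_gt0 Hs.
have [cV nE l4 /andP[a0 a1] [la ak L0 yE LE]] := Hs.
have n0 : 0 < n%:R :> R by rewrite nE expR_gt0.
have bl : 0 <= beta * l n by rewrite mulr_ge0 // ltW.
have asm : a n * expR (- (l n ^+ 2 / 160)) <= 1 by apply: (near nms n _ k).
have esm : 2 * expR (- (f * x * n%:R / 4)) <= x / 2 by apply: (near nes n _ k).
have l20 : 0 < l n ^+ 2 by rewrite exprn_gt0.
set L := last_fraction _ _ _ in L0 LE.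
have L_gt0 : 0 < L by apply: lt_le_trans L0; rewrite invr_gt0 mulr_gt0.
have Ll : L <= (kap + f) / l n.
  rewrite ler_pdivlMr // LE -/(kappa_ alpha n); apply: ltW; near: n.
  by apply: (cvgr_lt kap ck); rewrite ltrDl.
have Le : 4 / l n ^+ 2 + 2 * L <= e.
  have l1 : 2 / e <= l n by near: n; apply: near_loglog.
  have l2 : 4 * (kap + f) / e <= l n by near: n; apply: near_loglog.
  exact: flat_small l4 e0 l1 l2 Ll.
have la2 : (l n / 2 + 3) * (4 * l n ^+ 2) <= e ^+ 2 * a n.
  have g : 8 / (e ^+ 2 * al0) * l n ^+ 3 <= expR (1 * l n) by near: n; apply: near_growth.
  rewrite mul1r mulrAC ler_pdivrMr ?mulr_gt0 // in g.
  apply: (le_trans (cubic_le l4)); apply: (le_trans g).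
  by rewrite mulrC -mulrA ler_wpM2l // ltW.
have TT := sharp_tail q0 aE e0 e4 f0 h8 l4 la ak' L0 EG f0 s2 f0 f4 ef Le la2.
rewrite -cV; apply: (W1_low_good q0 aE e0 e4 h8 l4 la ak' EP EG bl f0 s2 asm TT x0); rewrite cV -/L // -/u.
set Z := expR (- (_ / L)).
have -> : 2 * a n * (n%:R * Z + 6 * u * (n%:R / a n) + (3 * u + 2) * n%:R * (4 * l n ^+ 2) / a n) =
  n%:R * (2 * (a n * Z + 6 * u + (3 * u + 2) * (4 * l n ^+ 2))).
  by field; rewrite gt_eqF.
rewrite -mulrDr mulrCA [leRHS](_ : _ = n%:R * (f * x / 4)); last by ring.
rewrite ler_wpM2l //.
apply: (@le_trans _ _ (expR (1 + f - beta * l n) * ((30 + 48 * u) * l n ^+ 2 + 2 * (a n * Z)))).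
  rewrite ler_wpM2l ?expR_ge0 //; exact: flat_bound.
have fx : 0 < f * x / 8 by rewrite divr_gt0 // mulr_gt0.
rewrite mulrDr [leRHS](_ : _ = f * x / 8 + f * x / 8); last by field.
apply: lerD.
  have g : expR (1 + f) * (30 + 48 * u) / (f * x / 8) * l n ^+ 2 <= expR (beta * l n).
    by near: n; apply: near_growth.
  rewrite mulrAC ler_pdivrMr // in g.
  by rewrite expRD expRN mulrAC ler_pdivrMr ?expR_gt0 // [leLHS]mulrA [leRHS]mulrC.
have g : expR (1 + f) * 2 * al1 / (f * x / 8) * l n ^+ 0 <= expR (w * l n).
  by near: n; apply: near_growth.
rewrite expr0 mulr1 ler_pdivrMr // in g.
have ZZ : Z <= expR (- ((1 - 12 * f) * l n / (kap + f))).
  rewrite /Z ler_expR lerN2.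
  have fr := flat_rate_ge f0 f24; rewrite -/e in fr.
  set th := (1 - f) * _ in fr *.
  apply: (@le_trans _ _ ((1 - 12 * f) / L)); last by rewrite ler_wpM2r // invr_ge0 ltW.
  rewrite -mulrA ler_wpM2l // -[leLHS]invrK lef_pV2 ?posrE ?invr_gt0 ?divr_gt0 // invf_div //.
have AZ : a n * Z <= al1 * expR (l n - (1 - 12 * f) * l n / (kap + f)).
  rewrite expRD mulrA; apply: ler_pM => //; [exact: ltW | exact: expR_ge0].
apply: (@le_trans _ _ (expR (1 + f - beta * l n) * (2 * (al1 * expR (l n - (1 - 12 * f) * l n / (kap + f)))))).
  by rewrite ler_wpM2l ?expR_ge0 // ler_wpM2l.
have -> : expR (1 + f - beta * l n) * (2 * (al1 * expR (l n - (1 - 12 * f) * l n / (kap + f)))) =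
   expR (1 + f) * 2 * al1 / expR (w * l n).
  have mulE (c1 c2 A B : R) : A * (c1 * (c2 * B)) = c1 * c2 * (A * B) by ring.
  rewrite mulE -expRD [RHS]mulrC.
  have -> : 1 + f - beta * l n + (l n - (1 - 12 * f) * l n / (kap + f)) = (1 + f) + (- (w * l n)).
    by rewrite /w; field; rewrite gt_eqF.
  by rewrite expRD [expR (- _)]expRN; ring.
by rewrite ler_pdivrMr ?expR_gt0 // [leRHS]mulrC.
Unshelve. all: by end_near. Qed.


Lemma near_mean_ge (A : R) (j : nat) : \forall n \near \oo, forall k, scaled n k ->
  A * l n ^+ j <= a n.
Proof.
near=> n => k [_ _ _ /andP[a0 _] _]; apply: le_trans a0.
have g : A / al0 * l n ^+ j <= expR (1 * l n) by near: n; apply: near_growth.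
by rewrite mul1r mulrAC ler_pdivrMr // mulrC [_ * al0]mulrC in g; rewrite mulrC.
Unshelve. all: by end_near. Qed.

Lemma near_n_ge (A : R) (j : nat) : \forall n \near \oo, forall k, scaled n k ->
  A * l n ^+ j <= n%:R.
Proof.
near=> n => k /(scaledP al0_gt0)[_ _ _ nl _]; apply: le_trans nl.
by rewrite -[l n in leRHS]mul1r; near: n; apply: near_growth.
Unshelve. all: by end_near. Qed.

Lemma near_top_bound (Delta beta g x e c : R) : 0 <= Delta -> Delta_ alpha n @[n --> \oo] --> Delta ->
  0 < beta -> 0 < 1 - beta - Delta -> 0 < g -> g <= 2^-1 -> 0 < x -> 0 < e ->
  c = (1 + 2 * g) / (1 - beta - Delta) -> \forall n \near \oo, forall k, scaled n k ->
  expR (beta * l n) * (3 * last_mean (vertex n) k (a n) + l n / 2) <=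
  x * (c ^+ 2 * a n / (16 * l n ^+ 2) * expR (- ((1 + g) * l n / c)) - 15 / (4 * e)).
Proof.
move=> D0 cD b0 gam0 g0 g2 x0 e0; set gam := 1 - beta - Delta in gam0 * => cE.
(* With this margin, [(1 + g) / c <= gam - 2 eta] reduces to [0 <= g (1 / 2 - g)]. *)
pose eta := gam * g / 4; have eta0 : 0 < eta by rewrite divr_gt0 // mulr_gt0.
pose A1 := 1 + `|al1|; have A10 : 1 <= A1 by rewrite lerDl.
pose c1 := expR ((Delta + eta) * ln A1).
near=> n => k Hs; have [l0 ap q0 nl _] := scaledP al0_gt0 Hs.
have [_ _ l4 /andP[a0 a1] [la _ _ yE _]] := Hs.
have g10 : 0 < 1 + 2 * g by lra.
have c0 : 0 < c by rewrite cE divr_gt0.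
apply: (@top_bound _ beta Delta eta g c x e al0 c1) => //.
  exact: expR_ge0.
  have a_ge1 : 1 <= a n by apply: le_trans la; rewrite exprn_ege1 //; lra.
  have lna : 0 <= ln (a n) by rewrite ln_ge0.
  have lna2 : ln (a n) <= l n + ln A1.
    rewrite -ler_expR lnK ?posrE // expRD lnK ?posrE; last by lra.
    apply: (le_trans a1); rewrite mulrC ler_wpM2l ?expR_ge0 //.
    by have := ler_norm al1; rewrite /A1; lra.
  rewrite yE /c1 -expRD -mulrDr [ln A1 + _]addrC ler_expR.
  have Dg : Delta_ alpha n < Delta + eta by near: n; apply: (cvgr_lt Delta cD); rewrite ltrDl.
  apply: (@le_trans _ _ ((Delta + eta) * ln (a n))); first by rewrite ler_wpM2r // ltW.
  by rewrite ler_wpM2l //; lra.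
  rewrite -/gam cE invf_div mulrAC ler_wpM2r ?(ltW l0) //.
  rewrite mulrA ler_pdivrMr //.
  have -> : (gam - 2 * eta) * (1 + 2 * g) = gam * ((1 - g / 2) * (1 + 2 * g)) by rewrite /eta; field.
  rewrite mulrC ler_wpM2l ?(ltW gam0) //.
  have : 0 <= g * (2^-1 - g) by rewrite mulr_ge0 ?(ltW g0) // subr_ge0.
  lra.
  by near: n; apply: near_growth.
Unshelve. all: by end_near. Qed.


(** Since [c] is nearly [1 / (1 - beta - Delta)], the proportion lost to children of [top] is nearly
    [1 / ((1 - beta - Delta) kappa_n)]; the last hypothesis keeps it below [1 - 15 / 16 d]. *)
Lemma near_high (Delta beta d : R) : 0 <= Delta -> Delta_ alpha n @[n --> \oo] --> Delta ->
  0 < beta -> 0 < d -> d <= 1 - beta - Delta ->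
  (\forall n \near \oo, 1 <= (1 - 15 / 16 * d) * ((1 - beta - Delta) * kappa_ alpha n)) ->
  \forall n \near \oo, forall k (E : {set {set vertex n}}), scaled n k ->
  E \subset vertex_pairs (vertex n) ->
  good (vertex1 n) k (q n) (a n) (d / 128) (d / 64) (l n) E -> d / 8 * n%:R < W1n beta n E.
Proof.
move=> D0 cD b0 d0; set gam := 1 - beta - Delta => dgam nk.
have gam0 : 0 < gam by lra.
have d1 : d < 1 by move: dgam; rewrite /gam; lra.
(* All tolerances are small fractions of [d], so that [high_sum] applies; [tau = 8 / d] turns the
   variance term [n / (2 tau)] into [d n / 16], while [tau K] is still [o(n)]. *)
pose e := d / 128; pose h := d / 64; pose x := d / 64; pose g := d / 128; pose tau := 8 / d.
pose c := (1 + 2 * g) / gam.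
have e0 : 0 < e by rewrite divr_gt0.
have x0 : 0 < x by rewrite divr_gt0.
have g0 : 0 < g by rewrite divr_gt0.
have tau0 : 0 < tau by rewrite divr_gt0.
have e4 : e <= 4^-1 by rewrite /e; lra.
have h8 : h <= 8^-1 by rewrite /h; lra.
have g2 : g <= 2^-1 by rewrite /g; lra.
have c0 : 0 < c by rewrite divr_gt0 //; lra.
have e20 : 0 < e ^+ 2 by rewrite exprn_gt0.
have h30 : 0 < 1 - 3 * h by rewrite /h; lra.
have e120 : 0 < 1 - 2 * e by rewrite /e; lra.
have th0 : 0 <= (1 + e / 2) / (1 - 2 * e) * (1 + 2 * g) / (1 - 3 * h).
  by rewrite !mulr_ge0 ?invr_ge0 ?(ltW h30) ?(ltW e120) //; rewrite /e /g; lra.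
have d64 : 0 < d / 64 by rewrite divr_gt0.
have bx0 : 0 < beta * x / 4 by rewrite divr_gt0 // mulr_gt0.
have ntop := near_top_bound D0 cD b0 gam0 g0 g2 x0 e0 (erefl c).
have m1 := near_mean_ge 128 2.
have m2 := near_mean_ge (192 / (x * e ^+ 2)) 2.
have m3 := near_mean_ge (48 / e ^+ 2) 3.
have m4 := near_mean_ge (4 * (1 + g) / (g * c)) 1.
have m5 := near_mean_ge (12 / e ^+ 2 * (64 / d)) 2.
have m6 := near_mean_ge (4 * (1 / e + 3 / e ^+ 2) * (64 / d)) 3.
have n1 := near_n_ge 16 2.
have n2 := near_n_ge (2 / c) 1.
have n3 := near_n_ge x^-1 0.
near=> n => k E Hs EP EG.
have [l0 ap q0 nl [aE ak']] := scaledP al0_gt0 Hs.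
have [cV nE l4 /andP[a0 a1] [la ak L0 _ LE]] := Hs.
have nn : 0 < n%:R :> R by rewrite nE expR_gt0.
have bl : 0 <= beta * l n by rewrite mulr_ge0 // ltW.
have l20 : 0 < l n ^+ 2 by rewrite exprn_gt0.
have a2l : a n <= expR (2 * l n).
  have gr : al1 * l n ^+ 0 <= expR (1 * l n) by near: n; apply: near_growth.
  rewrite expr0 mulr1 mul1r in gr; apply: (le_trans a1).
  have -> : 2 * l n = l n + l n by rewrite mulr_natl mulr2n.
  by rewrite expRD ler_wpM2r ?expR_ge0.
have n16 : 16 * l n ^+ 2 <= #|vertex n|%:R by rewrite cV; apply: (near n1 n _ k).
have a128 : 128 * l n ^+ 2 <= a n by apply: (near m1 n _ k).
have p1 : 192 * l n ^+ 2 <= x * e ^+ 2 * a n.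
  have m : 192 / (x * e ^+ 2) * l n ^+ 2 <= a n by apply: (near m2 n _ k).
  by rewrite mulrAC ler_pdivrMr ?mulr_gt0 // in m; rewrite [leRHS]mulrC.
have p2 : 48 * l n ^+ 3 <= e ^+ 2 * a n.
  have m : 48 / e ^+ 2 * l n ^+ 3 <= a n by apply: (near m3 n _ k).
  by rewrite mulrAC ler_pdivrMr // in m; rewrite [leRHS]mulrC.
have rl : 128 * l n ^+ 2 <= expR (beta * l n * x / 4).
  have -> : beta * l n * x / 4 = beta * x / 4 * l n by ring.
  by near: n; apply: near_growth.
have es : expR (7 * #|vertex n|%:R - beta * l n * x * #|vertex n|%:R / 4) <= x.
  rewrite cV; have lb : 32 / (beta * x) <= l n by near: n; apply: near_loglog.
  rewrite ler_pdivrMr ?mulr_gt0 // in lb.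
  apply: (@le_trans _ _ (expR (- n%:R))).
    by rewrite ler_expR drift_le // ltW.
  rewrite expRN -[leRHS]invrK lef_pV2 ?posrE ?invr_gt0 ?expR_gt0 //.
  apply: le_trans (expR_ge1Dx _); apply: (@le_trans _ _ n%:R); last by rewrite lerDr.
  by rewrite -[leLHS]mulr1 -(expr0 (l n)); apply: (near n3 n _ k).
have K2 : 2 * l n <= c * #|vertex n|%:R.
  have m : 2 / c * l n ^+ 1 <= n%:R by apply: (near n2 n _ k).
  by rewrite mulrAC ler_pdivrMr // expr1 in m; rewrite cV [leRHS]mulrC.
have Kl : 4 * l n * (1 + g) <= g * c * a n.
  have m : 4 * (1 + g) / (g * c) * l n ^+ 1 <= a n by apply: (near m4 n _ k).
  rewrite expr1 in m; have gc0 : 0 < g * c by rewrite mulr_gt0.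
  have := ler_wpM2l (ltW gc0) m.
  by have -> : g * c * (4 * (1 + g) / (g * c) * l n) = 4 * l n * (1 + g) by field; rewrite !gt_eqF.
have tp' : expR (beta * l n) * (3 * last_mean (vertex n) k (a n) + l n / 2) <=
  x * (c ^+ 2 * a n / (16 * l n ^+ 2) * expR (- ((1 + g) * l n / c)) - 15 / (4 * e)) by apply: (near ntop n _ k).
have H1 := W1_high_good_level q0 aE e0 e4 h8 l4 la ak' EP EG bl x0 c0 g0 a2l es K2 Kl tp'.
have H2 := W1_high_good_next q0 aE e0 e4 h8 l4 la ak' L0 EP EG bl x0 c0 g0 tau0 a2l n16 a128
  p1 p2 rl es K2 Kl tp'.
have xh : x = h by [].
rewrite !cV xh in H1 H2; set w := W1n beta n E in H1 H2 *; set L := last_fraction _ _ _ in L0 LE H1 H2.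
rewrite -ltr_pdivlMr //.
have L_gt0 : 0 < L by apply: lt_le_trans L0; rewrite invr_gt0 mulr_gt0.
have L_le1 : L <= 1 by rewrite LE gerBl expR_ge0.
have kn : 1 <= (1 - 15 / 16 * d) * (gam * (L * l n)).
  by rewrite LE -/(kappa_ alpha n); near: n.
pose Q := (1 + e / 2) / (1 - 2 * e) * (c / ((1 - 3 * h) * (l n * L))).
have HQ : Q <= (1 + d / 8) * (1 - 15 / 16 * d).
  have -> : Q = (1 + e / 2) / (1 - 2 * e) * (1 + 2 * g) / (1 - 3 * h) * (gam * (L * l n))^-1.
    by rewrite /Q /c; field; rewrite !gt_eqF.
  have th := theta_le d0 d1; have gL : 0 < gam * (L * l n) by rewrite !mulr_gt0.
  by apply: ler_pM => //; [rewrite invr_ge0 ltW | rewrite -[leLHS]mul1r ler_pdivrMr].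
have lc : (tau / 2 + 1) * c / (d / 64) <= l n by near: n; apply: near_loglog.
have t5 : (tau / 2 + 1) * c / l n <= d / 64.
  by rewrite ler_pdivrMr //; move: lc; rewrite ler_pdivrMr // [l n * _]mulrC.
have t1 : c / l n <= d / 64.
  have cl : 0 <= c / l n by exact: ltW (divr_gt0 c0 l0).
  apply: le_trans t5; rewrite -mulrA ler_peMl // lerDr.
  exact: ltW (divr_gt0 tau0 _).
have t2 : 4 / l n ^+ 2 <= d / 64.
  have ld : 64 / d <= l n by near: n; apply: near_loglog.
  rewrite ler_pdivrMr // in ld; rewrite ler_pdivrMr //.
  have l44 : 4 * l n <= l n ^+ 2 by rewrite expr2 ler_wpM2r // ltW.
  have -> : d / 64 * l n ^+ 2 = l n ^+ 2 * d / 64 by ring.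
  rewrite ler_pdivlMr //; apply: le_trans (ler_wpM2r (ltW d0) l44).
  by rewrite -mulrA ler_wpM2l.
have t3 : 12 * l n ^+ 2 / (e ^+ 2 * a n) <= d / 64.
  rewrite ler_pdivrMr ?(mulr_gt0 e20 ap) //.
  have : 12 / e ^+ 2 * (64 / d) * l n ^+ 2 <= a n by apply: (near m5 n _ k).
  have -> : 12 / e ^+ 2 * (64 / d) * l n ^+ 2 = 12 * l n ^+ 2 / (e ^+ 2 * (d / 64)).
    by field; rewrite !gt_eqF.
  have -> : d / 64 * (e ^+ 2 * a n) = a n * (e ^+ 2 * (d / 64)) by ring.
  by rewrite ler_pdivrMr // mulr_gt0.
have t4 : 4 * l n ^+ 2 * (l n / e + 3 / e ^+ 2) / a n <= d / 64.
  have m6' : 4 * (1 / e + 3 / e ^+ 2) * (64 / d) * l n ^+ 3 <= a n by apply: (near m6 n _ k).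
  rewrite ler_pdivrMr // -ler_pdivrMl //; apply: le_trans m6'.
  rewrite invf_div [_ ^+ 3]exprSr.
  set u := 3 / e ^+ 2; have u0 : 0 <= u by rewrite divr_ge0 // ltW.
  have -> : 4 * (1 / e + u) * (64 / d) * (l n ^+ 2 * l n) = 64 / d * (4 * l n ^+ 2 * (l n / e + u * l n)) by ring.
  rewrite ler_wpM2l ?divr_ge0 ?(ltW d0) // ler_wpM2l ?mulr_ge0 ?(ltW l0) // lerD2l ler_peMr //.
  by apply: le_trans l4; rewrite ler1n.
apply: (@high_sum R d L c (c / l n) (4 / l n ^+ 2) (12 * l n ^+ 2 / (e ^+ 2 * a n))
  (4 * l n ^+ 2 * (l n / e + 3 / e ^+ 2) / a n) ((tau / 2 + 1) * c / l n) Q) => //; try exact: ltW.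
  rewrite ler_pdivlMr // -/h; apply: le_trans H1.
  by rewrite le_eqVlt; apply/orP; left; apply/eqP; field; rewrite gt_eqF.
rewrite ler_pdivlMr // -/h; apply: le_trans H2; rewrite -/Q.
have -> : n%:R / (2 * tau) = d / 16 * n%:R by rewrite /tau; field; rewrite gt_eqF.
have -> : (tau / 2 + 1) * (c * n%:R / l n) = (tau / 2 + 1) * c / l n * n%:R by ring.
have -> : 4 * n%:R / l n ^+ 2 = 4 / l n ^+ 2 * n%:R by ring.
set s3 := 12 * _ / _; set s4 := 4 * l n ^+ 2 * _ / _; set s5 := _ / l n; set s2 := 4 / _.
by rewrite le_eqVlt; apply/orP; left; apply/eqP; ring.
Unshelve. all: by end_near. Qed.

End Scale.

(** * From good graphs to limits of probabilities *)

Section Limit.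
Variables (R : realType) (alpha : nat -> R) (al0 al1 : R).
Hypothesis al0_gt0 : 0 < al0.
Hypothesis alpha_bounds : \forall n \near \oo, al0 <= alpha n <= al1.
Variables (e h : R).
Hypothesis e_gt0 : 0 < e.
Hypothesis e_le : e <= 4^-1.
Hypothesis h_gt0 : 0 < h.
Hypothesis h_le : h <= 8^-1.
Local Notation l := (loglog R).
Local Notation q := (q_ alpha).
Local Notation a := (mean_degree alpha).
Local Notation scaled := (scaled alpha al0 al1).

Lemma near_q : \forall n \near \oo, 0 <= q n <= 1.
Proof.
near=> n; have [k Hs] : exists k, scaled n k by near: n; exact: near_scaled.
have [l0 ap q0 nl _] := scaledP al0_gt0 Hs; rewrite (ltW q0) /=.
have [_ nE l4 /andP[_ a1] _] := Hs; have n0 : 0 < n%:R :> R by rewrite nE expR_gt0.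
have qE : q n = a n / n%:R by rewrite /mean_degree mulrAC mulfV ?mul1r // gt_eqF.
rewrite qE ler_pdivrMr // mul1r; apply: (le_trans a1).
have g1 : 2 * l n ^+ 1 <= expR (1 * l n) by near: n; apply: near_growth.
have g0 : al1 * l n ^+ 0 <= expR (1 * l n) by near: n; apply: near_growth.
rewrite mul1r expr1 in g1; rewrite mul1r expr0 mulr1 in g0.
apply: (@le_trans _ _ (expR (l n) * expR (l n))); first by rewrite ler_wpM2r ?expR_ge0.
by rewrite nE -expRD ler_expR; apply: le_trans g1; rewrite mulr_natl mulr2n.
Unshelve. all: by end_near. Qed.

Lemma er_prob_cvg0 (A : forall n, pred (graph n)) :
  (\forall n \near \oo, forall k (E : {set {set vertex n}}), scaled n k ->
    E \subset vertex_pairs (vertex n) -> good (vertex1 n) k (q n) (a n) e h (l n) E -> ~~ A n E) ->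
  er_prob (q n) (A n) @[n --> \oo] --> (0 : R).
Proof.
move=> HA; apply/cvgrPdist_le => eps eps0.
have ng := near_good alpha al1 al0_gt0 e_gt0 e_le h_gt0 h_le eps0.
near=> n; have [k Hs] : exists k, scaled n k by near: n; exact: near_scaled.
have /andP[q0 q1] : 0 <= q n <= 1 by near: n; exact: near_q.
have ge0 : 0 <= er_prob (q n) (A n) by rewrite er_probE; apply: erE_ge0.
rewrite sub0r normrN ger0_norm // er_probE.
have ngn : erE (q n) (fun E => (~~ good (vertex1 n) k (q n) (a n) e h (l n) E)%:R) <= eps.
  by apply: (near ng n _ k).
apply: le_trans ngn; apply: erE_le => // E EP; rewrite ler_nat.
have [G|_] := boolP (good _ _ _ _ _ _ _ _); last exact: leq_b1.
have nA : ~~ A n E by apply: (near HA n _ k E).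
by rewrite (negbTE nA).
Unshelve. all: by end_near. Qed.

Lemma er_prob_cvg1 (A : forall n, pred (graph n)) :
  (\forall n \near \oo, forall k (E : {set {set vertex n}}), scaled n k ->
    E \subset vertex_pairs (vertex n) -> good (vertex1 n) k (q n) (a n) e h (l n) E -> A n E) ->
  er_prob (q n) (A n) @[n --> \oo] --> (1 : R).
Proof.
move=> HA; have c0 : er_prob (q n) (predC (A n)) @[n --> \oo] --> (0 : R).
  apply: er_prob_cvg0; apply: filterS HA => n HA k E Hs EP G.
  by rewrite /= negbK; apply: HA EP G.
have c1 : 1 - er_prob (q n) (predC (A n)) @[n --> \oo] --> (1 - 0 : R) by apply: cvgB => //; apply: cvg_cst.
rewrite subr0 in c1; apply: cvg_trans c1; apply: near_eq_cvg.
near=> n; rewrite !er_probE; apply/eqP; rewrite subr_eq -erED.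
rewrite [X in X == _](_ : _ = erE (q n) (fun _ : {set {set vertex n}} => 1)); last first.
  by rewrite erE_cst.
apply/eqP; congr (erE _ _).
by apply/funext => E /=; case: (A n E); rewrite /= ?addr0 ?add0r.
Unshelve. all: by end_near. Qed.

End Limit.

Lemma scaled_W1_ge0 (R : realType) (beta : R) n (E : graph n) : 0 <= scaled_W1 beta E.
Proof. by rewrite divr_ge0 // W1_ge0. Qed.

(** If [Delta] were positive, then eventually [y >= 1] and [1 - lambda_n >= 1 / 2], so [kappa_n]
    would be at least [l / 2] and unbounded. *)
Lemma kappa_finite_Delta (R : realType) (alpha : nat -> R) (al0 al1 kap Delta : R) : 0 < al0 ->
  (\forall n \near \oo, al0 <= alpha n <= al1) ->
  (kappa_ alpha n)%:E @[n --> \oo] --> kap%:E -> Delta_ alpha n @[n --> \oo] --> Delta -> Delta <= 0.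
Proof.
move=> al00 ab /fine_cvgP[_ ck] cD; rewrite leNgt; apply/negP => D0.
have F : \forall n \near \oo, False.
  near=> n; have [k Hs] : exists k, scaled alpha al0 al1 n k by near: n; exact: near_scaled.
  have [l0 ap _ _ _] := scaledP al00 Hs; have [_ _ l4 _ [la _ _ yE LE]] := Hs.
  have Dn : 0 < Delta_ alpha n by near: n; apply: (cvgr_gt Delta cD).
  have lk : 4 * (`|kap| + 1) <= loglog R n by near: n; apply: near_loglog.
  have kl : kappa_ alpha n < kap + 1 by near: n; apply: (cvgr_lt kap ck); rewrite ltrDl.
  have a1 : 1 <= mean_degree alpha n by apply: le_trans la; rewrite exprn_ege1 //; lra.
  have y1 : 1 <= last_mean (vertex n) k (mean_degree alpha n).
    by rewrite yE -[leLHS]expR0 ler_expR mulr_ge0 ?ln_ge0 // ltW.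
  have L2 : 2^-1 <= 1 - lambda_ alpha n.
    rewrite -LE /last_fraction; have : expR (- last_mean (vertex n) k (mean_degree alpha n)) <= 2^-1.
      rewrite expRN lef_pV2 ?posrE ?expR_gt0 //; apply: le_trans (expR_ge1Dx _).
      by move: y1; lra.
    by lra.
  have := ler_wpM2r (ltW l0) L2; move: kl; rewrite /kappa_; have := ler_norm kap.
  by move: lk; lra.
by have [n []] := filter_ex F.
Unshelve. all: by end_near. Qed.

Theorem theorem1p11 (R : realType) :
  exists C : R -> R, (forall delta : R, 0 < delta -> 0 < C delta) /\
  forall (alpha : nat -> R) (Delta lambda : R) (kappa : \bar R) (beta : R),
    (forall n : nat, (0 < n)%N -> 0 < alpha n) ->
    (0 < limn_einf (fun n => (alpha n)%:E))%E ->
    (limn_esup (fun n => (alpha n)%:E) < +oo)%E ->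
    0 <= Delta <= 1 -> Delta_ alpha n @[n --> \oo] --> Delta ->
    0 <= lambda <= 1 -> lambda_ alpha n @[n --> \oo] --> lambda ->
    (0 <= kappa)%E -> (kappa_ alpha n)%:E @[n --> \oo] --> kappa ->
    0 < beta ->
    ((beta_c Delta kappa < beta%:E)%E ->
       forall eps : R, 0 < eps ->
         er_prob (q_ alpha n) (fun E : graph n => eps < `|scaled_W1 beta E|)
           @[n --> \oo] --> (0 : R)) /\
    ((beta%:E < beta_c Delta kappa)%E ->
       er_prob (q_ alpha n)
         (fun E : graph n => C (fine (beta_c Delta kappa) - beta) < scaled_W1 beta E)
         @[n --> \oo] --> (1 : R)).
Proof.
(* The constant is the one delivered by [high_sum]. *)
exists (fun d => d / 8); split=> [d d0|]; first by rewrite divr_gt0.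
move=> alpha Delta lambda kappa beta _ /liminf_bound[al0 al00 nal0] /limsup_bound[al1 nal1].
move=> /andP[D0 D1] cD _ _ k0 ck b0.
have ab : \forall n \near \oo, al0 <= alpha n <= al1.
  by apply: filterS2 nal0 nal1 => n -> ->.
have nn : \forall n \near \oo, 0 < n%:R :> R.
  by near=> n; rewrite ltr0n; near: n; exact: nbhs_infty_gt.
split.
  move=> bc eps eps0.
  (* Above [1 - Delta] the number of choices alone suffices. Otherwise [beta_c < beta] forces
     [kappa] to be finite, hence [Delta = 0], and the weights have to be used. *)
  have [bD|bD] := ltP (1 - Delta) beta.
    apply: (@er_prob_cvg0 R alpha al0 al1 al00 ab 4^-1 8^-1) => //; last first.
    have low := @near_low_steep R alpha al0 al1 al00 Delta beta eps _ cD b0 bD eps0.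
    apply: filterS2 nn (low _) => [n n0 H k E Hs EP G|]; last by rewrite D0 D1.
    rewrite -leNgt ger0_norm ?scaled_W1_ge0 // /scaled_W1 ler_pdivrMr //.
    exact: H Hs EP G.
  have [kap kapE] : exists kap : R, kappa = kap%:E.
    case: kappa bc k0 {ck} => [kap|/=|] bc k0; [by exists kap | | by []].
    by move: bc; rewrite /beta_c invey sube0 -EFinB lte_fin ltNge bD.
  rewrite {}kapE in ck bc k0; rewrite lee_fin in k0.
  have DE : Delta = 0.
    by apply/eqP; rewrite eq_le D0 andbT; apply: kappa_finite_Delta al00 ab ck cD.
  have kb : kap * (1 - beta) < 1.
    have [->|kn0] := eqVneq kap 0; first by rewrite mul0r.
    move: bc; rewrite /beta_c inver (negbTE kn0) DE -!EFinB lte_fin subr0.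
    have kp : 0 < kap by rewrite lt0r kn0.
    by move=> bk; rewrite mulrC -ltr_pdivlMr // div1r; lra.
  (* As [1 - beta] is at most one, replacing [kap] by [kap + f] costs at most [f], so the rate
     condition follows from [13 f < 1 - kap (1 - beta)]. *)
  pose f := Num.min 24^-1 ((1 - kap * (1 - beta)) / 32).
  have f0 : 0 < f by rewrite lt_min invr_gt0 ltr0n /= divr_gt0 // subr_gt0.
  have f24 : f <= 24^-1 by rewrite ge_min lexx.
  have f32 : f <= (1 - kap * (1 - beta)) / 32 by rewrite ge_min lexx orbT.
  have kf : (kap + f) * (1 - beta) < 1 - 12 * f.
    have : f * (1 - beta) <= f by rewrite ler_piMr ?(ltW f0) //; lra.
    by lra.
  have f2 : f ^+ 2 <= 1 by rewrite expr_le1 ?(ltW f0) //; lra.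
  apply: (@er_prob_cvg0 R alpha al0 al1 al00 ab (f ^+ 2 / 4) f) => //; [| | |].
        by rewrite divr_gt0 // exprn_gt0.
      by lra.
    by lra.
  have low := @near_low_flat R alpha al0 al1 al00 kap beta eps f b0 k0 eps0 ck f0 f24 kf.
  apply: filterS2 nn low => n n0 H k E Hs EP G.
  rewrite -leNgt ger0_norm ?scaled_W1_ge0 // /scaled_W1 ler_pdivrMr //.
  exact: H Hs EP G.
move=> bc; set d := fine (beta_c Delta kappa) - beta.
(* For finite [kappa] the number [1 - beta - Delta] is [d + 1 / kappa], so its product with
   [kappa_n] tends to [1 + d kappa]; for infinite [kappa] it diverges. *)
have [d0 dg nk] : [/\ 0 < d, d <= 1 - beta - Delta &
   \forall n \near \oo, 1 <= (1 - 15 / 16 * d) * ((1 - beta - Delta) * kappa_ alpha n)].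
  case: kappa bc k0 ck @d => [kap||//] bc k0 ck d.
    have kn0 : kap != 0.
      by apply: contraTneq bc => ->; rewrite /beta_c inve0.
    rewrite lee_fin in k0; have kp : 0 < kap by rewrite lt0r kn0.
    have dE : d = 1 - Delta - kap^-1 - beta by rewrite /d /beta_c inver (negbTE kn0).
    clearbody d; move: bc; rewrite /beta_c inver (negbTE kn0) -!EFinB lte_fin => bc.
    have d0 : 0 < d by rewrite dE subr_gt0.
    have kv : 0 < kap^-1 by rewrite invr_gt0.
    split => //; first by rewrite dE; lra.
    move: ck => /fine_cvgP[_ ck].
    have dd : 1 - beta - Delta = d + kap^-1 by rewrite dE; lra.
    have d1 : d + kap^-1 < 1 by rewrite -dd; lra.
    have lim : (1 - 15 / 16 * d) * (d + kap^-1) * kappa_ alpha n @[n --> \oo] -->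
        (1 - 15 / 16 * d) * (d + kap^-1) * kap by apply: cvgMr.
    (* The inequality amounts to [15 / 16 d (d + 1 / kap) < d], which holds because
       [d + 1 / kap < 1]; any fraction up to one would do here. *)
    have gt1 : 1 < (1 - 15 / 16 * d) * (d + kap^-1) * kap.
      rewrite -ltr_pdivrMr // div1r.
      have : d * (d + kap^-1) < d by rewrite gtr_pMr.
      by lra.
    apply: filterS (cvgr_gt _ lim _ gt1) => n; rewrite dd => /ltW.
    by rewrite -[X in 1 <= X -> _]mulrA.
  have dE : 1 - beta - Delta = d by rewrite /d /beta_c invey sube0 /=; lra.
  have d0 : 0 < d.
    by move: bc; rewrite -dE /beta_c invey sube0 -EFinB lte_fin; lra.
  clearbody d.
  split => //; first by rewrite dE.
  have d1 : d < 1 by rewrite -dE; lra.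
  have c0 : 0 < (1 - 15 / 16 * d) * d by rewrite mulr_gt0 //; lra.
  apply: filterS (cvgey_ge ck ((1 - 15 / 16 * d) * d)^-1) => n; rewrite lee_fin dE => kn.
  by rewrite mulrA -ler_pdivrMl // mulr1.
have d1 : d < 1 by lra.
apply: (@er_prob_cvg1 R alpha al0 al1 al00 ab (d / 128) (d / 64)) => //; [by lra|by lra|by lra|by lra|].
have high := @near_high R alpha al0 al1 al00 Delta beta d D0 cD b0 d0 dg nk.
apply: filterS2 nn high => n n0 H k E Hs EP G.
by rewrite /scaled_W1 ltr_pdivlMr //; exact: H Hs EP G.
Unshelve. all: by end_near. Qed.
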